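(* Let $1<p<2$. Then $$M_p(r)-\left(\frac{1}{1-r^{2/(2-p)}}\right)^{1-p/2}\to 0\quad\text{as } r\to1^-.$$
   Context: $\mathbb{D}=\{z\in\mathbb{C}:|z|<1\}$. $\mathcal{B}$ is the class of analytic functions $f(z)=\sum_{k=0}^\infty a_kz^k$ on $\mathbb{D}$ with $|f(z)|<1$ for all $z\in\mathbb{D}$. For $p>0$ and $f\in\mathcal{B}$, $M_p^f(r)=\sum_{k=0}^\infty |a_k|^p r^k$, and $M_p(r):=\sup_{f\in\mathcal{B}}M_p^f(r)$. *)

(* Defs.v *)
From Stdlib Require Import Reals.
From Coquelicot Require Import Coquelicot.

Open Scope R_scope.

(* [x ^ p] for [0 <= x] and [0 < p].  [Rpower 0 p] equals [1], because [ln 0 = 0],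
   so the value at [0] has to be set separately. *)
Definition npow (x p : R) : R := if Req_EM_T x 0 then 0 else Rpower x p.

(* The class B.  The values of [fn] outside the unit disk are irrelevant; [coef] is
   determined by [fn] on the disk. *)
Record classB : Type := ClassB {
  fn : C -> C;
  coef : nat -> C;
  fn_expansion : forall z : C, Cmod z < 1 ->
    @is_pseries C_AbsRing C_NormedModule coef z (fn z);
  fn_bound : forall z : C, Cmod z < 1 -> Cmod (fn z) < 1
}.

(* [Cmod (coef f k) <= 1] for all [k], so for [0 <= r < 1] this series converges, with
   sum at most [1 / (1 - r)]; hence neither [Series] here nor [real] below takes its
   default value. *)
Definition Mf (p : R) (f : classB) (r : R) : R :=
  Series (fun k : nat => npow (Cmod (coef f k)) p * r ^ k).

Definition M (p r : R) : R :=
  real (Lub_Rbar (fun x : R => exists f : classB, x = Mf p f r)).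

(* Main.v *)
Require Import Defs.
From Stdlib Require Import Reals.
From Coquelicot Require Import Coquelicot.
From Stdlib Require Import Lra Lia Psatz ZArith.

(** Put q = r^(2/(2-p)), l = -ln q and w_k = (1-q) q^k, so that r^k = (w_k/(1-q))^(1-p/2),
    and T = (1/(1-q))^(1-p/2).  Young's inequality, term by term, bounds |a_k|^p r^k by
    T (p/2 |a_k|^2 + (1-p/2) w_k) ([young_upper]).  Since the sum of |a_k|^2 is at most 1
    for a function of the class ([classB_coef_sq]), and so is that of w_k, the supremum
    M_p(r) is at most T.

    Young's inequality is an equality where |a_k|^2 = w_k, and there the same function has
    a tangent from below: |a_k|^p r^k >= T ((1-p) w_k + p Re(a_k conj b_k)) whenever
    |b_k|^2 = w_k ([tangent_lower], [Mf_lower]).  It is thus enough to find a function of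
    the class for which the sum of Re(a_k conj b_k) is 1 up to an error sqrt l times a
    power of log(1/l).  As T is of order l^(-(1-p/2)) and 1-p/2 < 1/2 for p > 1, the gap
    then tends to 0 ([lower_bound], [gap_small]).

    For b_k take the chirp sqrt(w_k) exp(i (2 PI/l) q^k), k < K.  On the circle, at
    z = exp(ix), the k-th term of its generating polynomial f0 has a phase with derivative
    x - 2 PI q^k in k; for 0 < x < 2 PI there is exactly one stationary point, and the
    frequencies sweep the circle at the rate 2 PI w_k.  By stationary phase
    | |f0(z)| - 1 | <= eta/|1-z| with eta of order sqrt l log(1/l) ([chirp_sum],
    [f0_circle]).  To bring f0 into the class it is multiplied by a polynomial h, made of
    Fejer kernels at dyadic scales, such that |h| <= exp(-eta/|1-z|) while |1-h| is only
    of order eta log(1/l)/|1-z| ([damping]).  Then |f0 h| <= 1 ([damped_bound]), and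
    Parseval's identity on roots of unity shows that passing from f0 to f0 h costs
    only sqrt l times logarithms in the inner product with f0 ([damped_inner]).

    The stationary phase estimate compares each term of the sum with the increment of
    the Fresnel integral in the coordinate in which the phase is y^2/2 ([cell]).  The
    difference is a cubic error plus the difference of two consecutive unimodular numbers
    times a weight of bounded variation, which is summed by parts ([weight_block]); the
    few terms at the stationary point are bounded trivially.  The same comparison for a
    Gauss sum, whose modulus is known by completing the square ([gauss_sum]), shows that
    the complete Fresnel integral has modulus sqrt(2 PI) ([fresnel_const]). *)

Open Scope R_scope.

(** * Finite sums *)

Fixpoint rsum (f : nat -> R) (n : nat) : R :=
  match n with O => 0 | S m => rsum f m + f m end.

Fixpoint csum (f : nat -> C) (n : nat) : C :=
  match n with O => RtoC 0 | S m => (csum f m + f m)%C end.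

Lemma rsum_ext f g n : (forall k, (k < n)%nat -> f k = g k) -> rsum f n = rsum g n.
Proof. induction n; simpl; intros H; [easy|]. rewrite IHn, H; auto; lia. Qed.

Lemma rsum_le f g n : (forall k, (k < n)%nat -> f k <= g k) -> rsum f n <= rsum g n.
Proof. induction n; simpl; intros H; [lra|]. apply Rplus_le_compat; auto. Qed.

Lemma rsum_plus f g n : rsum (fun k => f k + g k) n = rsum f n + rsum g n.
Proof. induction n; simpl; [ring|]. rewrite IHn; ring. Qed.

Lemma rsum_scal c f n : rsum (fun k => c * f k) n = c * rsum f n.
Proof. induction n; simpl; [ring|]. rewrite IHn; ring. Qed.

Lemma rsum_const c n : rsum (fun _ => c) n = INR n * c.
Proof. induction n; [simpl; ring|]. simpl rsum; rewrite IHn, S_INR; ring. Qed.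

Lemma rsum_ge0 f n : (forall k, (k < n)%nat -> 0 <= f k) -> 0 <= rsum f n.
Proof. induction n; simpl; intros H; [lra|]. apply Rplus_le_le_0_compat; auto. Qed.

Lemma rsum_le_bound f c n : (forall k, (k < n)%nat -> f k <= c) -> rsum f n <= INR n * c.
Proof. intros H. rewrite <- rsum_const. now apply rsum_le. Qed.

Lemma rsum_term_le f n k :
  (forall j, (j < n)%nat -> 0 <= f j) -> (k < n)%nat -> f k <= rsum f n.
Proof.
  induction n; intros H Hk; [lia|]; simpl.
  destruct (Nat.eq_dec k n) as [->|Hne].
  - assert (0 <= rsum f n) by (apply rsum_ge0; auto). lra.
  - assert (f k <= rsum f n) by (apply IHn; auto; lia). assert (0 <= f n) by auto. lra.
Qed.

Lemma rsum_add f m n : rsum f (m + n) = rsum f m + rsum (fun k => f (m + k)%nat) n.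
Proof.
  induction n; simpl; [rewrite Nat.add_0_r; ring|].
  rewrite Nat.add_succ_r; simpl; rewrite IHn; ring.
Qed.

Lemma rsum_telescope f n : rsum (fun k => f (S k) - f k) n = f n - f O.
Proof. induction n; simpl; [ring|]. rewrite IHn; ring. Qed.

Lemma rsum_sum_n f n : sum_n f n = rsum f (S n).
Proof.
  induction n; [rewrite sum_O; symmetry; apply Rplus_0_l|].
  rewrite sum_Sn, IHn; reflexivity.
Qed.

Lemma csum_ext f g n : (forall k, (k < n)%nat -> f k = g k) -> csum f n = csum g n.
Proof. induction n; simpl; intros H; [easy|]. rewrite IHn, H; auto; lia. Qed.

Lemma csum_plus f g n : csum (fun k => f k + g k)%C n = (csum f n + csum g n)%C.
Proof. induction n; simpl; [ring|]. rewrite IHn; ring. Qed.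

Lemma csum_minus f g n : csum (fun k => f k - g k)%C n = (csum f n - csum g n)%C.
Proof. induction n; simpl; [ring|]. rewrite IHn; ring. Qed.

Lemma csum_scal c f n : csum (fun k => c * f k)%C n = (c * csum f n)%C.
Proof. induction n; simpl; [ring|]. rewrite IHn; ring. Qed.

Lemma csum_const c n : csum (fun _ => c) n = (RtoC (INR n) * c)%C.
Proof. induction n; [simpl; ring|]. simpl csum; rewrite IHn, S_INR, RtoC_plus; ring. Qed.

Lemma csum_add f m n : csum f (m + n) = (csum f m + csum (fun k => f (m + k)%nat) n)%C.
Proof.
  induction n; simpl; [rewrite Nat.add_0_r; ring|].
  rewrite Nat.add_succ_r; simpl; rewrite IHn; ring.
Qed.

Lemma csum_telescope f n : csum (fun k => f (S k) - f k)%C n = (f n - f O)%C.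
Proof. induction n; simpl; [ring|]. rewrite IHn; ring. Qed.

Lemma csum_conj f n : Cconj (csum f n) = csum (fun k => Cconj (f k)) n.
Proof.
  induction n; simpl; [|rewrite Cplus_conj, IHn; ring].
  unfold Cconj; simpl. rewrite Ropp_0; reflexivity.
Qed.

Lemma csum_swap (f : nat -> nat -> C) m n :
  csum (fun i => csum (fun j => f i j) n) m = csum (fun j => csum (fun i => f i j) m) n.
Proof.
  induction m; simpl.
  - rewrite (csum_const 0 n). ring.
  - rewrite IHm, <- csum_plus. reflexivity.
Qed.

Lemma Re_csum f n : Re (csum f n) = rsum (fun k => Re (f k)) n.
Proof. induction n; simpl; [reflexivity|]. rewrite <- IHn. reflexivity. Qed.

Lemma RtoC_rsum f n : RtoC (rsum f n) = csum (fun k => RtoC (f k)) n.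
Proof. induction n; simpl; [reflexivity|]. rewrite RtoC_plus, IHn. reflexivity. Qed.

Lemma Cmod_csum f n : Cmod (csum f n) <= rsum (fun k => Cmod (f k)) n.
Proof.
  induction n; simpl; [rewrite Cmod_0; lra|].
  eapply Rle_trans; [apply Cmod_triangle|lra].
Qed.

Lemma csum_single f n k :
  (k < n)%nat -> (forall j, (j < n)%nat -> j <> k -> f j = 0%R :> C) -> csum f n = f k.
Proof.
  induction n; intros Hk H; [lia|]; simpl.
  destruct (Nat.eq_dec k n) as [->|Hne].
  - rewrite (csum_ext _ (fun _ => RtoC 0)), csum_const; [ring|].
    intros j Hj; apply H; lia.
  - rewrite IHn, (H n); [ring|lia|lia|lia|]. intros j Hj Hjk; apply H; auto.
Qed.

Lemma csum_zero_tail f m n : (m <= n)%nat ->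
  (forall k, (m <= k)%nat -> f k = 0%R :> C) -> csum f n = csum f m.
Proof.
  intros Hmn H. replace n with (m + (n - m))%nat by lia. rewrite csum_add.
  rewrite (csum_ext (fun k => f (m + k)%nat) (fun _ => RtoC 0)).
  - rewrite csum_const. ring.
  - intros k _. apply H. lia.
Qed.

(** * Points of the unit circle *)

Definition cis (x : R) : C := (cos x, sin x).

Lemma cis_plus x y : cis (x + y) = (cis x * cis y)%C.
Proof. unfold cis, Cmult; simpl. rewrite cos_plus, sin_plus. f_equal; ring. Qed.

Lemma cis_0 : cis 0 = 1%R.
Proof. unfold cis. rewrite cos_0, sin_0. reflexivity. Qed.

Lemma cis_opp x : cis (- x) = Cconj (cis x).
Proof. unfold cis, Cconj; simpl. rewrite cos_neg, sin_neg. reflexivity. Qed.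

Lemma cis_minus x y : cis (x - y) = (cis x * Cconj (cis y))%C.
Proof. unfold Rminus. rewrite cis_plus, cis_opp. reflexivity. Qed.

Lemma Cmod_cis x : Cmod (cis x) = 1.
Proof.
  unfold Cmod, cis; simpl.
  replace (_ + _) with 1; [apply sqrt_1|].
  pose proof (sin2_cos2 x) as H; unfold Rsqr in H; lra.
Qed.

Lemma cis_pow x n : (cis x ^ n)%C = cis (INR n * x).
Proof.
  induction n; [simpl; rewrite Rmult_0_l, cis_0; reflexivity|].
  simpl Cpow. rewrite IHn, <- cis_plus, S_INR. f_equal; ring.
Qed.

Lemma cis_2PI_INR n : cis (2 * PI * INR n) = 1%R.
Proof.
  unfold cis. rewrite <- (Rplus_0_l (2 * PI * INR n)).
  replace (0 + 2 * PI * INR n) with (0 + 2 * INR n * PI) by ring.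
  rewrite cos_period, sin_period, cos_0, sin_0. reflexivity.
Qed.

Lemma Cmod2_Re_Im z : Cmod z ^ 2 = Re z ^ 2 + Im z ^ 2.
Proof. apply Cmod2_alt. Qed.

Lemma Cmod_sq_le z r : 0 <= r -> Cmod z ^ 2 <= r ^ 2 -> Cmod z <= r.
Proof. intros Hr H. nra. Qed.

Lemma Cmod_1_minus_cis_sq x : Cmod (1 - cis x) ^ 2 = 2 - 2 * cos x.
Proof.
  rewrite Cmod2_Re_Im. unfold cis, Cminus; simpl.
  pose proof (sin2_cos2 x) as H; unfold Rsqr in H. nra.
Qed.

Lemma Cmod_1_minus_cis x : Cmod (1 - cis x) = 2 * Rabs (sin (x / 2)).
Proof.
  assert (H : Cmod (1 - cis x) ^ 2 = (2 * Rabs (sin (x / 2))) ^ 2).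
  { rewrite Cmod_1_minus_cis_sq.
    replace x with (2 * (x / 2)) at 1 by field. rewrite cos_2a_sin.
    rewrite Rpow_mult_distr, pow2_abs. ring. }
  pose proof (Cmod_ge_0 (1 - cis x)). pose proof (Rabs_pos (sin (x / 2))). nra.
Qed.

Lemma Rabs_sin_le x : Rabs (sin x) <= Rabs x.
Proof.
  destruct (Req_dec x 0) as [->|Hx]; [rewrite sin_0; lra|].
  destruct (MVT_abs sin cos 0 x) as [c [Hc _]].
  { intros c _. apply derivable_pt_lim_sin. }
  rewrite sin_0, !Rminus_0_r in Hc. rewrite Hc.
  pose proof (COS_bound c). assert (Rabs (cos c) <= 1) by (apply Rabs_le; lra).
  pose proof (Rabs_pos x). nra.
Qed.

Lemma Cmod_1_minus_cis_le x : Cmod (1 - cis x) <= Rabs x.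
Proof.
  rewrite Cmod_1_minus_cis. pose proof (Rabs_sin_le (x / 2)).
  unfold Rdiv in *. rewrite Rabs_mult, (Rabs_pos_eq (/ 2)) in H by lra. lra.
Qed.

Lemma Cmod_cis_minus a b : Cmod (cis a - cis b) <= Rabs (a - b).
Proof.
  replace (cis a - cis b)%C with (- (cis b * (1 - cis (a - b))))%C.
  - rewrite Cmod_opp, Cmod_mult, Cmod_cis, Rmult_1_l. apply Cmod_1_minus_cis_le.
  - replace a with (b + (a - b)) at 2 by ring. rewrite (cis_plus b). ring.
Qed.

Lemma sin_lower x : 0 <= x <= PI / 2 -> 2 / PI * x <= sin x.
Proof.
  intros [H0 H1].
  destruct (Rle_lt_dec x 0) as [Hx|Hx].
  { replace x with 0 by lra. rewrite sin_0; lra. }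
  destruct (Rle_lt_dec (PI / 2) x) as [Hx2|Hx2].
  { replace x with (PI / 2) by lra. rewrite sin_PI2. right; field; lra. }
  (* The sine is concave: its slope on [0, x] exceeds its slope on [x, PI/2], so
     the graph lies above the chord joining the end points. *)
  destruct (MVT_cor2 sin cos 0 x Hx) as [c1 [E1 [A1 B1]]].
  { intros; apply derivable_pt_lim_sin. }
  destruct (MVT_cor2 sin cos x (PI / 2) Hx2) as [c2 [E2 [A2 B2]]].
  { intros; apply derivable_pt_lim_sin. }
  rewrite sin_0 in E1. rewrite sin_PI2 in E2.
  assert (Hc : cos c2 < cos c1) by (apply cos_decreasing_1; lra).
  apply Rmult_le_reg_r with (PI / 2); [lra|].
  replace (2 / PI * x * (PI / 2)) with x by (field; lra).
  assert (H : 0 <= x * (PI / 2 - x) * (cos c1 - cos c2)).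
  { apply Rmult_le_pos; [apply Rmult_le_pos|]; lra. }
  replace x with (x * (sin x + (1 - sin x))) at 1 by ring.
  rewrite E2. replace (sin x * (PI / 2)) with (x * sin x + sin x * (PI / 2 - x)) by ring.
  replace (sin x) with (cos c1 * (x - 0)) at 2 by lra. nra.
Qed.

(** * Parseval's identity on roots of unity *)

Definition root (L l : nat) : C := cis (2 * PI * INR l / INR L).

Lemma geom_sum (w : C) n : ((1 - w) * csum (fun k => w ^ k)%C n = 1 - w ^ n)%C.
Proof. induction n; simpl; [ring|]. rewrite Cmult_plus_distr_l, IHn. ring. Qed.

Lemma root_pow L l k : (root L l ^ k)%C = cis (2 * PI * INR (l * k) / INR L).
Proof. unfold root. rewrite cis_pow, mult_INR. f_equal. unfold Rdiv; ring. Qed.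

Lemma root_sum L d : (0 < d < L)%nat -> csum (fun l => root L l ^ d)%C L = 0%R.
Proof.
  intros Hd.
  assert (Hd0 : 0 < INR d < INR L) by (split; [apply lt_0_INR|apply lt_INR]; lia).
  set (w := cis (2 * PI * INR d / INR L)).
  assert (E : csum (fun l => root L l ^ d)%C L = csum (fun l => w ^ l)%C L).
  { apply csum_ext; intros l _. rewrite root_pow. unfold w. rewrite cis_pow, mult_INR.
    f_equal. field. lra. }
  pose proof (geom_sum w L) as G. rewrite <- E in G.
  assert (HwL : (w ^ L)%C = 1%R).
  { unfold w. rewrite cis_pow.
    replace (INR L * (2 * PI * INR d / INR L)) with (2 * PI * INR d) by (field; lra).
    apply cis_2PI_INR. }
  rewrite HwL in G.
  assert (Hw : (1 - w)%C <> 0%R).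
  { intros H0. assert (H1 : Cmod (1 - w) = 0) by (rewrite H0; apply Cmod_0).
    unfold w in H1. rewrite Cmod_1_minus_cis in H1.
    assert (Hs : 0 < sin (2 * PI * INR d / INR L / 2)).
    { pose proof PI_RGT_0.
      replace (2 * PI * INR d / INR L / 2) with (PI * (INR d / INR L)) by (field; lra).
      assert (0 < INR d / INR L) by (apply Rdiv_lt_0_compat; lra).
      assert (INR d / INR L < 1) by (apply Rmult_lt_reg_r with (INR L); [lra|];
        unfold Rdiv; rewrite Rmult_assoc, Rinv_l by lra; lra).
      apply sin_gt_0; nra. }
    rewrite Rabs_pos_eq in H1; lra. }
  replace (1 - 1)%C with (RtoC 0) in G by ring.
  set (T := csum (fun l => root L l ^ d)%C L) in *.
  replace T with (/ (1 - w) * ((1 - w) * T))%C by (field; exact Hw).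
  rewrite G. ring.
Qed.

Lemma Cmod_root L l : Cmod (root L l) = 1.
Proof. apply Cmod_cis. Qed.

Lemma unit_conj z : Cmod z = 1 -> (z * Cconj z)%C = 1%R.
Proof. intros H. rewrite <- Cmod2_conj, H. f_equal; ring. Qed.

Lemma root_orth L j k : (j < L)%nat -> (k < L)%nat -> j <> k ->
  csum (fun l => root L l ^ j * Cconj (root L l ^ k))%C L = 0%R.
Proof.
  intros Hj Hk Hjk.
  assert (H : forall i m, (i < m)%nat -> (m < L)%nat ->
    csum (fun l => root L l ^ m * Cconj (root L l ^ i))%C L = 0%R).
  { intros i m Him Hm. rewrite <- (root_sum L (m - i)) by lia.
    apply csum_ext; intros l _.
    replace m with (m - i + i)%nat at 1 by lia. rewrite Cpow_add_r, <- Cmult_assoc.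
    rewrite unit_conj by (rewrite Cmod_pow, Cmod_root; apply pow1). ring. }
  destruct (Nat.lt_ge_cases k j) as [H1|H1]; [now apply H|].
  assert (H2 := H j k ltac:(lia) Hk).
  rewrite <- (Cconj_conj (csum _ L)), csum_conj.
  rewrite (csum_ext _ (fun l => root L l ^ k * Cconj (root L l ^ j))%C).
  - rewrite H2. unfold Cconj; simpl. rewrite Ropp_0. reflexivity.
  - intros l _. rewrite Cmult_conj, Cconj_conj. ring.
Qed.

Lemma root_diag L k : csum (fun l => root L l ^ k * Cconj (root L l ^ k))%C L = INR L.
Proof.
  rewrite (csum_ext _ (fun _ => RtoC 1)); [rewrite csum_const; ring|].
  intros l _. apply unit_conj. rewrite Cmod_pow, Cmod_root; apply pow1.
Qed.

Definition peval (a : nat -> C) (n : nat) (z : C) : C := csum (fun k => a k * z ^ k)%C n.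

Lemma parseval_inner a b n L : (n <= L)%nat ->
  csum (fun l => peval a n (root L l) * Cconj (peval b n (root L l)))%C L
  = (INR L * csum (fun k => a k * Cconj (b k)) n)%C.
Proof.
  intros Hn. unfold peval.
  rewrite (csum_ext _ (fun l => csum (fun j => csum (fun k =>
    a j * Cconj (b k) * (root L l ^ j * Cconj (root L l ^ k)))%C n) n)).
  2:{ intros l _. rewrite csum_conj, Cmult_comm, <- csum_scal.
      apply csum_ext; intros j _. rewrite Cmult_comm, <- csum_scal.
      apply csum_ext; intros k _. rewrite Cmult_conj. ring. }
  rewrite csum_swap, <- csum_scal. apply csum_ext; intros j Hj.
  rewrite csum_swap.
  rewrite (csum_single _ n j).
  - rewrite csum_scal, root_diag. ring.
  - exact Hj.
  - intros k Hk Hkj. rewrite csum_scal, root_orth by lia. ring.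
Qed.

Lemma parseval a n L : (n <= L)%nat ->
  rsum (fun l => Cmod (peval a n (root L l)) ^ 2) L = INR L * rsum (fun k => Cmod (a k) ^ 2) n.
Proof.
  intros Hn. apply RtoC_inj. rewrite RtoC_mult, !RtoC_rsum.
  rewrite (csum_ext (fun k => RtoC (Cmod (a k) ^ 2)) (fun k => a k * Cconj (a k))%C).
  - rewrite <- parseval_inner by exact Hn. apply csum_ext; intros l _. apply Cmod2_conj.
  - intros k _. apply Cmod2_conj.
Qed.

(** The sum is the mean of |f|^2 over the n-th roots of unity, for the polynomial f with
    these coefficients. *)
Lemma coef_sq_le a n B : (forall x, Cmod (peval a n (cis x)) <= B) ->
  rsum (fun k => Cmod (a k) ^ 2) n <= B ^ 2.
Proof.
  intros H. destruct n as [|n]; [simpl; nra|].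
  assert (HL : 0 < INR (S n)) by (apply lt_0_INR; lia).
  apply Rmult_le_reg_l with (INR (S n)); [exact HL|].
  rewrite <- (parseval a (S n) (S n)) by lia.
  apply rsum_le_bound. intros l _.
  pose proof (H (2 * PI * INR l / INR (S n))). fold (root (S n) l) in H0.
  pose proof (Cmod_ge_0 (peval a (S n) (root (S n) l))). nra.
Qed.

(** * Polynomials and the maximum principle *)

(** Degree less than [n], as a property of functions: the products and powers below
    never need explicit coefficients. *)
Definition ispoly (n : nat) (f : C -> C) : Prop :=
  exists a, forall z, f z = peval a n z.

Lemma ispoly_ext n f g : (forall z, f z = g z) -> ispoly n f -> ispoly n g.
Proof. intros H [a Ha]. exists a. intros z. now rewrite <- H. Qed.

Lemma ispoly_mono m n f : (m <= n)%nat -> ispoly m f -> ispoly n f.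
Proof.
  intros Hmn [a Ha]. exists (fun k => if (k <? m)%nat then a k else RtoC 0).
  intros z. rewrite Ha. unfold peval.
  rewrite (csum_zero_tail _ m n Hmn).
  - apply csum_ext. intros k Hk. destruct (Nat.ltb_spec k m); [reflexivity|lia].
  - intros k Hk. destruct (Nat.ltb_spec k m); [lia|ring].
Qed.

Lemma ispoly_const c : ispoly 1 (fun _ => c).
Proof. exists (fun _ => c). intros z. unfold peval; simpl. ring. Qed.

Lemma ispoly_plus n f g : ispoly n f -> ispoly n g -> ispoly n (fun z => f z + g z)%C.
Proof.
  intros [a Ha] [b Hb]. exists (fun k => a k + b k)%C. intros z.
  rewrite Ha, Hb. unfold peval. rewrite <- csum_plus. apply csum_ext. intros; ring.
Qed.

Lemma ispoly_scal c n f : ispoly n f -> ispoly n (fun z => c * f z)%C.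
Proof.
  intros [a Ha]. exists (fun k => c * a k)%C. intros z.
  rewrite Ha. unfold peval. rewrite <- csum_scal. apply csum_ext. intros; ring.
Qed.

Lemma csum_shift f n : csum f (S n) = (f O + csum (fun k => f (S k)) n)%C.
Proof. induction n; simpl; [ring|]. simpl in IHn. rewrite IHn. ring. Qed.

Lemma ispoly_mulz n f : ispoly n f -> ispoly (S n) (fun z => z * f z)%C.
Proof.
  intros [a Ha]. exists (fun k => match k with O => RtoC 0 | S j => a j end). intros z.
  rewrite Ha. unfold peval. rewrite csum_shift, <- csum_scal.
  rewrite Cmult_0_l, Cplus_0_l. apply csum_ext. intros; simpl; ring.
Qed.

Lemma ispoly_mulzn m n f : ispoly n f -> ispoly (m + n) (fun z => z ^ m * f z)%C.
Proof.
  intros H. induction m; simpl.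
  - eapply ispoly_ext; [|exact H]. intros; ring.
  - eapply ispoly_ext; [|apply ispoly_mulz; exact IHm]. intros; simpl; ring.
Qed.

Lemma ispoly_mult m n f g : ispoly m f -> ispoly n g -> ispoly (m + n) (fun z => f z * g z)%C.
Proof.
  intros Hf [b Hb].
  apply ispoly_ext with (fun z => f z * peval b n z)%C; [intros; now rewrite Hb|].
  clear g Hb. induction n; unfold peval in *; simpl.
  - apply ispoly_ext with (fun z => 0 * f z)%C; [intros; ring|].
    apply ispoly_scal. apply ispoly_mono with m; [lia|exact Hf].
  - apply ispoly_ext with
      (fun z => f z * csum (fun k => b k * z ^ k) n + b n * (z ^ n * f z))%C; [intros; ring|].
    apply ispoly_plus; [apply ispoly_mono with (m + n)%nat; [lia|exact IHn]|].
    apply ispoly_scal. apply ispoly_mono with (n + m)%nat; [lia|]. now apply ispoly_mulzn.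
Qed.

Lemma ispoly_pow n f m : ispoly n f -> ispoly (S (m * n)) (fun z => f z ^ m)%C.
Proof.
  intros H. induction m; simpl; [apply ispoly_const|].
  eapply ispoly_mono; [|apply ispoly_mult; [exact H|exact IHm]]. lia.
Qed.

Lemma ispoly_zpow m : ispoly (S m) (fun z => z ^ m)%C.
Proof.
  eapply ispoly_mono; [|eapply ispoly_ext; [|apply (ispoly_mulzn m), (ispoly_const 1)]];
    [lia|intros; simpl; ring].
Qed.

Lemma ispoly_csum n (f : nat -> C -> C) m :
  (forall k, (k < m)%nat -> ispoly n (f k)) -> ispoly n (fun z => csum (fun k => f k z) m).
Proof.
  induction m; intros H; simpl.
  - apply ispoly_ext with (fun z => 0 * csum (fun k => 0 * z ^ k)%C n)%C; [intros; ring|].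
    apply ispoly_scal. exists (fun _ => RtoC 0). reflexivity.
  - apply ispoly_plus; auto.
Qed.

Lemma geom_bound t n : 0 <= t < 1 -> rsum (fun k => t ^ k) n <= / (1 - t).
Proof.
  intros Ht. apply Rmult_le_reg_l with (1 - t); [lra|]. rewrite Rinv_r by lra.
  enough ((1 - t) * rsum (fun k => t ^ k) n = 1 - t ^ n) as ->
    by (pose proof (pow_le t n); lra).
  induction n; simpl; [ring|]. rewrite Rmult_plus_distr_l, IHn. ring.
Qed.

Lemma bernoulli e n : 0 <= e -> 1 + INR n * e <= (1 + e) ^ n.
Proof.
  intros He. induction n; [simpl; lra|]. rewrite S_INR. simpl.
  assert (0 <= INR n) by apply pos_INR. nra.
Qed.

Lemma pow_le_one x n : 0 <= x <= 1 -> x ^ n <= 1.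
Proof. intros H. rewrite <- (pow1 n). apply pow_incr. lra. Qed.

(** On the circle every power f^m is bounded by 1, so by Parseval its coefficients are
    bounded by 1, and |f(z)|^m <= 1/(1-|z|).  As this holds for all m, |f(z)| cannot
    exceed 1. *)
Lemma max_principle n f : ispoly n f -> (forall x, Cmod (f (cis x)) <= 1) ->
  forall z, Cmod z < 1 -> Cmod (f z) <= 1.
Proof.
  intros Hf H z Hz.
  assert (Hm : forall m, Cmod (f z) ^ m <= / (1 - Cmod z)).
  { intros m. destruct (ispoly_pow n f m Hf) as [c Hc].
    rewrite <- Cmod_pow, Hc. unfold peval.
    eapply Rle_trans; [apply Cmod_csum|].
    eapply Rle_trans; [|apply (geom_bound (Cmod z) (S (m * n)))].
    2:{ split; [apply Cmod_ge_0|exact Hz]. }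
    apply rsum_le. intros k Hk. rewrite Cmod_mult, Cmod_pow.
    rewrite <- (Rmult_1_l (Cmod z ^ k)) at 2.
    apply Rmult_le_compat_r; [apply pow_le, Cmod_ge_0|].
    assert (Hs : rsum (fun j => Cmod (c j) ^ 2) (S (m * n)) <= 1 ^ 2).
    { apply coef_sq_le. intros x. rewrite <- Hc, Cmod_pow.
      rewrite <- (pow1 m). apply pow_incr. split; [apply Cmod_ge_0|apply H]. }
    pose proof (rsum_term_le (fun j => Cmod (c j) ^ 2) (S (m * n)) k) as Ht.
    simpl in Ht. apply Cmod_sq_le; [lra|].
    eapply Rle_trans; [|exact Hs]. apply (Ht ltac:(intros; pose proof (Cmod_ge_0 (c j)); nra) Hk). }
  apply Rnot_lt_le. intros Hgt.
  destruct (INR_archimed (Cmod (f z) - 1) (/ (1 - Cmod z)) ltac:(lra)) as [m Hm2].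
  pose proof (bernoulli (Cmod (f z) - 1) m ltac:(lra)) as Hb.
  replace (1 + (Cmod (f z) - 1)) with (Cmod (f z)) in Hb by ring.
  specialize (Hm m). lra.
Qed.

(** * Coefficients of the class B *)

Lemma pow_n_C (z : C) k : @pow_n C_Ring z k = (z ^ k)%C.
Proof. induction k; simpl; [reflexivity|]. rewrite IHk. reflexivity. Qed.

Lemma sum_n_csum (u : nat -> C) n : @sum_n C_AbelianMonoid u n = csum u (S n).
Proof.
  induction n; [rewrite sum_O; symmetry; apply Cplus_0_l|].
  rewrite sum_Sn, IHn. reflexivity.
Qed.

Lemma is_pseries_C_limit (a : nat -> C) (z l : C) :
  @is_pseries C_AbsRing C_NormedModule a z l ->
  forall eps, 0 < eps -> exists N, forall n, (N <= n)%nat -> Cmod (peval a n z - l) < eps.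
Proof.
  intros H eps Heps. unfold is_pseries, is_series in H.
  pose proof (proj1 (filterlim_locally_ball_norm _ _) H (mkposreal eps Heps)) as [N HN].
  exists (S N). intros n Hn. destruct n as [|n]; [lia|].
  specialize (HN n ltac:(lia)). unfold ball_norm in HN. simpl in HN.
  rewrite sum_n_csum in HN.
  unfold peval. rewrite (csum_ext _ (fun k => @scal C_Ring C_ModuleSpace (@pow_n C_Ring z k) (a k))).
  - exact HN.
  - intros k _. rewrite <- (pow_n_C z k). apply Cmult_comm.
Qed.

Lemma poly_is_pseries (a : nat -> C) n (z : C) : (forall k, (n <= k)%nat -> a k = 0%R :> C) ->
  @is_pseries C_AbsRing C_NormedModule a z (peval a n z).
Proof.
  intros Ha. unfold is_pseries, is_series.
  apply filterlim_ext_loc with (fun _ : nat => peval a n z); [|apply filterlim_const].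
  exists n. intros m Hm. rewrite sum_n_csum. unfold peval.
  rewrite (csum_zero_tail _ n (S m) ltac:(lia)).
  - apply csum_ext. intros k _. rewrite <- (pow_n_C z k). apply Cmult_comm.
  - intros k Hk. rewrite Ha by lia. apply Cmult_0_r.
Qed.

(** On the circle of radius R < 1 the partial sums converge uniformly (the terms at a
    larger radius are bounded), so long partial sums are bounded by 1 + eps there, and
    Parseval applies to these polynomials. *)
Lemma classB_coef_sq_R (f : classB) (Rr : R) n : 0 < Rr < 1 ->
  rsum (fun k => Cmod (coef f k) ^ 2 * (Rr ^ k) ^ 2) n <= 1.
Proof.
  intros HR. set (a := coef f).
  set (R1 := (1 + Rr) / 2).
  assert (HR1 : Rr < R1 < 1) by (unfold R1; lra).
  assert (HB : exists B, 0 < B /\ forall k, Cmod (a k) * R1 ^ k <= B).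
  { assert (Hz : Cmod R1 < 1) by (rewrite Cmod_R, Rabs_pos_eq; lra).
    destruct (is_pseries_C_limit a R1 _ (fn_expansion f R1 Hz) 1 ltac:(lra)) as [N HN].
    exists (2 + rsum (fun k => Cmod (a k) * R1 ^ k) N).
    assert (Hpos : forall k, 0 <= Cmod (a k) * R1 ^ k)
      by (intros; apply Rmult_le_pos; [apply Cmod_ge_0|apply pow_le; lra]).
    assert (Hs : 0 <= rsum (fun k => Cmod (a k) * R1 ^ k) N) by (apply rsum_ge0; auto).
    split; [lra|]. intros k. destruct (Nat.lt_ge_cases k N) as [Hk|Hk].
    - pose proof (rsum_term_le (fun k => Cmod (a k) * R1 ^ k) N k) as Ht. simpl in Ht.
      specialize (Ht ltac:(auto) Hk). lra.
    - pose proof (HN k Hk) as H1. pose proof (HN (S k) ltac:(lia)) as H2.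
      assert (E : (a k * RtoC R1 ^ k = (peval a (S k) R1 - fn f R1) - (peval a k R1 - fn f R1))%C)
        by (unfold peval; simpl; ring).
      replace (Cmod (a k) * R1 ^ k) with (Cmod (a k * RtoC R1 ^ k)%C).
      + rewrite E. unfold Cminus at 1. eapply Rle_trans; [apply Cmod_triangle|].
        rewrite Cmod_opp. lra.
      + rewrite Cmod_mult, Cmod_pow, Cmod_R, Rabs_pos_eq; lra. }
  destruct HB as [B [HB0 HB]].
  set (rho := Rr / R1).
  assert (Hrho : 0 < rho < 1).
  { unfold rho. split; [apply Rdiv_lt_0_compat; lra|].
    apply Rlt_div_l; lra. }
  assert (Hterm : forall k, Cmod (a k) * Rr ^ k <= B * rho ^ k).
  { intros k. replace (Rr ^ k) with (R1 ^ k * rho ^ k).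
    - rewrite <- Rmult_assoc. apply Rmult_le_compat_r; [apply pow_le; lra|apply HB].
    - rewrite <- Rpow_mult_distr. f_equal. unfold rho. field. lra. }
  assert (Hpoly : forall eps, 0 < eps -> exists m, (n <= m)%nat /\
     forall x, Cmod (peval a m (Rr * cis x)) <= 1 + eps).
  { intros eps Heps.
    destruct (pow_lt_1_zero rho ltac:(rewrite Rabs_pos_eq; lra) (eps / 2 * (1 - rho) / B)
       ltac:(apply Rdiv_lt_0_compat; nra)) as [m0 Hm0].
    exists (Nat.max n m0). split; [lia|]. intros x. set (m := Nat.max n m0).
    assert (Hz : Cmod (Rr * cis x) < 1)
      by (rewrite Cmod_mult, Cmod_cis, Cmod_R, Rabs_pos_eq; lra).
    destruct (is_pseries_C_limit a _ _ (fn_expansion f _ Hz) (eps / 2) ltac:(lra)) as [N HN].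
    specialize (HN (m + N)%nat ltac:(lia)).
    pose proof (fn_bound f _ Hz) as Hb.
    assert (Htail : Cmod (csum (fun k => a (m + k)%nat * (Rr * cis x) ^ (m + k))%C N) <= eps / 2).
    { eapply Rle_trans; [apply Cmod_csum|].
      eapply Rle_trans; [apply (rsum_le _ (fun k => B * rho ^ m * rho ^ k))|].
      - intros k _. rewrite Cmod_mult, Cmod_pow, Cmod_mult, Cmod_cis, Cmod_R, Rabs_pos_eq by lra.
        rewrite Rmult_1_r, Rmult_assoc, <- pow_add. apply Hterm.
      - rewrite rsum_scal.
        pose proof (geom_bound rho N ltac:(lra)) as G.
        specialize (Hm0 m ltac:(unfold m; lia)). rewrite Rabs_pos_eq in Hm0 by (apply pow_le; lra).
        assert (HBm : B * rho ^ m <= eps / 2 * (1 - rho)).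
        { apply Rmult_lt_compat_l with (r := B) in Hm0; [|lra].
          replace (B * (eps / 2 * (1 - rho) / B)) with (eps / 2 * (1 - rho)) in Hm0 by (field; lra).
          lra. }
        assert (0 <= B * rho ^ m) by (apply Rmult_le_pos; [lra|apply pow_le; lra]).
        apply Rle_trans with (eps / 2 * (1 - rho) * / (1 - rho)); [|right; field; lra].
        apply Rmult_le_compat; auto. apply rsum_ge0; intros; apply pow_le; lra. }
    unfold peval in HN. rewrite csum_add in HN.
    set (P := csum (fun k => a k * (Rr * cis x) ^ k)%C m) in *.
    set (T := csum (fun k => a (m + k)%nat * (Rr * cis x) ^ (m + k))%C N) in *.
    change (Cmod P <= 1 + eps).
    replace P with ((P + T - fn f (Rr * cis x)) + (fn f (Rr * cis x) + - T))%C by ring.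
    eapply Rle_trans; [apply Cmod_triangle|].
    pose proof (Cmod_triangle (fn f (Rr * cis x)) (- T)). rewrite Cmod_opp in H. lra. }
  apply Rnot_lt_le. intros Hgt.
  set (s := rsum (fun k => Cmod (a k) ^ 2 * (Rr ^ k) ^ 2) n) in *.
  destruct (Hpoly (Rmin 1 ((s - 1) / 4))) as [m [Hnm Hm]].
  { apply Rmin_glb_lt; lra. }
  set (eps := Rmin 1 ((s - 1) / 4)) in *.
  assert (He : 0 < eps <= 1 /\ eps <= (s - 1) / 4).
  { unfold eps. split; [split; [apply Rmin_glb_lt; lra|apply Rmin_l]|apply Rmin_r]. }
  assert (Hc := coef_sq_le (fun k => a k * RtoC Rr ^ k)%C m (1 + eps)).
  assert (Hc2 : rsum (fun k => Cmod (a k * RtoC Rr ^ k) ^ 2) m <= (1 + eps) ^ 2).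
  { apply Hc. intros x. unfold peval.
    rewrite (csum_ext _ (fun k => a k * (Rr * cis x) ^ k)%C); [apply Hm|].
    intros k _. rewrite Cpow_mult_l. ring. }
  assert (s <= rsum (fun k => Cmod (a k * RtoC Rr ^ k) ^ 2) m).
  { replace m with (n + (m - n))%nat by lia. rewrite rsum_add.
    assert (0 <= rsum (fun k => Cmod (a (n + k)%nat * RtoC Rr ^ (n + k)) ^ 2) (m - n)).
    { apply rsum_ge0. intros. apply pow_le, Cmod_ge_0. }
    unfold s. rewrite (rsum_ext _ (fun k => Cmod (a k * RtoC Rr ^ k) ^ 2)); [lra|].
    intros k _. rewrite Cmod_mult, Cmod_pow, Cmod_R, Rabs_pos_eq by lra. ring. }
  nra.
Qed.

Lemma ex_derive_continuous_R (f : R -> R) t : ex_derive f t -> continuous f t.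
Proof. apply (ex_derive_continuous (K := R_AbsRing) (V := R_NormedModule)). Qed.

(** The finite sum is continuous in the radius, which tends to 1. *)
Lemma classB_coef_sq (f : classB) n : rsum (fun k => Cmod (coef f k) ^ 2) n <= 1.
Proof.
  apply Rnot_lt_le. intros Hgt.
  set (phi := fun t : R => rsum (fun k => Cmod (coef f k) ^ 2 * (t ^ k) ^ 2) n).
  assert (Hc : continuous phi 1).
  { unfold phi. clear. induction n as [|n IH]; simpl rsum; [apply continuous_const|].
    apply (continuous_plus (V := R_NormedModule)); [exact IH|].
    apply ex_derive_continuous_R. auto_derive. exact I. }
  assert (E : phi 1 = rsum (fun k => Cmod (coef f k) ^ 2) n).
  { apply rsum_ext. intros k _. rewrite !pow1. ring. }
  destruct (Hc (fun y => 1 < y)) as [d Hd]; [apply open_gt; lra|].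
  pose proof (cond_pos d) as Hd0.
  assert (Hm : 0 < Rmin d 1 / 2) by (assert (0 < Rmin d 1) by (apply Rmin_glb_lt; lra); lra).
  pose proof (Rmin_l d 1). pose proof (Rmin_r d 1).
  assert (H1 : 1 < phi (1 - Rmin d 1 / 2)).
  { apply Hd. change (Rabs (1 - Rmin d 1 / 2 - 1) < d). rewrite Rabs_left; lra. }
  pose proof (classB_coef_sq_R f (1 - Rmin d 1 / 2) n ltac:(lra)) as H2. unfold phi in H1. lra.
Qed.

Lemma series_nonneg (u : nat -> R) B : (forall k, 0 <= u k) -> (forall n, rsum u n <= B) ->
  Series u <= B /\ forall n, rsum u n <= Series u.
Proof.
  intros Hu HB.
  assert (Hinc : forall n, sum_n u n <= sum_n u (S n)).
  { intros n. rewrite !rsum_sum_n. simpl. specialize (Hu (S n)). lra. }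
  assert (Hb : forall n, sum_n u n <= B) by (intros; rewrite rsum_sum_n; apply HB).
  destruct (ex_finite_lim_seq_incr (sum_n u) B Hinc Hb) as [l Hl].
  assert (Es : Series u = l).
  { apply is_series_unique. exact Hl. }
  rewrite Es. split.
  - apply (is_lim_seq_le (sum_n u) (fun _ => B) l B Hb Hl (is_lim_seq_const B)).
  - intros n. apply Rle_trans with (sum_n u n).
    + rewrite rsum_sum_n. simpl. specialize (Hu n). lra.
    + apply (is_lim_seq_incr_compare (sum_n u) l Hl Hinc).
Qed.

(** * Tangent-line inequalities for the weighted sum *)

(** Both inequalities for powers used below come from convexity of the exponential;
    here it follows from the tangent line at the intermediate point. *)
Lemma exp_convex th u v : 0 <= th <= 1 ->
  exp (th * u + (1 - th) * v) <= th * exp u + (1 - th) * exp v.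
Proof.
  intros Hth. set (m := th * u + (1 - th) * v).
  assert (H : forall w, exp m * (1 + (w - m)) <= exp w).
  { intros w. replace w with (m + (w - m)) at 2 by ring. rewrite exp_plus.
    apply Rmult_le_compat_l; [left; apply exp_pos|]. apply exp_ineq1_le. }
  pose proof (H u). pose proof (H v).
  apply Rle_trans with (th * (exp m * (1 + (u - m))) + (1 - th) * (exp m * (1 + (v - m)))).
  - right. unfold m. ring.
  - apply Rplus_le_compat; apply Rmult_le_compat_l; lra.
Qed.

Lemma npow_0 p : npow 0 p = 0.
Proof. unfold npow. destruct (Req_EM_T 0 0); [reflexivity|lra]. Qed.

Lemma npow_pos a p : 0 < a -> npow a p = exp (p * ln a).
Proof. intros H. unfold npow. destruct (Req_EM_T a 0); [lra|reflexivity]. Qed.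

Lemma npow_ge0 a p : 0 <= a -> 0 <= npow a p.
Proof.
  intros [H|<-]; [|rewrite npow_0; lra]. rewrite npow_pos by exact H. left; apply exp_pos.
Qed.

(** Here r = q^(1-p/2), so that q = r^(2/(2-p)), and T is the expected size of the
    supremum. *)
Section Weights.
Variables (p l : R).
Hypothesis Hp : 1 < p < 2.
Hypothesis Hl : 0 < l.
Let q := exp (- l).
Let r := exp (- l * (1 - p / 2)).
Let T := Rpower (1 / (1 - q)) (1 - p / 2).

Lemma q_range : 0 < q < 1.
Proof. unfold q. split; [apply exp_pos|]. rewrite <- exp_0. apply exp_increasing. lra. Qed.

Lemma T_pos : 0 < T.
Proof. apply exp_pos. Qed.

(** With w_k = (1-q) q^k this says a^p r^k = T a^p w_k^(1-p/2): the factor r^k is the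
    weight for which Young's inequality produces a sequence of total mass 1. *)
Lemma weight_identity a k : 0 < a ->
  npow a p * r ^ k = T * exp (p * ln a + (1 - p / 2) * (ln (1 - q) - l * INR k)).
Proof.
  intros Ha. pose proof q_range as Hq. rewrite npow_pos by exact Ha.
  unfold T, Rpower. rewrite <- exp_plus.
  replace (r ^ k) with (exp (INR k * (- l * (1 - p / 2)))).
  - rewrite <- exp_plus. f_equal.
    unfold Rdiv at 3. rewrite Rmult_1_l, ln_Rinv by lra. ring.
  - unfold r. clear. induction k; [simpl; rewrite Rmult_0_l; apply exp_0|].
    rewrite S_INR, Rmult_plus_distr_r, exp_plus, IHk. simpl.
    replace (1 * (- l * (1 - p / 2))) with (- l * (1 - p / 2)) by ring. ring.
Qed.

Definition wt k := (1 - q) * q ^ k.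

Lemma wt_pos k : 0 < wt k.
Proof. pose proof q_range. apply Rmult_lt_0_compat; [lra|]. apply pow_lt. lra. Qed.

Lemma wt_exp k : wt k = exp (ln (1 - q) - l * INR k).
Proof.
  pose proof q_range.
  replace (ln (1 - q) - l * INR k) with (ln (1 - q) + - (l * INR k)) by ring.
  rewrite exp_plus, exp_ln by lra. unfold wt. f_equal.
  unfold q. clear. induction k; [simpl; rewrite Rmult_0_r, Ropp_0, exp_0; reflexivity|].
  rewrite S_INR. simpl. rewrite IHk, <- exp_plus. f_equal. ring.
Qed.

Lemma wt_sum n : rsum wt n = 1 - q ^ n.
Proof. unfold wt. rewrite rsum_scal. induction n; simpl; [ring|]. rewrite Rmult_plus_distr_l, IHn. ring. Qed.

(** Young's inequality with the exponents 2/p and 2/(2-p). *)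
Lemma young_upper a k : 0 <= a ->
  npow a p * r ^ k <= T * (p / 2 * a ^ 2 + (1 - p / 2) * wt k).
Proof.
  pose proof T_pos as HT. intros [Ha|<-].
  - rewrite weight_identity by exact Ha. apply Rmult_le_compat_l; [lra|].
    replace (a ^ 2) with (exp (2 * ln a)).
    2:{ replace (2 * ln a) with (ln a + ln a) by ring. rewrite exp_plus, exp_ln by exact Ha. ring. }
    rewrite wt_exp. eapply Rle_trans; [|apply exp_convex; lra].
    right. f_equal. field.
  - rewrite npow_0, Rmult_0_l. pose proof (wt_pos k). apply Rmult_le_pos; [lra|]. nra.
Qed.

(** The graph of the convex function a -> a^p b^(2-p) lies above its tangent at a = b;
    this is the point where Young's inequality is an equality. *)
Lemma tangent_lower a b k : 0 <= a -> 0 < b -> b ^ 2 = wt k ->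
  T * ((1 - p) * wt k + p * (a * b)) <= npow a p * r ^ k.
Proof.
  pose proof T_pos as HT. intros [Ha|<-] Hb Hbw.
  - rewrite weight_identity by exact Ha. apply Rmult_le_compat_l; [lra|].
    assert (El : ln (1 - q) - l * INR k = 2 * ln b).
    { rewrite <- (ln_exp (_ - _)), <- wt_exp, <- Hbw.
      replace (b ^ 2) with (b * b) by ring. rewrite ln_mult by exact Hb. ring. }
    rewrite El. rewrite <- Hbw.
    set (s := ln a - ln b).
    assert (Ea : a = b * exp s).
    { unfold s, Rminus. rewrite exp_plus, exp_Ropp, !exp_ln by assumption. field. lra. }
    replace (p * ln a + (1 - p / 2) * (2 * ln b)) with (2 * ln b + p * s) by (unfold s; field).
    rewrite exp_plus. replace (exp (2 * ln b)) with (b ^ 2).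
    2:{ replace (2 * ln b) with (ln b + ln b) by ring. rewrite exp_plus, exp_ln by exact Hb. ring. }
    rewrite Ea at 1.
    replace ((1 - p) * b ^ 2 + p * (b * exp s * b)) with (b ^ 2 * (1 - p + p * exp s)) by ring.
    apply Rmult_le_compat_l; [nra|].
    assert (Hi : 0 <= / p <= 1).
    { split; [left; apply Rinv_0_lt_compat; lra|]. rewrite <- Rinv_1. apply Rinv_le_contravar; lra. }
    pose proof (exp_convex (/ p) (p * s) 0 Hi) as Hc.
    replace (/ p * (p * s) + (1 - / p) * 0) with s in Hc by (field; lra).
    rewrite exp_0 in Hc. apply Rmult_le_compat_l with (r := p) in Hc; [|lra].
    replace (p * (/ p * exp (p * s) + (1 - / p) * 1)) with (exp (p * s) + p - 1) in Hc
      by (field; lra). lra.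
  - rewrite npow_0, Rmult_0_l, Rmult_0_l, Rmult_0_r, Rplus_0_r. pose proof (wt_pos k).
    assert (0 < (p - 1) * wt k) by (apply Rmult_lt_0_compat; lra). nra.
Qed.

Lemma r_pos : 0 < r.
Proof. apply exp_pos. Qed.

(** Termwise Young, and then both sequences |a_k|^2 and w_k have sum at most 1. *)
Lemma Mf_partial_le f n : rsum (fun k => npow (Cmod (coef f k)) p * r ^ k) n <= T.
Proof.
  pose proof T_pos. pose proof q_range.
  eapply Rle_trans.
  - apply rsum_le. intros k _. apply young_upper, Cmod_ge_0.
  - rewrite rsum_scal, rsum_plus, !rsum_scal, wt_sum.
    pose proof (classB_coef_sq f n). assert (0 < q ^ n) by (apply pow_lt; lra).
    rewrite <- (Rmult_1_r T) at 2. apply Rmult_le_compat_l; [lra|]. nra.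
Qed.

Lemma Mf_bounds f : Mf p f r <= T /\
  forall n, rsum (fun k => npow (Cmod (coef f k)) p * r ^ k) n <= Mf p f r.
Proof.
  apply series_nonneg; [|apply Mf_partial_le].
  intros k. apply Rmult_le_pos; [apply npow_ge0, Cmod_ge_0|apply pow_le; left; apply r_pos].
Qed.

(** The linear lower bound turns the problem into finding a function of the class whose
    coefficients have inner product nearly 1 with some b such that |b_k|^2 = w_k. *)
Lemma Mf_lower f (b : nat -> C) K : (forall k, (k < K)%nat -> Cmod (b k) ^ 2 = wt k) ->
  T * ((1 - p) * rsum wt K + p * Re (csum (fun k => coef f k * Cconj (b k))%C K)) <= Mf p f r.
Proof.
  intros Hb. pose proof T_pos as HT.
  eapply Rle_trans; [|apply (proj2 (Mf_bounds f) K)].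
  rewrite Re_csum, <- !rsum_scal, <- rsum_plus, <- rsum_scal. apply rsum_le. intros k Hk.
  pose proof (wt_pos k) as Hw. specialize (Hb k Hk).
  assert (Hb0 : 0 < Cmod (b k)) by (pose proof (Cmod_ge_0 (b k)); nra).
  eapply Rle_trans; [|apply (tangent_lower (Cmod (coef f k)) (Cmod (b k)) k); auto; apply Cmod_ge_0].
  apply Rmult_le_compat_l; [lra|]. apply Rplus_le_compat_l, Rmult_le_compat_l; [lra|].
  eapply Rle_trans; [apply Rle_abs|]. eapply Rle_trans; [apply re_le_Cmod|].
  rewrite Cmod_mult, Cmod_conj. lra.
Qed.

(** The uniform upper bound makes the least upper bound finite, so that it is a real
    number and not a default value. *)
Lemma M_bounds f : Mf p f r <= M p r /\ M p r <= T.
Proof.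
  unfold M. set (E := fun x => exists g, x = Mf p g r).
  destruct (Lub_Rbar_correct E) as [H1 H2].
  assert (HT : Rbar_le (Lub_Rbar E) T).
  { apply H2. intros x [g ->]. simpl. apply Mf_bounds. }
  assert (Hf : Rbar_le (Mf p f r) (Lub_Rbar E)) by (apply H1; exists f; reflexivity).
  destruct (Lub_Rbar E); simpl in *; [split; assumption|contradiction|contradiction].
Qed.
End Weights.

(** The factor 1/(1+e) makes the bound strict inside the disk, as the class demands. *)
Lemma poly_classB n (a : nat -> C) e : 0 < e ->
  (forall x, Cmod (peval a n (cis x)) <= 1) ->
  exists f : classB, forall k, (k < n)%nat -> coef f k = (RtoC (/ (1 + e)) * a k)%C.
Proof.
  intros He Ha.
  set (c := fun k => if (k <? n)%nat then (RtoC (/ (1 + e)) * a k)%C else RtoC 0).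
  assert (Hi : 0 < / (1 + e) < 1).
  { split; [apply Rinv_0_lt_compat; lra|]. rewrite <- Rinv_1. apply Rinv_lt_contravar; lra. }
  assert (Hc : forall z, peval c n z = (RtoC (/ (1 + e)) * peval a n z)%C).
  { intros z. unfold peval. rewrite <- csum_scal. apply csum_ext. intros k Hk.
    unfold c. destruct (Nat.ltb_spec k n); [ring|lia]. }
  unshelve eexists (ClassB (peval c n) c _ _).
  - intros z _. apply poly_is_pseries. intros k Hk. unfold c.
    destruct (Nat.ltb_spec k n); [lia|reflexivity].
  - intros z Hz. rewrite Hc, Cmod_mult, Cmod_R, Rabs_pos_eq by lra.
    assert (Cmod (peval a n z) <= 1).
    { apply max_principle with n; [exists a; reflexivity|exact Ha|exact Hz]. }
    nra.
  - intros k Hk. simpl. unfold c. destruct (Nat.ltb_spec k n); [reflexivity|lia].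
Qed.

(** * Damping near z = 1 *)

Lemma cis_reduce x : exists y, - PI <= y <= PI /\ cis y = cis x.
Proof.
  pose proof PI_RGT_0 as HPI.
  set (k := Int_part ((x + PI) / (2 * PI))).
  destruct (base_Int_part ((x + PI) / (2 * PI))) as [H1 H2]. fold k in H1, H2.
  assert (E : (x + PI) / (2 * PI) * (2 * PI) = x + PI) by (field; lra).
  exists (x - 2 * PI * IZR k). split; [nra|].
  destruct (Z_le_gt_dec 0 k) as [Hk|Hk].
  - rewrite <- (Z2Nat.id k) by exact Hk. rewrite <- INR_IZR_INZ.
    rewrite cis_minus, cis_2PI_INR. unfold Cconj; simpl. rewrite Ropp_0. apply Cmult_1_r.
  - replace k with (- Z.of_nat (Z.to_nat (- k)))%Z by lia. rewrite opp_IZR, <- INR_IZR_INZ.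
    replace (x - _) with (x + 2 * PI * INR (Z.to_nat (- k))) by ring.
    rewrite cis_plus, cis_2PI_INR. apply Cmult_1_r.
Qed.

(** [Fej j] is the analytic half of the Fejer kernel, with coefficients 1 - k/j: on the
    circle its real part is 1/2 plus half the kernel, of size j for |x| < 1/j, while
    its modulus is at most 3/|1-z|.  [G j] is j times it, written as a sum of geometric
    sums, which makes the closed form an easy induction. *)
Definition G (j : nat) (z : C) : C := csum (fun i => csum (fun k => z ^ k)%C (S i)) j.
Definition Fej (j : nat) (z : C) : C := (RtoC (/ INR j) * G j z)%C.

Lemma ispoly_G j : ispoly j (G j).
Proof.
  unfold G. apply (ispoly_csum j (fun i z => csum (fun k => z ^ k)%C (S i))). intros i Hi.
  apply (ispoly_csum j (fun k z => z ^ k)%C). intros k Hk.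
  apply ispoly_mono with (S k); [lia|apply ispoly_zpow].
Qed.

Lemma ispoly_Fej j : ispoly j (Fej j).
Proof. apply ispoly_scal, ispoly_G. Qed.

Lemma G_closed j x : let z := cis x in
  (RtoC (Cmod (1 - z) ^ 2) * G j z = RtoC (INR j) * Cconj (1 - z) + (1 - z ^ j))%C.
Proof.
  intros z. assert (Hz : (z * Cconj z)%C = 1%R) by (apply unit_conj, Cmod_cis).
  rewrite Cmod2_conj.
  assert (E1 : Cconj (1 - z) = (1 - Cconj z)%C).
  { rewrite Cminus_conj. f_equal. unfold Cconj; simpl. now rewrite Ropp_0. }
  rewrite E1. unfold G. induction j; [simpl; ring|].
  change (csum (fun i => csum (fun k => z ^ k)%C (S i)) (S j)) with
    (csum (fun i => csum (fun k => z ^ k)%C (S i)) j + csum (fun k => z ^ k)%C (S j))%C.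
  rewrite Cmult_plus_distr_l, IHj.
  pose proof (geom_sum z (S j)) as Hg.
  replace ((1 - z) * (1 - Cconj z) * csum (fun k => (z ^ k)%C) (S j))%C
    with ((1 - Cconj z) * ((1 - z) * csum (fun k => (z ^ k)%C) (S j)))%C by ring.
  rewrite Hg, S_INR, RtoC_plus. simpl Cpow.
  transitivity ((INR j + 1) * (1 - Cconj z) + (1 - z * z ^ j) + z ^ j * (z * Cconj z - 1))%C; [ring|].
  rewrite Hz. ring.
Qed.

Lemma one_minus_cos_lower y : Rabs y <= PI -> 2 * y ^ 2 / PI ^ 2 <= 1 - cos y.
Proof.
  intros Hy. pose proof PI_RGT_0 as HPI.
  assert (H : 2 / PI * (Rabs y / 2) <= sin (Rabs y / 2)).
  { apply sin_lower. pose proof (Rabs_pos y). lra. }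
  assert (E : cos y = 1 - 2 * sin (Rabs y / 2) * sin (Rabs y / 2)).
  { replace (cos y) with (cos (Rabs y)).
    - replace (Rabs y) with (2 * (Rabs y / 2)) at 1 by field. apply cos_2a_sin.
    - unfold Rabs. destruct (Rcase_abs y); [apply cos_neg|reflexivity]. }
  rewrite E, <- (pow2_abs y).
  assert (0 <= 2 / PI * (Rabs y / 2)).
  { pose proof (Rabs_pos y). apply Rmult_le_pos; [apply Rlt_le, Rdiv_lt_0_compat|]; lra. }
  replace (2 * Rabs y ^ 2 / PI ^ 2) with (2 * (2 / PI * (Rabs y / 2)) ^ 2) by (field; lra).
  nra.
Qed.

Lemma Re_G_closed j x :
  (2 - 2 * cos x) * Re (G j (cis x)) = INR j / 2 * (2 - 2 * cos x) + (1 - cos (INR j * x)).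
Proof.
  pose proof (f_equal Re (G_closed j x)) as H. cbv zeta in H.
  rewrite cis_pow, Cmod_1_minus_cis_sq in H.
  unfold Cmult, Cplus, Cminus, Cconj, cis in H. simpl in H.
  unfold Re. simpl.
  set (g := G j (cis x)) in *. change (G j (cos x, sin x)) with g in *.
  lra.
Qed.

Lemma G_one j : Re (G j 1) = INR j * (INR j + 1) / 2.
Proof.
  unfold G. induction j; [simpl; field|].
  change (csum (fun i => csum (fun k => 1 ^ k)%C (S i)) (S j)) with
    (csum (fun i => csum (fun k => 1 ^ k)%C (S i)) j + csum (fun k => 1 ^ k)%C (S j))%C.
  rewrite re_plus, IHj.
  rewrite (csum_ext (fun k => 1 ^ k)%C (fun _ => RtoC 1)) by (intros; apply Cpow_1_l).
  rewrite csum_const, Cmult_1_r, re_RtoC, S_INR. field.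
Qed.

Lemma cos_eq_1 x : - PI <= x <= PI -> cos x = 1 -> x = 0.
Proof.
  intros Hx Hc. pose proof PI_RGT_0.
  pose proof (one_minus_cos_lower x ltac:(apply Rabs_le; lra)) as H1.
  rewrite Hc in H1.
  assert (0 < 2 / PI ^ 2) by (apply Rdiv_lt_0_compat; nra).
  replace (2 * x ^ 2 / PI ^ 2) with (2 / PI ^ 2 * x ^ 2) in H1 by (field; lra).
  destruct (Req_dec x 0) as [Hx0|Hx0]; [exact Hx0|].
  assert (0 < x ^ 2) by (apply pow2_gt_0, Hx0).
  assert (0 < 2 / PI ^ 2 * x ^ 2) by (apply Rmult_lt_0_compat; lra). lra.
Qed.

Lemma Re_Fej_lower j x : (0 < j)%nat -> INR j * Rabs x <= PI ->
  2 * INR j / PI ^ 2 <= Re (Fej j (cis x)).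
Proof.
  intros Hj Hx.
  assert (HPI3 : 2 < PI) by (pose proof PI2_1; lra).
  assert (Hj0 : 1 <= INR j) by (apply (le_INR 1); lia).
  assert (Hxx : Rabs x <= PI) by (pose proof (Rabs_pos x); nra).
  unfold Fej. rewrite re_scal_l.
  enough (HG : 2 * INR j ^ 2 / PI ^ 2 <= Re (G j (cis x))).
  { replace (2 * INR j / PI ^ 2) with (/ INR j * (2 * INR j ^ 2 / PI ^ 2)) by (field; lra).
    apply Rmult_le_compat_l; [left; apply Rinv_0_lt_compat; lra|exact HG]. }
  destruct (Req_dec (cos x) 1) as [Hc|Hc].
  - rewrite (cos_eq_1 x) by (auto; apply Rabs_le_between; exact Hxx).
    rewrite cis_0, G_one.
    apply Rmult_le_reg_r with (PI ^ 2); [nra|].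
    replace (2 * INR j ^ 2 / PI ^ 2 * PI ^ 2) with (2 * INR j ^ 2) by (field; lra).
    assert (4 <= PI ^ 2) by nra.
    nra.
  - pose proof (Re_G_closed j x) as H.
    assert (Hp : 0 < 2 - 2 * cos x) by (pose proof (COS_bound x); lra).
    apply Rmult_le_reg_l with (2 - 2 * cos x); [exact Hp|]. rewrite H.
    assert (H1 : 2 * (INR j * x) ^ 2 / PI ^ 2 <= 1 - cos (INR j * x)).
    { apply one_minus_cos_lower. rewrite Rabs_mult, Rabs_pos_eq by lra. exact Hx. }
    assert (H2 : 2 - 2 * cos x <= x ^ 2).
    { rewrite <- Cmod_1_minus_cis_sq, <- (pow2_abs x). apply pow_incr.
      split; [apply Cmod_ge_0|apply Cmod_1_minus_cis_le]. }
    assert (H3 : (2 - 2 * cos x) * (2 * INR j ^ 2 / PI ^ 2) <= 2 * (INR j * x) ^ 2 / PI ^ 2).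
    { replace (2 * (INR j * x) ^ 2 / PI ^ 2) with (x ^ 2 * (2 * INR j ^ 2 / PI ^ 2)) by (field; lra).
      apply Rmult_le_compat_r; [|exact H2]. apply Rmult_le_pos; [nra|].
      left. apply Rinv_0_lt_compat. nra. }
    assert (0 <= INR j / 2 * (2 - 2 * cos x)) by (apply Rmult_le_pos; lra). lra.
Qed.

Lemma Re_Fej_half j x : (0 < j)%nat -> / 2 <= Re (Fej j (cis x)).
Proof.
  intros Hj. destruct (cis_reduce x) as [y [Hy <-]].
  assert (Hj0 : 1 <= INR j) by (apply (le_INR 1); lia).
  unfold Fej. rewrite re_scal_l. enough (INR j / 2 <= Re (G j (cis y))).
  { replace (/ 2) with (/ INR j * (INR j / 2)) by (field; lra).
    apply Rmult_le_compat_l; [left; apply Rinv_0_lt_compat; lra|assumption]. }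
  destruct (Req_dec (cos y) 1) as [Hc|Hc].
  - rewrite (cos_eq_1 y), cis_0, G_one by auto. nra.
  - pose proof (Re_G_closed j y) as H. pose proof (COS_bound y). pose proof (COS_bound (INR j * y)).
    apply Rmult_le_reg_l with (2 - 2 * cos y); lra.
Qed.

Lemma Cmod_Fej_le j x : (0 < j)%nat -> Cmod (Fej j (cis x)) <= INR j.
Proof.
  intros Hj. assert (Hj0 : 1 <= INR j) by (apply (le_INR 1); lia).
  unfold Fej. rewrite Cmod_mult, Cmod_R, Rabs_pos_eq by (left; apply Rinv_0_lt_compat; lra).
  apply Rmult_le_reg_l with (INR j); [lra|]. rewrite <- Rmult_assoc, Rinv_r, Rmult_1_l by lra.
  unfold G. eapply Rle_trans; [apply Cmod_csum|]. apply rsum_le_bound. intros i Hi.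
  eapply Rle_trans; [apply Cmod_csum|].
  eapply Rle_trans; [apply rsum_le_bound with (c := 1)|].
  - intros k _. rewrite Cmod_pow, Cmod_cis, pow1. lra.
  - rewrite Rmult_1_r. apply le_INR. lia.
Qed.

Lemma Cmod_Fej_le_inv j x : (0 < j)%nat -> Cmod (Fej j (cis x)) * Cmod (1 - cis x) <= 3.
Proof.
  intros Hj. assert (Hj0 : 1 <= INR j) by (apply (le_INR 1); lia).
  set (s := Cmod (1 - cis x)). assert (Hs : 0 <= s) by apply Cmod_ge_0.
  destruct (Rle_lt_dec (INR j * s) 1) as [H|H].
  - pose proof (Cmod_Fej_le j x Hj). nra.
  - pose proof (f_equal Cmod (G_closed j x)) as HG. cbv zeta in HG. fold s in HG.
    rewrite Cmod_mult, Cmod_R, Rabs_pos_eq in HG by nra.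
    assert (HG2 : s ^ 2 * Cmod (G j (cis x)) <= INR j * s + 2).
    { rewrite HG. eapply Rle_trans; [apply Cmod_triangle|].
      rewrite Cmod_mult, Cmod_conj, Cmod_R, Rabs_pos_eq by lra. fold s.
      enough (Cmod (1 - cis x ^ j) <= 2) by lra.
      unfold Cminus. eapply Rle_trans; [apply Cmod_triangle|].
      rewrite Cmod_opp, Cmod_pow, Cmod_cis, pow1, Cmod_1. lra. }
    unfold Fej. rewrite Cmod_mult, Cmod_R, Rabs_pos_eq by (left; apply Rinv_0_lt_compat; lra).
    apply Rmult_le_reg_l with (INR j * s); [nra|].
    replace (INR j * s * (/ INR j * Cmod (G j (cis x)) * s)) with (s ^ 2 * Cmod (G j (cis x)))
      by (field; lra).
    nra.
Qed.

(** Summing the kernels over the dyadic scales gives a polynomial whose real part is at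
    least of order min(1/|x|, 2^n), and whose modulus is larger by a logarithm at most. *)
Definition U (n : nat) (z : C) : C := csum (fun i => Fej (2 ^ i) z) (S n).

Lemma pow2_pos i : (0 < 2 ^ i)%nat.
Proof. induction i; simpl; lia. Qed.

Lemma pow2_le i n : (i <= n)%nat -> (2 ^ i <= 2 ^ n)%nat.
Proof. intros H. apply Nat.pow_le_mono_r; lia. Qed.

Lemma ispoly_U n : ispoly (2 ^ n) (U n).
Proof.
  apply (ispoly_csum (2 ^ n) (fun i => Fej (2 ^ i))). intros i Hi.
  apply ispoly_mono with (2 ^ i)%nat; [apply pow2_le; lia|apply ispoly_Fej].
Qed.

Lemma Re_U_ge i n x : (i <= n)%nat -> Re (Fej (2 ^ i) (cis x)) <= Re (U n (cis x)).
Proof.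
  intros Hi. unfold U. rewrite Re_csum.
  apply (rsum_term_le (fun k => Re (Fej (2 ^ k) (cis x)))); [|lia].
  intros k _. pose proof (Re_Fej_half (2 ^ k) x (pow2_pos k)). lra.
Qed.

(** The scale i is the largest one for which [Re_Fej_lower] applies at x. *)
Lemma dyadic_exists n x : Rabs x <= PI -> exists i, (i <= n)%nat /\ INR (2 ^ i) * Rabs x <= PI /\
  (i = n \/ PI < 2 * INR (2 ^ i) * Rabs x).
Proof.
  intros Hx. induction n as [|n [i [Hi [H1 H2]]]].
  - exists O. simpl. split; [lia|]. split; [lra|now left].
  - destruct (Rle_lt_dec (INR (2 ^ S n) * Rabs x) PI) as [H|H].
    + exists (S n). repeat split; auto.
    + exists i. split; [lia|]. split; [exact H1|]. right. destruct H2 as [->|H2]; [|exact H2].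
      replace (INR (2 ^ S n)) with (2 * INR (2 ^ n)) in H; [exact H|].
      simpl. rewrite Nat.add_0_r, plus_INR. ring.
Qed.

(** All kernels have positive real part, so a single well chosen scale suffices. *)
Lemma Re_U_lower n x B : Rabs x <= PI -> B * PI ^ 2 <= 2 * INR (2 ^ n) -> B * (PI * Rabs x) <= 1 ->
  B <= Re (U n (cis x)).
Proof.
  intros Hx HB1 HB2. pose proof PI_RGT_0 as HPI.
  destruct (dyadic_exists n x Hx) as [i [Hi [H1 H2]]].
  eapply Rle_trans; [|apply (Re_U_ge i n x Hi)].
  eapply Rle_trans; [|apply (Re_Fej_lower _ _ (pow2_pos i) H1)].
  apply Rmult_le_reg_r with (PI ^ 2); [nra|].
  replace (2 * INR (2 ^ i) / PI ^ 2 * PI ^ 2) with (2 * INR (2 ^ i)) by (field; lra).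
  destruct H2 as [->|H2]; [exact HB1|].
  destruct (Rle_lt_dec B 0) as [HB|HB].
  - pose proof (pos_INR (2 ^ i)). nra.
  - assert (B * PI * PI <= B * PI * (2 * INR (2 ^ i) * Rabs x)) by (apply Rmult_le_compat_l; nra).
    pose proof (pos_INR (2 ^ i)) as Hj.
    assert (2 * INR (2 ^ i) * (B * (PI * Rabs x)) <= 2 * INR (2 ^ i) * 1)
      by (apply Rmult_le_compat_l; lra).
    replace (B * PI ^ 2) with (B * PI * PI) by ring. lra.
Qed.

Lemma Cmod_U_le_inv n x : Cmod (U n (cis x)) * Cmod (1 - cis x) <= 3 * INR (S n).
Proof.
  unfold U. eapply Rle_trans; [apply Rmult_le_compat_r; [apply Cmod_ge_0|apply Cmod_csum]|].
  rewrite Rmult_comm, <- rsum_scal, (Rmult_comm 3). apply rsum_le_bound.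
  intros i _. rewrite Rmult_comm. apply Cmod_Fej_le_inv, pow2_pos.
Qed.

Lemma Cmod_U_le n x : Cmod (U n (cis x)) <= 2 * INR (2 ^ n).
Proof.
  unfold U. eapply Rle_trans; [apply Cmod_csum|].
  eapply Rle_trans; [apply rsum_le; intros i _; apply Cmod_Fej_le, pow2_pos|].
  induction n; [simpl; lra|].
  change (rsum (fun k => INR (2 ^ k)) (S n) + INR (2 ^ S n) <= 2 * INR (2 ^ S n)).
  replace (INR (2 ^ S n)) with (2 * INR (2 ^ n)); [lra|].
  rewrite Nat.pow_succ_r', mult_INR. reflexivity.
Qed.

Lemma Cmod_1_minus_pow w m : Cmod w <= 1 -> Cmod (1 - w ^ m) <= INR m * Cmod (1 - w).
Proof.
  intros Hw. induction m.
  - simpl. replace (1 - 1)%C with (RtoC 0) by ring. rewrite Cmod_0. lra.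
  - rewrite S_INR. simpl Cpow.
    replace (1 - w * w ^ m)%C with ((1 - w) + w * (1 - w ^ m))%C by ring.
    eapply Rle_trans; [apply Cmod_triangle|]. rewrite Cmod_mult.
    pose proof (Cmod_ge_0 (1 - w ^ m)). nra.
Qed.

(** With V = (kap/m) U take h = (1 - V)^m, an approximation of exp(-kap U).  For m large
    |V|^2 <= Re V, hence |1-V|^2 <= 1 - Re V <= exp(-Re V), and the bound for |h|
    follows from that for Re U.  The last bound is |1 - h| <= m |V| = kap |U|. *)
Lemma damping n kap : 0 <= kap -> exists (m : nat) (h : C -> C),
  INR m <= 8 * kap * INR (2 ^ n) ^ 2 + 1 /\
  ispoly (S (m * S (2 ^ n))) h /\
  (forall x, Cmod (h (cis x)) <= 1) /\
  (forall x B, Rabs x <= PI -> B * PI ^ 2 <= 2 * INR (2 ^ n) -> B * (PI * Rabs x) <= 1 ->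
     Cmod (h (cis x)) <= exp (- (kap / 2 * B))) /\
  (forall x, Cmod (1 - h (cis x)) * Cmod (1 - cis x) <= kap * (3 * INR (S n))).
Proof.
  intros Hk. set (D := INR (2 ^ n)).
  destruct (archimed (8 * kap * D ^ 2)) as [Ha1 Ha2].
  set (a := 8 * kap * D ^ 2) in *. assert (Ha0 : 0 <= a) by (unfold a; apply Rmult_le_pos; nra).
  set (m := Z.to_nat (up a)).
  assert (Hup : (0 < up a)%Z) by (apply lt_IZR; lra).
  assert (Em : INR m = IZR (up a)) by (unfold m; rewrite INR_IZR_INZ, Z2Nat.id; [reflexivity|lia]).
  assert (Hm0 : 0 < INR m) by (rewrite Em; lra).
  set (V := fun z => (RtoC (kap / INR m) * U n z)%C).
  exists m, (fun z => (1 - V z) ^ m)%C.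
  assert (Hkm : 0 <= kap / INR m) by (apply Rmult_le_pos; [lra|left; apply Rinv_0_lt_compat; lra]).
  assert (HRe : forall x, Re (V (cis x)) = kap / INR m * Re (U n (cis x))).
  { intros x. unfold V. destruct (U n (cis x)). simpl. ring. }
  (* That is, |V|^2 <= Re V: as |U| <= 2 D and Re U >= 1/2, it is enough that
     8 kap D^2 <= m. *)
  assert (Hstep : forall x, Cmod (1 - V (cis x)) ^ 2 <= 1 - Re (V (cis x))).
  { intros x.
    assert (E : Cmod (1 - V (cis x)) ^ 2 = 1 - 2 * Re (V (cis x)) + Cmod (V (cis x)) ^ 2).
    { rewrite !Cmod2_Re_Im. destruct (V (cis x)). simpl. ring. }
    rewrite E. enough (Cmod (V (cis x)) ^ 2 <= Re (V (cis x))) by lra.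
    rewrite HRe. unfold V. rewrite Cmod_mult, Cmod_R, Rabs_pos_eq by exact Hkm.
    rewrite Rpow_mult_distr.
    replace ((kap / INR m) ^ 2 * Cmod (U n (cis x)) ^ 2)
      with (kap / INR m * (kap / INR m * Cmod (U n (cis x)) ^ 2)) by ring.
    apply Rmult_le_compat_l; [exact Hkm|].
    assert (H1 : / 2 <= Re (U n (cis x))).
    { eapply Rle_trans; [|apply (Re_U_ge 0 n x); lia]. apply Re_Fej_half, pow2_pos. }
    eapply Rle_trans; [|exact H1].
    pose proof (Cmod_U_le n x) as H2. fold D in H2. pose proof (Cmod_ge_0 (U n (cis x))) as H3.
    assert (H4 : Cmod (U n (cis x)) ^ 2 <= 4 * D ^ 2) by nra.
    apply Rmult_le_reg_l with (INR m); [exact Hm0|].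
    replace (INR m * (kap / INR m * Cmod (U n (cis x)) ^ 2)) with (kap * Cmod (U n (cis x)) ^ 2)
      by (field; lra).
    assert (kap * Cmod (U n (cis x)) ^ 2 <= kap * (4 * D ^ 2)) by (apply Rmult_le_compat_l; lra).
    unfold a in *. lra. }
  assert (HRe0 : forall x, 0 <= Re (V (cis x))).
  { intros x. rewrite HRe. apply Rmult_le_pos; [exact Hkm|].
    pose proof (Re_U_ge 0 n x ltac:(lia)). pose proof (Re_Fej_half (2 ^ 0) x (pow2_pos 0)). lra. }
  assert (Hle1 : forall x, Cmod (1 - V (cis x)) <= 1).
  { intros x. specialize (Hstep x). specialize (HRe0 x). apply Cmod_sq_le; lra. }
  split; [rewrite Em; unfold a in *; lra|]. split; [|split; [|split]].
  - apply ispoly_pow. apply ispoly_ext with (fun z => 1 + RtoC (- (kap / INR m)) * U n z)%C.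
    { intros z. unfold V. rewrite RtoC_opp. ring. }
    apply ispoly_plus.
    + apply ispoly_mono with 1%nat; [lia|apply ispoly_const].
    + apply ispoly_scal, ispoly_mono with (2 ^ n)%nat; [lia|apply ispoly_U].
  - intros x. rewrite Cmod_pow. apply pow_le_one. split; [apply Cmod_ge_0|apply Hle1].
  - intros x B Hx HB1 HB2. rewrite Cmod_pow.
    pose proof (Re_U_lower n x B Hx HB1 HB2) as HB.
    apply Rsqr_incr_0_var; [|left; apply exp_pos]. rewrite !Rsqr_pow2.
    rewrite <- pow_mult, Nat.mul_comm, pow_mult.
    apply Rle_trans with ((exp (- Re (V (cis x)))) ^ m).
    + apply pow_incr. split; [apply pow_le, Cmod_ge_0|].
      eapply Rle_trans; [apply Hstep|]. pose proof (exp_ineq1_le (- Re (V (cis x)))). lra.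
    + replace (exp (- (kap / 2 * B)) ^ 2) with (exp (- (kap * B))).
      2:{ simpl. rewrite Rmult_1_r, <- exp_plus. f_equal. field. }
      assert (E : forall t k, exp t ^ k = exp (INR k * t)).
      { intros t k. induction k; [simpl; now rewrite Rmult_0_l, exp_0|].
        rewrite S_INR. simpl. rewrite IHk, <- exp_plus. f_equal; ring. }
      rewrite E, HRe.
      replace (INR m * - (kap / INR m * Re (U n (cis x)))) with (- (kap * Re (U n (cis x))))
        by (field; lra).
      assert (kap * B <= kap * Re (U n (cis x))) by (apply Rmult_le_compat_l; lra).
      destruct (Req_dec (kap * B) (kap * Re (U n (cis x)))) as [->|Hne]; [lra|].
      left. apply exp_increasing. lra.
  - intros x. eapply Rle_trans; [apply Rmult_le_compat_r; [apply Cmod_ge_0|apply Cmod_1_minus_pow, Hle1]|].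
    replace (1 - (1 - V (cis x)))%C with (V (cis x)) by ring.
    unfold V. rewrite Cmod_mult, Cmod_R, Rabs_pos_eq by exact Hkm.
    replace (INR m * (kap / INR m * Cmod (U n (cis x))) * Cmod (1 - cis x))
      with (kap * (Cmod (U n (cis x)) * Cmod (1 - cis x))) by (field; lra).
    apply Rmult_le_compat_l; [exact Hk|apply Cmod_U_le_inv].
Qed.

(** * Plane curves and the Fresnel integral *)

Lemma Cmod_pair_dot a b x y : a * x + b * y <= Cmod (a, b) * Cmod (x, y).
Proof.
  rewrite <- (Cmod_conj (a, b)), <- Cmod_mult.
  eapply Rle_trans; [|eapply Rle_trans; [apply Rle_abs|apply re_le_Cmod]].
  right. simpl. ring.
Qed.

(** Mean value inequality for a plane curve of speed at most g'.  The mean value theorem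
    is applied to the component of the curve in the direction of the displacement. *)
Lemma curve_mvt (u v g u' v' g' : R -> R) a b : a <= b ->
  (forall y, a <= y <= b -> is_derive u y (u' y)) ->
  (forall y, a <= y <= b -> is_derive v y (v' y)) ->
  (forall y, a <= y <= b -> is_derive g y (g' y)) ->
  (forall y, a <= y <= b -> Cmod (u' y, v' y) <= g' y) ->
  Cmod (u b - u a, v b - v a) <= g b - g a.
Proof.
  intros Hab Hu Hv Hg H.
  destruct Hab as [Hab|<-].
  2:{ unfold Rminus. rewrite !Rplus_opp_r. change (0, 0) with (RtoC 0). rewrite Cmod_0. lra. }
  set (w := (u b - u a, v b - v a) : C).
  set (c := Re w). set (s := Im w).
  destruct (MVT_cor2 (fun y => c * u y + s * v y - Cmod w * g y)
    (fun y => c * u' y + s * v' y - Cmod w * g' y) a b Hab) as [y [E [Hy1 Hy2]]].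
  { intros y Hy. apply is_derive_Reals.
    apply (is_derive_minus (fun y => c * u y + s * v y) (fun y => Cmod w * g y)).
    - apply (is_derive_plus (fun y => c * u y) (fun y => s * v y)).
      + apply is_derive_scal, Hu, Hy.
      + apply is_derive_scal, Hv, Hy.
    - apply is_derive_scal, Hg, Hy. }
  pose proof (H y ltac:(lra)) as Hy.
  assert (Hd : c * u' y + s * v' y <= Cmod w * g' y).
  { eapply Rle_trans; [apply Cmod_pair_dot|].
    replace (c, s) with w by (unfold c, s; destruct w; reflexivity).
    apply Rmult_le_compat_l; [apply Cmod_ge_0|exact Hy]. }
  assert (Ew : c * (u b - u a) + s * (v b - v a) = Cmod w * Cmod w).
  { replace (Cmod w * Cmod w) with (Cmod w ^ 2) by ring. rewrite Cmod2_Re_Im.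
    unfold c, s, w; simpl. ring. }
  assert (Hfin : Cmod w * Cmod w <= Cmod w * (g b - g a)).
  { assert ((c * u' y + s * v' y - Cmod w * g' y) * (b - a) <= 0 * (b - a))
      by (apply Rmult_le_compat_r; lra). lra. }
  destruct (Rle_lt_dec (Cmod w) 0) as [Hw|Hw].
  - assert (Hg0 : 0 <= g b - g a).
    { destruct (MVT_cor2 g g' a b Hab) as [t [Et [Ht1 Ht2]]].
      { intros t Ht. apply is_derive_Reals, Hg, Ht. }
      rewrite Et. apply Rmult_le_pos; [|lra].
      eapply Rle_trans; [apply Cmod_ge_0|apply (H t); lra]. }
    lra.
  - apply Rmult_le_reg_l with (Cmod w); assumption.
Qed.

Definition Fc (y : R) : R := RInt (fun t => cos (t ^ 2 / 2)) 0 y.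
Definition Fs (y : R) : R := RInt (fun t => sin (t ^ 2 / 2)) 0 y.
(** The integral of exp(i t^2/2) from 0 to y. *)
Definition Fr (y : R) : C := (Fc y, Fs y).

Lemma is_derive_RInt_0 (f : R -> R) y : (forall t, continuous f t) ->
  is_derive (fun y => RInt f 0 y) y (f y).
Proof.
  intros Hf. apply (is_derive_RInt f (fun y => RInt f 0 y) 0 y).
  - exists posreal_one. intros t _. apply (RInt_correct f).
    apply (ex_RInt_continuous f). intros; apply Hf.
  - apply Hf.
Qed.

Lemma is_derive_Fc y : is_derive Fc y (cos (y ^ 2 / 2)).
Proof.
  apply (is_derive_RInt_0 (fun t => cos (t ^ 2 / 2))). intros t.
  apply ex_derive_continuous_R. auto_derive. exact I.
Qed.

Lemma is_derive_Fs y : is_derive Fs y (sin (y ^ 2 / 2)).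
Proof.
  apply (is_derive_RInt_0 (fun t => sin (t ^ 2 / 2))). intros t.
  apply ex_derive_continuous_R. auto_derive. exact I.
Qed.

Lemma pair_split (x1 x2 y1 y2 p1 p2 q1 q2 : R) :
  Cplus ((x1 - p1) - (y1 - q1), (x2 + p2) - (y2 + q2)) (Cminus (p1, - p2) (q1, - q2))
   = Cminus (x1, x2) (y1, y2).
Proof. unfold Cminus, Copp, Cplus; simpl. f_equal; ring. Qed.

(** Integration by parts: the curve Fr(y) + i exp(i y^2/2)/y has speed 1/y^2. *)
Lemma Fr_tail a b : a <= b -> 0 < a * b ->
  Cmod (Fr b - Fr a) <= / Rabs a + / Rabs b + (/ a - / b).
Proof.
  intros Hab H0.
  assert (Hne : forall y, a <= y <= b -> y <> 0) by (intros y Hy ->; nra).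
  set (u := fun y => Fc y - sin (y ^ 2 / 2) / y).
  set (v := fun y => Fs y + cos (y ^ 2 / 2) / y).
  assert (H : Cmod (u b - u a, v b - v a) <= - / b - - / a).
  { apply (curve_mvt u v (fun y => - / y) (fun y => sin (y ^ 2 / 2) / y ^ 2)
      (fun y => - cos (y ^ 2 / 2) / y ^ 2) (fun y => / y ^ 2)); [exact Hab| | | |].
    - intros y Hy. specialize (Hne y Hy). unfold u.
      replace (sin (y ^ 2 / 2) / y ^ 2) with
        (cos (y ^ 2 / 2) - (cos (y ^ 2 / 2) - sin (y ^ 2 / 2) / y ^ 2)) by ring.
      apply (is_derive_minus Fc (fun y => sin (y ^ 2 / 2) / y)); [apply is_derive_Fc|].
      auto_derive; [exact Hne|].
      change (y * (y * 1) * / 2) with (y ^ 2 / 2). field. exact Hne.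
    - intros y Hy. specialize (Hne y Hy). unfold v.
      replace (- cos (y ^ 2 / 2) / y ^ 2) with
        (sin (y ^ 2 / 2) + (- sin (y ^ 2 / 2) - cos (y ^ 2 / 2) / y ^ 2)) by (field; exact Hne).
      apply (is_derive_plus Fs (fun y => cos (y ^ 2 / 2) / y)); [apply is_derive_Fs|].
      auto_derive; [exact Hne|].
      change (y * (y * 1) * / 2) with (y ^ 2 / 2). field. exact Hne.
    - intros y Hy. specialize (Hne y Hy). auto_derive; [exact Hne|]. field. exact Hne.
    - intros y Hy. specialize (Hne y Hy).
      replace (sin (y ^ 2 / 2) / y ^ 2, - cos (y ^ 2 / 2) / y ^ 2) with
        (RtoC (/ y ^ 2) * (- Ci * cis (y ^ 2 / 2)))%C.
      + rewrite Cmod_mult, Cmod_mult, Cmod_opp, Cmod_Ci, Cmod_cis, Cmod_R, Rabs_pos_eq; [lra|].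
        left. apply Rinv_0_lt_compat. apply pow2_gt_0, Hne.
      + unfold Cmult, cis; simpl. f_equal; field; exact Hne. }
  assert (Hb : forall y, y <> 0 -> Cmod (sin (y ^ 2 / 2) / y, - (cos (y ^ 2 / 2) / y)) = / Rabs y).
  { intros y Hy.
    replace (sin (y ^ 2 / 2) / y, - (cos (y ^ 2 / 2) / y)) with
      (RtoC (/ y) * (- Ci * cis (y ^ 2 / 2)))%C.
    - rewrite Cmod_mult, Cmod_mult, Cmod_opp, Cmod_Ci, Cmod_cis, Cmod_R, Rabs_inv. ring.
    - unfold Cmult, cis; simpl. f_equal; field; exact Hy. }
  pose proof (Hb a (Hne a ltac:(lra))) as Hba. pose proof (Hb b (Hne b ltac:(lra))) as Hbb.
  set (w := (u b - u a, v b - v a) : C) in *.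
  set (wa := (sin (a ^ 2 / 2) / a, - (cos (a ^ 2 / 2) / a)) : C) in *.
  set (wb := (sin (b ^ 2 / 2) / b, - (cos (b ^ 2 / 2) / b)) : C) in *.
  replace (Fr b - Fr a)%C with (w + (wb - wa))%C.
  2:{ exact (pair_split (Fc b) (Fs b) (Fc a) (Fs a) _ _ _ _). }
  eapply Rle_trans; [apply Cmod_triangle|].
  pose proof (Cmod_triangle wb (- wa)) as Ht. rewrite Cmod_opp in Ht.
  change (wb - wa)%C with (wb + - wa)%C. lra.
Qed.

Lemma is_derive_sin_affine k m a y : m <> 0 ->
  is_derive (fun y => sin (k + m * (y - a)) / m) y (cos (k + m * (y - a))).
Proof.
  intros Hm. auto_derive; [exact I|]. change (y + - a) with (y - a). field. exact Hm.
Qed.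

Lemma is_derive_cos_affine k m a y : m <> 0 ->
  is_derive (fun y => cos (k + m * (y - a)) / m) y (- sin (k + m * (y - a))).
Proof.
  intros Hm. auto_derive; [exact I|]. change (y + - a) with (y - a). field. exact Hm.
Qed.

(** Replacing the phase y^2/2 by its chord, of slope (a+b)/2, leaves an integral that
    can be evaluated; the phase changes by at most (b-a)^2/8. *)
Lemma Fr_chord a b : a < b -> a + b <> 0 ->
  Cmod (Fr b - Fr a - RtoC (2 / (a + b)) * (- Ci * (cis (b ^ 2 / 2) - cis (a ^ 2 / 2))))
   <= (b - a) ^ 3 / 8.
Proof.
  intros Hab Hm. set (m := (a + b) / 2). assert (Hm0 : m <> 0) by (unfold m; lra).
  set (L := fun y => a ^ 2 / 2 + m * (y - a)).
  set (u := fun y => Fc y - sin (L y) / m). set (v := fun y => Fs y + cos (L y) / m).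
  assert (H : Cmod (u b - u a, v b - v a) <= (b - a) ^ 2 / 8 * b - (b - a) ^ 2 / 8 * a).
  { apply (curve_mvt u v (fun y => (b - a) ^ 2 / 8 * y)
      (fun y => cos (y ^ 2 / 2) - cos (L y)) (fun y => sin (y ^ 2 / 2) - sin (L y))
      (fun _ => (b - a) ^ 2 / 8)); [lra| | | |].
    - intros y Hy. apply (is_derive_minus Fc (fun y => sin (L y) / m)); [apply is_derive_Fc|].
      apply is_derive_sin_affine, Hm0.
    - intros y Hy. unfold Rminus.
      apply (is_derive_plus Fs (fun y => cos (L y) / m)); [apply is_derive_Fs|].
      apply is_derive_cos_affine, Hm0.
    - intros y Hy. auto_derive; [exact I|]. field.
    - intros y Hy. change (Cmod (cis (y ^ 2 / 2) - cis (L y)) <= (b - a) ^ 2 / 8).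
      eapply Rle_trans; [apply Cmod_cis_minus|].
      replace (y ^ 2 / 2 - L y) with (- ((y - a) * (b - y) / 2)) by (unfold L, m; field).
      rewrite Rabs_Ropp, Rabs_pos_eq; [|apply Rmult_le_pos; nra].
      assert (0 <= (y - a - (b - y)) ^ 2) by apply pow2_ge_0. nra. }
  replace (Fr b - Fr a - RtoC (2 / (a + b)) * (- Ci * (cis (b ^ 2 / 2) - cis (a ^ 2 / 2))))%C
    with (u b - u a, v b - v a).
  - eapply Rle_trans; [exact H|]. right. field.
  - assert (Ea : L a = a ^ 2 / 2) by (unfold L; ring).
    assert (Eb : L b = b ^ 2 / 2) by (unfold L, m; field).
    unfold u, v. rewrite Ea, Eb. unfold Fr, cis, Cminus, Copp, Cmult, Cplus, m; cbn -[Fc Fs cos sin pow].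
    f_equal; field; exact Hm.
Qed.

(** * The function cot y - 1/y *)

Definition gcot (y : R) : R := cos y / sin y - / y.

Lemma gcot_odd y : gcot (- y) = - gcot y.
Proof.
  unfold gcot. rewrite cos_neg, sin_neg. unfold Rdiv.
  rewrite !Rinv_opp. ring.
Qed.

(** The derivative is 1/y^2 - 1/sin^2 y, and sin y <= y. *)
Lemma gcot_decr x y : 0 < x -> x <= y -> y < PI -> gcot y <= gcot x.
Proof.
  intros Hx [Hxy|<-] Hy; [|lra].
  destruct (MVT_cor2 gcot (fun t => / t ^ 2 - / (sin t) ^ 2) x y Hxy) as [t [E [H1 H2]]].
  { intros t Ht. assert (0 < sin t) by (apply sin_gt_0; lra).
    apply is_derive_Reals. unfold gcot. auto_derive; [split; [lra|split; [lra|exact I]]|].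
    pose proof (sin2_cos2 t) as Hsc. unfold Rsqr in Hsc.
    replace (cos t) with (1 * cos t) at 1 by ring.
    transitivity (/ t ^ 2 - (sin t * sin t + cos t * cos t) / (sin t) ^ 2); [field; lra|].
    rewrite Hsc. field. lra. }
  assert (Hs : 0 < sin t) by (apply sin_gt_0; lra).
  assert (Hst : sin t <= t).
  { pose proof (Rabs_sin_le t). rewrite !Rabs_pos_eq in H; lra. }
  assert (/ t ^ 2 <= / (sin t) ^ 2).
  { apply Rinv_le_contravar; [nra|]. apply pow_incr. lra. }
  assert ((/ t ^ 2 - / sin t ^ 2) * (y - x) <= 0 * (y - x)) by (apply Rmult_le_compat_r; lra).
  lra.
Qed.

Lemma ycosy_le y : 0 < y < PI -> y * cos y <= sin y.
Proof.
  intros Hy.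
  destruct (MVT_cor2 (fun t => sin t - t * cos t) (fun t => t * sin t) 0 y) as [t [E [H1 H2]]];
    [lra| |].
  { intros t Ht. apply is_derive_Reals. auto_derive; [exact I|]. ring. }
  rewrite sin_0 in E. assert (0 < sin t) by (apply sin_gt_0; lra).
  assert (0 <= t * sin t * (y - 0)) by (apply Rmult_le_pos; nra). lra.
Qed.

Lemma gcot_le0 y : 0 < y < PI -> gcot y <= 0.
Proof.
  intros Hy. pose proof (ycosy_le y Hy). assert (0 < sin y) by (apply sin_gt_0; lra).
  unfold gcot. apply Rmult_le_reg_l with (y * sin y); [nra|].
  replace (y * sin y * (cos y / sin y - / y)) with (y * cos y - sin y) by (field; lra). lra.
Qed.

(** There is no singularity at 0, only the simple pole at PI. *)
Lemma gcot_bound y : 0 < y < PI -> Rabs (gcot y) <= / (PI - y) + 1.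
Proof.
  intros Hy. pose proof (gcot_le0 y Hy) as H0. rewrite Rabs_left1 by exact H0.
  assert (Hs : 0 < sin y) by (apply sin_gt_0; lra).
  assert (Hi : 0 < / (PI - y)) by (apply Rinv_0_lt_compat; lra).
  destruct (Rle_lt_dec 1 y) as [H1|H1].
  - pose proof (gcot_le0 (PI - y) ltac:(lra)) as H2. unfold gcot in *.
    rewrite sin_PI_x in H2. replace (cos (PI - y)) with (- cos y) in H2.
    2:{ rewrite cos_minus, cos_PI, sin_PI. ring. }
    assert (/ y <= 1) by (rewrite <- Rinv_1; apply Rinv_le_contravar; lra).
    unfold Rdiv in *. lra.
  - enough (- gcot y <= 1) by lra.
    unfold gcot. apply Rmult_le_reg_l with (y * sin y); [nra|].
    replace (y * sin y * - (cos y / sin y - / y)) with (sin y - y * cos y) by (field; lra).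
    assert (Hst : sin y <= y).
    { pose proof (Rabs_sin_le y). rewrite !Rabs_pos_eq in H; lra. }
    assert (Hc : 0 < cos y) by (apply cos_gt_0; pose proof PI2_1; lra).
    pose proof (sin2_cos2 y) as Hsc. unfold Rsqr in Hsc.
    assert (1 - cos y <= sin y).
    { nra. }
    nra.
Qed.

Lemma gcot_decr_neg x y : - PI < x -> x <= y -> y < 0 -> gcot y <= gcot x.
Proof.
  intros Hx Hxy Hy. pose proof (gcot_decr (- y) (- x) ltac:(lra) ltac:(lra) ltac:(lra)) as H.
  rewrite !gcot_odd in H. lra.
Qed.

Lemma gcot_bound_neg y : - PI < y < 0 -> Rabs (gcot y) <= / (PI + y) + 1.
Proof.
  intros Hy. pose proof (gcot_bound (- y) ltac:(lra)) as H.
  rewrite gcot_odd, Rabs_Ropp in H. unfold Rminus in H. rewrite Ropp_involutive in H. exact H.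
Qed.

(** * Summation by parts *)

(** Differences of a bounded sequence against a weight of bounded variation. *)
Lemma abel_bound (h : nat -> C) (z : nat -> R) n : (forall k, Cmod (h k) <= 1) ->
  Cmod (csum (fun k => (h (S k) - h k) * RtoC (z k))%C (S n))
    <= Rabs (z O) + Rabs (z n) + rsum (fun k => Rabs (z (S k) - z k)) n.
Proof.
  intros Hh.
  assert (E : csum (fun k => (h (S k) - h k) * RtoC (z k))%C (S n) =
    (h (S n) * RtoC (z n) - h O * RtoC (z O)
      - csum (fun k => h (S k) * RtoC (z (S k) - z k)) n)%C).
  { induction n; [simpl; ring|].
    change (csum (fun k => (h (S k) - h k) * RtoC (z k))%C (S (S n))) with
      (csum (fun k => (h (S k) - h k) * RtoC (z k))%C (S n)
        + (h (S (S n)) - h (S n)) * RtoC (z (S n)))%C.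
    rewrite IHn. simpl csum. rewrite RtoC_minus. ring. }
  rewrite E. unfold Cminus.
  eapply Rle_trans; [apply Cmod_triangle|]. rewrite Cmod_opp.
  pose proof (Cmod_triangle (h (S n) * RtoC (z n)) (- (h O * RtoC (z O)))) as H1.
  rewrite Cmod_opp, !Cmod_mult, !Cmod_R in H1.
  assert (H2 : Cmod (csum (fun k => h (S k) * RtoC (z (S k) - z k))%C n)
     <= rsum (fun k => Rabs (z (S k) - z k)) n).
  { eapply Rle_trans; [apply Cmod_csum|]. apply rsum_le. intros k _.
    rewrite Cmod_mult, Cmod_R. pose proof (Rabs_pos (z (S k) - z k)). specialize (Hh (S k)). nra. }
  pose proof (Hh (S n)). pose proof (Hh O). pose proof (Rabs_pos (z n)). pose proof (Rabs_pos (z O)).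
  assert (Cmod (h (S n)) * Rabs (z n) <= 1 * Rabs (z n)) by (apply Rmult_le_compat_r; lra).
  assert (Cmod (h O) * Rabs (z O) <= 1 * Rabs (z O)) by (apply Rmult_le_compat_r; lra).
  lra.
Qed.

Lemma tv_prod (A g : nat -> R) B n :
  (forall k, (k <= n)%nat -> 0 <= A k <= 1) ->
  (forall k, (k < n)%nat -> A (S k) <= A k) ->
  (forall k, (k <= n)%nat -> Rabs (g k) <= B) ->
  (forall k, (k < n)%nat -> g (S k) <= g k) ->
  rsum (fun k => Rabs (A (S k) * g (S k) - A k * g k)) n <= 3 * B.
Proof.
  intros HA HAd Hg Hgd.
  apply Rle_trans with (rsum (fun k => - (g (S k) - g k) + B * - (A (S k) - A k)) n).
  - apply rsum_le. intros k Hk.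
    replace (A (S k) * g (S k) - A k * g k) with
      (- (A (S k) * (g k - g (S k)) + g k * (A k - A (S k)))) by ring.
    rewrite Rabs_Ropp. eapply Rle_trans; [apply Rabs_triang|].
    rewrite !Rabs_mult. specialize (HAd k Hk). specialize (Hgd k Hk).
    pose proof (HA (S k) ltac:(lia)). pose proof (Hg k ltac:(lia)).
    rewrite (Rabs_pos_eq (A (S k))), (Rabs_pos_eq (g k - _)), (Rabs_pos_eq (A k - _)) by lra.
    nra.
  - rewrite rsum_plus, rsum_scal.
    rewrite (rsum_ext _ (fun k => -1 * (g (S k) - g k))) by (intros; ring).
    rewrite (rsum_ext (fun k => - (A (S k) - A k)) (fun k => -1 * (A (S k) - A k))) by (intros; ring).
    rewrite !rsum_scal, !rsum_telescope.
    pose proof (Hg O ltac:(lia)) as H1. pose proof (Hg n ltac:(lia)) as H2.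
    apply Rabs_le_between in H1. apply Rabs_le_between in H2.
    pose proof (HA O ltac:(lia)). pose proof (HA n ltac:(lia)). nra.
Qed.

(** One step of a sum of exp(i y^2/2) with amplitude A, compared with c times the
    integral over the same step.  Since half the sum of two points of the circle is
    -i cot(th/2) times half their difference, and by [Fr_chord] the integral is nearly
    -2i/(a+b) times their difference, what remains is a multiple of the difference of
    the two points.  In its coefficient the poles of the cotangent and of 1/th cancel
    up to the mismatch A - c (b-a), which makes it suitable for summation by parts. *)
Lemma cell a b A c : a < b -> a + b <> 0 -> 0 <= c ->
  let th := (b ^ 2 - a ^ 2) / 2 in sin (th / 2) <> 0 ->
  Cmod (RtoC (A / 2) * (cis (a ^ 2 / 2) + cis (b ^ 2 / 2)) - RtoC c * (Fr b - Fr a)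
     - - Ci * ((cis (b ^ 2 / 2) - cis (a ^ 2 / 2))
        * RtoC (A * gcot (th / 2) / 2 + (A - c * (b - a)) / th)))
   <= c * ((b - a) ^ 3 / 8).
Proof.
  intros Hab Hs Hc th Hth.
  assert (Eth : th = (b - a) * (a + b) / 2) by (unfold th; field).
  assert (Hth0 : th <> 0).
  { rewrite Eth. intros H0.
    assert (H1 : (b - a) * (a + b) = 0) by lra.
    apply Rmult_integral in H1. destruct H1; lra. }
  set (ha := cis (a ^ 2 / 2)). set (hb := cis (b ^ 2 / 2)).
  assert (Ecot : (ha + hb = - Ci * ((hb - ha) * RtoC (cos (th / 2) / sin (th / 2))))%C).
  { set (mid := (a ^ 2 / 2 + b ^ 2 / 2) / 2).
    assert (Ea : ha = cis (mid - th / 2)) by (unfold ha, mid, th; f_equal; field).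
    assert (Eb : hb = cis (mid + th / 2)) by (unfold hb, mid, th; f_equal; field).
    rewrite Ea, Eb, cis_minus, cis_plus. unfold cis, Cconj, Cminus, Copp, Cmult, Cplus, RtoC, Ci; simpl.
    f_equal; field; exact Hth. }
  assert (HZ : A * gcot (th / 2) / 2 + (A - c * (b - a)) / th
    = A / 2 * (cos (th / 2) / sin (th / 2)) - c * (2 / (a + b))).
  { unfold gcot. replace (c * (2 / (a + b))) with (c * (b - a) / th).
    - field. split; assumption.
    - rewrite Eth. field. lra. }
  rewrite HZ, RtoC_minus, !RtoC_mult, Ecot.
  replace (_ - _ - _)%C with
    (- (RtoC c * (Fr b - Fr a - RtoC (2 / (a + b)) * (- Ci * (hb - ha)))))%C by ring.
  rewrite Cmod_opp, Cmod_mult, Cmod_R, Rabs_pos_eq by exact Hc.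
  apply Rmult_le_compat_l; [exact Hc|]. apply Fr_chord; assumption.
Qed.

(** * Gauss sums and the modulus of the Fresnel integral *)

Definition gterm (M k : nat) : C := cis (PI * (INR k - INR M) ^ 2 / INR (2 * M)).

Lemma csum_periodic_shift (u : nat -> C) L l : (forall k, u (k + L)%nat = u k) ->
  csum (fun k => u (k + l)%nat) L = csum u L.
Proof.
  intros Hu. induction l.
  - apply csum_ext. intros k _. f_equal. lia.
  - rewrite <- IHl.
    pose proof (csum_shift (fun k => u (k + l)%nat) L) as H. simpl in H.
    rewrite (Nat.add_comm L l), (Nat.add_comm l L) in H.
    assert (E : u (L + l)%nat = u l) by (rewrite Nat.add_comm; apply Hu).
    rewrite E in H.
    rewrite (csum_ext _ (fun k => u (S (k + l)))) by (intros; f_equal; lia).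
    set (X := csum (fun k => u (k + l)%nat) L) in *.
    set (Y := csum (fun k => u (S (k + l))) L) in *.
    assert (H2 : (X + u l - u l)%C = (u l + Y - u l)%C) by (rewrite H; reflexivity).
    replace X with (X + u l - u l)%C by ring. rewrite H2. ring.
Qed.

Lemma gterm_periodic M k : (0 < M)%nat -> gterm M (k + 2 * M) = gterm M k.
Proof.
  intros HM. unfold gterm. assert (0 < INR M) by (apply lt_0_INR; exact HM).
  replace (PI * (INR (k + 2 * M) - INR M) ^ 2 / INR (2 * M)) with
    (PI * (INR k - INR M) ^ 2 / INR (2 * M) + 2 * PI * INR k).
  - rewrite cis_plus, cis_2PI_INR. ring.
  - rewrite plus_INR, mult_INR. simpl INR. field. lra.
Qed.

(** Completing the square: multiplying the terms by the k-th powers of a root of unity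
    only shifts the sum and rotates it, so the polynomial with these coefficients has
    the same modulus at all 2M-th roots of unity.  By Parseval its square is 2M. *)
Lemma gauss_sum M : (0 < M)%nat -> Cmod (csum (gterm M) (2 * M)) = sqrt (INR (2 * M)).
Proof.
  intros HM. assert (HM0 : 0 < INR M) by (apply lt_0_INR; exact HM).
  set (L := (2 * M)%nat). assert (EL : INR L = 2 * INR M) by (unfold L; rewrite mult_INR; reflexivity).
  assert (H : forall l, Cmod (peval (gterm M) L (root L l)) = Cmod (csum (gterm M) L)).
  { intros l. rewrite <- (csum_periodic_shift (gterm M) L l) by (intros; apply gterm_periodic, HM).
    set (t := PI * (2 * INR l * INR M - INR l ^ 2) / INR L).
    rewrite <- (Rmult_1_l (Cmod (csum (fun k => gterm M (k + l)) L))), <- (Cmod_cis t), <- Cmod_mult.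
    f_equal. unfold peval. rewrite <- csum_scal. apply csum_ext. intros k _.
    rewrite root_pow. unfold gterm. rewrite <- !cis_plus. f_equal. unfold t. fold L.
    rewrite plus_INR, mult_INR. field. lra. }
  pose proof (parseval (gterm M) L L (le_n L)) as HP.
  rewrite (rsum_ext _ (fun _ => Cmod (csum (gterm M) L) ^ 2)) in HP by (intros; now rewrite H).
  rewrite (rsum_ext (fun k => Cmod (gterm M k) ^ 2) (fun _ => 1)) in HP
    by (intros; unfold gterm; rewrite Cmod_cis; ring).
  rewrite !rsum_const in HP.
  assert (E : Cmod (csum (gterm M) L) ^ 2 = INR L) by nra.
  rewrite <- E. symmetry. apply sqrt_pow2, Cmod_ge_0.
Qed.

Lemma block_sum (h : nat -> C) (z : nat -> R) n T :
  (forall k, Cmod (h k) <= 1) -> (forall k, (k < n)%nat -> Rabs (z k) <= T) ->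
  rsum (fun k => Rabs (z (S k) - z k)) (pred n) <= T -> 0 <= T ->
  Cmod (csum (fun k => (h (S k) - h k) * RtoC (z k))%C n) <= 3 * T.
Proof.
  intros Hh Hz Htv HT. destruct n as [|n]; [simpl; rewrite Cmod_0; lra|].
  eapply Rle_trans; [apply abel_bound, Hh|]. simpl pred in Htv.
  pose proof (Hz O ltac:(lia)). pose proof (Hz n ltac:(lia)). lra.
Qed.

(** The form in which summation by parts is used: by [cell] the weight of a step is half
    of a monotone amplitude times cot - 1/y, plus a correction r. *)
Lemma weight_block (h : nat -> C) (A g r : nat -> R) B T n :
  (forall k, Cmod (h k) <= 1) -> 0 <= B ->
  (forall k, 0 <= A k <= 1) -> (forall k, A (S k) <= A k) ->
  (forall k, (k < n)%nat -> Rabs (g k) <= B) ->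
  (forall k, (S k < n)%nat -> g (S k) <= g k) ->
  (forall k, (k < n)%nat -> Rabs (r k) <= B) ->
  rsum (fun k => Rabs (r (S k) - r k)) (pred n) <= T ->
  Cmod (csum (fun k => (h (S k) - h k) * RtoC (A k * g k / 2 + r k))%C n) <= 3 * (3 / 2 * B + T).
Proof.
  intros Hh HB HA HAd Hg Hgd Hr HT.
  assert (HT0 : 0 <= T).
  { eapply Rle_trans; [|exact HT]. apply rsum_ge0. intros; apply Rabs_pos. }
  apply (block_sum h (fun k => A k * g k / 2 + r k)); [exact Hh| | |lra].
  - intros k Hk. specialize (Hg k Hk). specialize (Hr k Hk). specialize (HA k).
    eapply Rle_trans; [apply Rabs_triang|].
    unfold Rdiv. rewrite !Rabs_mult, (Rabs_pos_eq (/ 2)), (Rabs_pos_eq (A k)) by lra.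
    pose proof (Rabs_pos (g k)). nra.
  - destruct n as [|n]; [simpl; lra|]. simpl pred in *.
    assert (H : rsum (fun k => Rabs (A (S k) * g (S k) - A k * g k)) n <= 3 * B).
    { apply tv_prod; intros; auto; [apply Hg|apply Hgd]; lia. }
    apply Rle_trans with (rsum (fun k => / 2 * Rabs (A (S k) * g (S k) - A k * g k)
       + Rabs (r (S k) - r k)) n).
    + apply rsum_le. intros k _.
      replace (A (S k) * g (S k) / 2 + r (S k) - (A k * g k / 2 + r k)) with
        (/ 2 * (A (S k) * g (S k) - A k * g k) + (r (S k) - r k)) by field.
      eapply Rle_trans; [apply Rabs_triang|]. rewrite Rabs_mult, (Rabs_pos_eq (/ 2)) by lra. lra.
    + rewrite rsum_plus, rsum_scal. lra.
Qed.

Lemma Cmod_diff_le x y : Rabs (Cmod x - Cmod y) <= Cmod (x - y).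
Proof.
  pose proof (Cmod_triangle (x - y) y) as T1. replace (x - y + y)%C with x in T1 by ring.
  pose proof (Cmod_triangle (y - x) x) as T2. replace (y - x + x)%C with y in T2 by ring.
  replace (y - x)%C with (- (x - y))%C in T2 by ring. rewrite Cmod_opp in T2.
  apply Rabs_le. lra.
Qed.

(** The Gauss sum consists of values of exp(i y^2/2) at points of equal spacing d, with
    c d = 1, so in [cell] there is no amplitude mismatch; the phase increments th stay in
    [-PI, PI], away from the pole of cot(th/2) - 2/th, and are monotone. *)
Lemma fresnel_gauss M : (0 < M)%nat -> let b := sqrt (PI * INR M) in
  Rabs (sqrt (2 * INR M) - sqrt (INR M / PI) * Cmod (Fr b - Fr (- b))) <= 40.
Proof.
  intros HM b. pose proof PI_4 as HPI4.
  assert (HPI2 : 2 < PI) by (pose proof PI2_1; lra).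
  assert (HM0 : 1 <= INR M) by (apply (le_INR 1); lia).
  set (d := sqrt (PI / INR M)). set (c := sqrt (INR M / PI)).
  assert (Hd2 : d ^ 2 = PI / INR M).
  { unfold d. apply pow2_sqrt. left; apply Rdiv_lt_0_compat; lra. }
  assert (Hd : 0 < d) by (apply sqrt_lt_R0, Rdiv_lt_0_compat; lra).
  assert (Hc0 : 0 <= c) by apply sqrt_pos.
  assert (Hcd : c * d = 1).
  { unfold c, d. rewrite <- sqrt_mult by (left; apply Rdiv_lt_0_compat; lra).
    replace (INR M / PI * (PI / INR M)) with 1 by (field; lra). apply sqrt_1. }
  assert (Hb : b = INR M * d).
  { unfold b, d. apply Rsqr_inj; [apply sqrt_pos|apply Rmult_le_pos; [lra|apply sqrt_pos]|].
    rewrite Rsqr_mult, !Rsqr_sqrt.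
    - unfold Rsqr. field. lra.
    - left; apply Rdiv_lt_0_compat; lra.
    - apply Rmult_le_pos; lra. }
  set (sg := fun k : nat => (INR k - INR M) * d).
  set (h := fun k : nat => cis (sg k ^ 2 / 2)).
  assert (Eh : forall k, h k = gterm M k).
  { intros k. unfold h, gterm, sg. f_equal. rewrite Rpow_mult_distr, Hd2, mult_INR.
    simpl INR. field. lra. }
  assert (Hstep : forall k, sg (S k) - sg k = d) by (intros; unfold sg; rewrite S_INR; ring).
  set (th := fun k => (sg (S k) ^ 2 - sg k ^ 2) / 2).
  set (e := PI / (4 * INR M)).
  assert (He : 0 < e) by (apply Rdiv_lt_0_compat; lra).
  assert (HeM : e * INR M = PI / 4) by (unfold e; field; lra).
  assert (Eth : forall k, th k / 2 = e * (2 * (INR k - INR M) + 1)).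
  { intros k. unfold th, sg. rewrite S_INR.
    replace (_ / 2 / 2) with ((2 * (INR k - INR M) + 1) * d ^ 2 / 4) by field.
    rewrite Hd2. unfold e. field. lra. }
  set (z := fun k => 1 * gcot (th k / 2) / 2 + 0).
  assert (Hneg : forall k, (k < M)%nat -> - (PI / 2) <= th k / 2 < 0).
  { intros k Hk. rewrite Eth. assert (INR k + 1 <= INR M) by (rewrite <- S_INR; apply le_INR; lia).
    pose proof (pos_INR k). split; nra. }
  assert (Hpos : forall k, (M <= k < 2 * M)%nat -> 0 < th k / 2 <= PI / 2).
  { intros k [Hk1 Hk2]. rewrite Eth. apply le_INR in Hk1.
    assert (INR k + 1 <= 2 * INR M).
    { replace (2 * INR M) with (INR (2 * M)) by (rewrite mult_INR; reflexivity).
      rewrite <- S_INR. apply le_INR. lia. } split; nra. }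
  assert (Hinc : forall k, th k / 2 <= th (S k) / 2).
  { intros k. rewrite !Eth, S_INR. nra. }
  assert (Hinv : / (PI / 2) <= 1) by (rewrite <- Rinv_1; apply Rinv_le_contravar; lra).
  assert (Hh : forall k, Cmod (h k) <= 1) by (intros; unfold h; rewrite Cmod_cis; lra).
  (* The phase increments are negative in the first half and positive in the second. *)
  assert (Hr0 : rsum (fun _ => Rabs (0 - 0)) (pred M) <= 0).
  { rewrite rsum_const, Rminus_0_r, Rabs_R0. lra. }
  assert (HL : Cmod (csum (fun k => (h (S k) - h k) * RtoC (z k))%C M) <= 9).
  { replace 9 with (3 * (3 / 2 * 2 + 0)) by field.
    apply (weight_block h (fun _ => 1) (fun k => gcot (th k / 2)) (fun _ => 0));
      try exact Hr0; try (intros; try rewrite Rabs_R0; lra); [exact Hh| |].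
    - intros k Hk. pose proof (Hneg k Hk). eapply Rle_trans; [apply gcot_bound_neg; lra|].
      assert (/ (PI + th k / 2) <= / (PI / 2)) by (apply Rinv_le_contravar; lra). lra.
    - intros k Hk. pose proof (Hneg k ltac:(lia)). pose proof (Hneg (S k) Hk).
      apply gcot_decr_neg; [lra|apply Hinc|lra]. }
  assert (HR : Cmod (csum (fun k => (h (S (M + k)) - h (M + k)%nat) * RtoC (z (M + k)%nat))%C M) <= 9).
  { replace 9 with (3 * (3 / 2 * 2 + 0)) by field.
    rewrite (csum_ext _ (fun k => (h (M + S k)%nat - h (M + k)%nat) * RtoC (z (M + k)%nat))%C)
      by (intros; do 3 f_equal; lia).
    apply (weight_block (fun k => h (M + k)%nat) (fun _ => 1)
      (fun k => gcot (th (M + k)%nat / 2)) (fun _ => 0));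
      try exact Hr0; try (intros; try rewrite Rabs_R0; lra); [intros; apply Hh| |].
    - intros k Hk. pose proof (Hpos (M + k)%nat ltac:(lia)).
      eapply Rle_trans; [apply gcot_bound; lra|].
      assert (/ (PI - th (M + k)%nat / 2) <= / (PI / 2)) by (apply Rinv_le_contravar; lra). lra.
    - intros k Hk. pose proof (Hpos (M + k)%nat ltac:(lia)).
      pose proof (Hpos (M + S k)%nat ltac:(lia)). pose proof (Hinc (M + k)%nat) as Hi.
      rewrite <- Nat.add_succ_r in Hi. apply gcot_decr; lra. }
  assert (HE : forall k, (k < 2 * M)%nat ->
    Cmod (RtoC (/ 2) * (h k + h (S k)) - RtoC c * (Fr (sg (S k)) - Fr (sg k))
      - - Ci * ((h (S k) - h k) * RtoC (z k))) <= PI / (8 * INR M)).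
  { intros k Hk.
    assert (Hne : th k / 2 <> 0).
    { destruct (Nat.lt_ge_cases k M) as [H|H]; [pose proof (Hneg k H)|pose proof (Hpos k ltac:(lia))]; lra. }
    assert (Hs : sin (th k / 2) <> 0).
    { destruct (Nat.lt_ge_cases k M) as [H|H].
      - pose proof (Hneg k H). assert (0 < sin (- (th k / 2))) by (apply sin_gt_0; lra).
        rewrite sin_neg in H1. lra.
      - pose proof (Hpos k ltac:(lia)). assert (0 < sin (th k / 2)) by (apply sin_gt_0; lra). lra. }
    assert (Hab : sg k < sg (S k)) by (pose proof (Hstep k); lra).
    assert (Hsum : sg k + sg (S k) <> 0).
    { intros H0. apply Hne. unfold th.
      replace (sg (S k) ^ 2 - sg k ^ 2) with ((sg (S k) - sg k) * (sg k + sg (S k))) by ring.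
      rewrite H0. field. }
    pose proof (cell (sg k) (sg (S k)) 1 c Hab Hsum Hc0 Hs) as Hcell.
    fold (th k) in Hcell. rewrite Hstep in Hcell.
    replace (1 * gcot (th k / 2) / 2 + (1 - c * d) / th k) with (z k) in Hcell.
    2:{ rewrite Hcd. unfold z. unfold Rminus. rewrite Rplus_opp_r. unfold Rdiv. ring. }
    replace (1 / 2) with (/ 2) in Hcell by field.
    eapply Rle_trans; [exact Hcell|]. right.
    replace (c * (d ^ 3 / 8)) with (c * d * d ^ 2 / 8) by field. rewrite Hcd, Hd2. field. lra. }
  assert (Hmain : Cmod (csum h (2 * M) - RtoC c * (Fr (sg (2 * M)%nat) - Fr (sg O))) <= 20).
  { set (X := fun k => (RtoC (/ 2) * (h k + h (S k)) - RtoC c * (Fr (sg (S k)) - Fr (sg k))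
      - - Ci * ((h (S k) - h k) * RtoC (z k)))%C).
    assert (E : (csum h (2 * M) - RtoC c * (Fr (sg (2 * M)%nat) - Fr (sg O)))%C =
      (csum X (2 * M) + - Ci * csum (fun k => (h (S k) - h k) * RtoC (z k)) (2 * M))%C).
    { unfold X. rewrite !csum_minus, !csum_scal, csum_plus.
      rewrite (csum_telescope (fun k => Fr (sg k))).
      assert (Eper : csum (fun k => h (S k)) (2 * M) = csum h (2 * M)).
      { pose proof (csum_shift h (2 * M)) as Hs.
        change (csum h (S (2 * M))) with (csum h (2 * M) + h (2 * M)%nat)%C in Hs.
        assert (Hp : h (2 * M)%nat = h O) by (rewrite !Eh; apply (gterm_periodic M 0 HM)).
        rewrite Hp in Hs.
        set (a1 := csum h (2 * M)) in *. set (a2 := csum (fun k => h (S k)) (2 * M)) in *.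
        replace a2 with (h O + a2 - h O)%C by ring. rewrite <- Hs. ring. }
      rewrite Eper. replace (RtoC (/ 2) * (csum h (2 * M) + csum h (2 * M)))%C with (csum h (2 * M)).
      - ring.
      - destruct (csum h (2 * M)). unfold Cmult, Cplus, RtoC; simpl. f_equal; field. }
    rewrite E. eapply Rle_trans; [apply Cmod_triangle|].
    assert (H1 : Cmod (csum X (2 * M)) <= PI / 4).
    { eapply Rle_trans; [apply Cmod_csum|].
      eapply Rle_trans; [apply rsum_le_bound with (c := PI / (8 * INR M)); exact HE|].
      rewrite mult_INR. simpl INR. right. field. lra. }
    assert (H2 : Cmod (- Ci * csum (fun k => (h (S k) - h k) * RtoC (z k)) (2 * M))%C <= 18).
    { rewrite Cmod_mult, Cmod_opp, Cmod_Ci, Rmult_1_l.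
      replace (2 * M)%nat with (M + M)%nat by lia. rewrite csum_add.
      eapply Rle_trans; [apply Cmod_triangle|]. lra. }
    lra. }
  assert (E1 : sg (2 * M)%nat = b) by (unfold sg; rewrite Hb, mult_INR; simpl INR; ring).
  assert (E0 : sg O = - b) by (unfold sg; rewrite Hb; simpl INR; ring).
  rewrite E1, E0 in Hmain.
  assert (EG : Cmod (csum h (2 * M)) = sqrt (2 * INR M)).
  { rewrite (csum_ext h (gterm M)) by (intros; apply Eh). rewrite gauss_sum by exact HM.
    rewrite mult_INR. reflexivity. }
  rewrite <- EG.
  replace (c * Cmod (Fr b - Fr (- b))) with (Cmod (RtoC c * (Fr b - Fr (- b)))).
  2:{ rewrite Cmod_mult, Cmod_R, Rabs_pos_eq by exact Hc0. reflexivity. }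
  eapply Rle_trans; [apply Cmod_diff_le|]. lra.
Qed.

(** The complete Fresnel integral has modulus sqrt(2 PI): compare with a Gauss sum of
    very large length M, whose error 40/sqrt(M) vanishes, and use the tail bound. *)
Lemma fresnel_const a b : 0 < a -> 0 < b ->
  Rabs (Cmod (Fr b - Fr (- a)) - sqrt (2 * PI)) <= 2 / a + 2 / b.
Proof.
  intros Ha Hb.
  assert (HPI2 : 2 < PI) by (pose proof PI2_1; lra).
  apply Rnot_lt_le. intros Hgt.
  set (e := Rabs (Cmod (Fr b - Fr (- a)) - sqrt (2 * PI)) - (2 / a + 2 / b)) in *.
  assert (He : 0 < e) by (unfold e; lra).
  destruct (INR_unbounded (a ^ 2 + b ^ 2 + (80 * PI / e) ^ 2 + 1)) as [M HM].
  assert (HM1 : 1 <= INR M) by nra.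
  assert (HMn : (0 < M)%nat) by (apply INR_lt; simpl; lra).
  pose proof (fresnel_gauss M HMn) as HG. cbv zeta in HG.
  set (T := sqrt (PI * INR M)) in *.
  assert (HT2 : T ^ 2 = PI * INR M) by (unfold T; apply pow2_sqrt; nra).
  assert (HT0 : 0 <= T) by apply sqrt_pos.
  assert (HaT : a <= T) by nra. assert (HbT : b <= T) by nra.
  set (c := sqrt (INR M / PI)) in *.
  assert (Hc2 : c ^ 2 = INR M / PI) by (unfold c; apply pow2_sqrt; left; apply Rdiv_lt_0_compat; lra).
  assert (Hc0 : 0 < c) by (apply sqrt_lt_R0, Rdiv_lt_0_compat; lra).
  assert (Es : sqrt (2 * INR M) = c * sqrt (2 * PI)).
  { unfold c. rewrite <- sqrt_mult by (try (left; apply Rdiv_lt_0_compat); lra).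
    f_equal. field. lra. }
  rewrite Es, <- Rmult_minus_distr_l, Rabs_mult, (Rabs_pos_eq c) in HG by lra.
  assert (Hce : 80 / e < c).
  { assert (Hx : (80 / e) ^ 2 < c ^ 2).
    { rewrite Hc2. apply Rmult_lt_reg_r with PI; [lra|].
      replace (INR M / PI * PI) with (INR M) by (field; lra).
      assert (H80' : (80 * PI / e) ^ 2 < INR M) by nra.
      replace ((80 * PI / e) ^ 2) with ((80 / e) ^ 2 * PI * PI) in H80' by (field; lra).
      nra. }
    nra. }
  assert (HG2 : Rabs (sqrt (2 * PI) - Cmod (Fr T - Fr (- T))) <= e / 2).
  { apply Rmult_le_reg_l with c; [exact Hc0|]. eapply Rle_trans; [exact HG|].
    apply Rmult_le_reg_r with (/ e); [apply Rinv_0_lt_compat; lra|].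
    replace (c * (e / 2) * / e) with (c / 2) by (field; lra). unfold Rdiv in Hce. lra. }
  pose proof (Fr_tail b T HbT ltac:(nra)) as T1.
  pose proof (Fr_tail (- T) (- a) ltac:(lra) ltac:(nra)) as T2.
  rewrite !Rabs_Ropp in T2. rewrite !Rinv_opp in T2.
  rewrite (Rabs_pos_eq a), (Rabs_pos_eq T) in T2 by lra.
  rewrite (Rabs_pos_eq b), (Rabs_pos_eq T) in T1 by lra.
  pose proof (Cmod_diff_le (Fr T - Fr (- T)) (Fr b - Fr (- a))) as HD.
  replace (Fr T - Fr (- T) - (Fr b - Fr (- a)))%C with
    ((Fr T - Fr b) + (Fr (- a) - Fr (- T)))%C in HD by ring.
  pose proof (Cmod_triangle (Fr T - Fr b) (Fr (- a) - Fr (- T))) as HD2.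
  assert (HD3 : Rabs (Cmod (Fr T - Fr (- T)) - Cmod (Fr b - Fr (- a))) <= 2 / a + 2 / b).
  { unfold Rdiv. lra. }
  clearbody T c. apply Rabs_le_between in HD3. apply Rabs_le_between in HG2.
  assert (Rabs (Cmod (Fr b - Fr (- a)) - sqrt (2 * PI)) <= 2 / a + 2 / b + e / 2)
    by (apply Rabs_le; lra).
  unfold e in *. lra.
Qed.

(** * The change of variable making the phase quadratic *)

(** Centered at its stationary point and rescaled, the phase of the chirp is psi.  The new
    variable is s = Sq(t) for t > 0 and s = -Sq(t) for t < 0, so that psi = s^2/2, and Dq
    is the derivative of Sq, negative for t < 0. *)
Definition psi (t : R) : R := exp (- t) + t - 1.
Definition Sq (t : R) : R := sqrt (2 * psi t).
Definition Dq (t : R) : R := (1 - exp (- t)) / Sq t.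

Lemma psi_pos t : t <> 0 -> 0 < psi t.
Proof. intros H. unfold psi. pose proof (exp_ineq1 (- t) ltac:(lra)). lra. Qed.

Lemma psi_ge0 t : 0 <= psi t.
Proof. unfold psi. pose proof (exp_ineq1_le (- t)). lra. Qed.

Lemma Sq_sq t : Sq t ^ 2 = 2 * psi t.
Proof. unfold Sq. apply pow2_sqrt. pose proof (psi_ge0 t). lra. Qed.

Lemma Sq_pos t : t <> 0 -> 0 < Sq t.
Proof. intros H. apply sqrt_lt_R0. pose proof (psi_pos t H). lra. Qed.

Lemma Sq_ge0 t : 0 <= Sq t.
Proof. apply sqrt_pos. Qed.

Lemma is_derive_Sq t : t <> 0 -> is_derive Sq t (Dq t).
Proof.
  intros H. pose proof (psi_pos t H) as Hp. pose proof (Sq_pos t H) as Hs. unfold Dq.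
  unfold Sq in *. unfold psi in *. auto_derive; [lra|].
  change (exp (- t) + t + - (1)) with (exp (- t) + t - 1). field. lra.
Qed.

Lemma is_derive_Dq t : t <> 0 -> is_derive Dq t ((exp (- t) - Dq t ^ 2) / Sq t).
Proof.
  intros H. pose proof (Sq_pos t H) as Hs.
  assert (Hd : is_derive (fun u => (1 - exp (- u)) / Sq u) t
    ((exp (- t) * Sq t - (1 - exp (- t)) * Dq t) / Sq t ^ 2)).
  { apply (is_derive_div (fun u => 1 - exp (- u)) Sq t (exp (- t)) (Dq t)).
    - auto_derive; [exact I|ring].
    - apply is_derive_Sq, H.
    - lra. }
  replace ((exp (- t) - Dq t ^ 2) / Sq t)
    with ((exp (- t) * Sq t - (1 - exp (- t)) * Dq t) / Sq t ^ 2); [exact Hd|].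
  unfold Dq. field. lra.
Qed.

Lemma sign_of_derive (f f' : R -> R) : (forall t, is_derive f t (f' t)) ->
  (forall t, 0 <= f' t) -> f 0 = 0 -> forall t, (0 <= t -> 0 <= f t) /\ (t <= 0 -> f t <= 0).
Proof.
  intros Hd Hp H0 t. split; intros [Ht|Ht].
  - destruct (MVT_cor2 f f' 0 t Ht) as [c [E _]]; [intros; apply is_derive_Reals, Hd|].
    specialize (Hp c). nra.
  - rewrite <- Ht. lra.
  - destruct (MVT_cor2 f f' t 0 Ht) as [c [E _]]; [intros; apply is_derive_Reals, Hd|].
    specialize (Hp c). nra.
  - rewrite Ht. lra.
Qed.

Lemma psi_compare1 t : (0 <= t -> (1 - exp (- t)) ^ 2 <= 2 * psi t) /\
  (t <= 0 -> 2 * psi t <= (1 - exp (- t)) ^ 2).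
Proof.
  destruct (sign_of_derive (fun t => 2 * psi t - (1 - exp (- t)) ^ 2)
    (fun t => 2 * (1 - exp (- t)) ^ 2)) with (t := t) as [H1 H2].
  - intros u. unfold psi. auto_derive; [exact I|]. ring.
  - intros u. pose proof (pow2_ge_0 (1 - exp (- u))). lra.
  - unfold psi. rewrite Ropp_0, exp_0. ring.
  - split; intros Ht; [specialize (H1 Ht)|specialize (H2 Ht)]; lra.
Qed.

Lemma psi_compare2 t : (0 <= t -> exp (- t) * (2 * psi t) <= (1 - exp (- t)) ^ 2) /\
  (t <= 0 -> (1 - exp (- t)) ^ 2 <= exp (- t) * (2 * psi t)).
Proof.
  destruct (sign_of_derive (fun t => exp t - exp (- t) - 2 * t)
    (fun t => exp t + exp (- t) - 2)) with (t := t) as [H1 H2].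
  - intros u. auto_derive; [exact I|]. ring.
  - intros u. pose proof (exp_ineq1_le u). pose proof (exp_ineq1_le (- u)). lra.
  - rewrite Ropp_0, exp_0. ring.
  - assert (E : (1 - exp (- t)) ^ 2 - exp (- t) * (2 * psi t)
      = exp (- t) * (exp t - exp (- t) - 2 * t)).
    { assert (He : exp (- t) * exp t = 1) by (rewrite <- exp_plus, Rplus_opp_l; apply exp_0).
      unfold psi. nra. }
    pose proof (exp_pos (- t)).
    split; intros Ht; [specialize (H1 Ht)|specialize (H2 Ht)]; nra.
Qed.

Lemma exp_half_sq t : exp (- t / 2) ^ 2 = exp (- t).
Proof. simpl. rewrite Rmult_1_r, <- exp_plus. f_equal. field. Qed.

Lemma exp_le a b : a <= b -> exp a <= exp b.
Proof. intros [H| ->]; [left; now apply exp_increasing|lra]. Qed.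

(** The slope of the substitution lies between 1 and exp(-t/2), which is the amplitude of
    the chirp in this normalization: amplitude and spacing agree at t = 0. *)
Lemma Dq_right t : 0 < t -> exp (- t / 2) <= Dq t <= 1.
Proof.
  intros Ht. pose proof (Sq_pos t ltac:(lra)) as Hs. pose proof (Sq_sq t) as Hq.
  destruct (psi_compare1 t) as [H1 _]. destruct (psi_compare2 t) as [H2 _].
  specialize (H1 ltac:(lra)). specialize (H2 ltac:(lra)). rewrite <- Hq in H1, H2.
  assert (He : exp (- t) < 1) by (rewrite <- exp_0; apply exp_increasing; lra).
  unfold Dq.
  split.
  - apply Rle_div_r; [exact Hs|]. apply Rsqr_incr_0_var; [|lra]. rewrite !Rsqr_pow2.
    rewrite Rpow_mult_distr, exp_half_sq. lra.
  - apply Rle_div_l; [exact Hs|].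
    apply Rsqr_incr_0_var; [|lra]. rewrite !Rsqr_pow2. lra.
Qed.

Lemma Dq_left t : t < 0 -> 1 <= - Dq t <= exp (- t / 2).
Proof.
  intros Ht. pose proof (Sq_pos t ltac:(lra)) as Hs. pose proof (Sq_sq t) as Hq.
  destruct (psi_compare1 t) as [_ H1]. destruct (psi_compare2 t) as [_ H2].
  specialize (H1 ltac:(lra)). specialize (H2 ltac:(lra)). rewrite <- Hq in H1, H2.
  assert (He : 1 < exp (- t)) by (rewrite <- exp_0; apply exp_increasing; lra).
  pose proof (exp_pos (- t / 2)). unfold Dq.
  split.
  - apply Rmult_le_reg_r with (Sq t); [exact Hs|].
    replace (- ((1 - exp (- t)) / Sq t) * Sq t) with (exp (- t) - 1) by (field; lra).
    apply Rsqr_incr_0_var; [|lra]. rewrite !Rsqr_pow2. nra.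
  - apply Rmult_le_reg_r with (Sq t); [exact Hs|].
    replace (- ((1 - exp (- t)) / Sq t) * Sq t) with (exp (- t) - 1) by (field; lra).
    apply Rsqr_incr_0_var; [|apply Rmult_le_pos; lra]. rewrite !Rsqr_pow2.
    rewrite Rpow_mult_distr, exp_half_sq. nra.
Qed.

(** Since Dq' = (exp(-t) - Dq^2)/Sq, and Dq^2 lies between exp(-t) and 1, the derivative
    of Dq is bounded by |1 - exp(-t)|/Sq = |Dq|. *)
Lemma Dq_lip_right u v : 0 < u -> u <= v -> Rabs (Dq v - Dq u) <= v - u.
Proof.
  intros Hu Huv.
  destruct (MVT_abs Dq (fun t => (exp (- t) - Dq t ^ 2) / Sq t) u v) as [c [E Hc]].
  { rewrite Rmin_left, Rmax_right by lra. intros c Hc. apply is_derive_Reals, is_derive_Dq. lra. }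
  rewrite Rmin_left, Rmax_right in Hc by lra.
  rewrite E, (Rabs_pos_eq (v - u)) by lra.
  rewrite <- (Rmult_1_l (v - u)) at 2. apply Rmult_le_compat_r; [lra|].
  pose proof (Sq_pos c ltac:(lra)) as Hs. pose proof (Dq_right c ltac:(lra)) as HD.
  pose proof (exp_half_sq c) as He. pose proof (exp_pos (- c / 2)).
  assert (HD2 : exp (- c) <= Dq c ^ 2 <= 1) by (rewrite <- He; nra).
  rewrite Rabs_left1.
  2:{ apply Rmult_le_reg_r with (Sq c); [exact Hs|].
      replace ((exp (- c) - Dq c ^ 2) / Sq c * Sq c) with (exp (- c) - Dq c ^ 2) by (field; lra). lra. }
  apply Rle_trans with (Dq c); [|lra]. unfold Dq at 2.
  apply Rmult_le_reg_r with (Sq c); [exact Hs|].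
  replace (- ((exp (- c) - Dq c ^ 2) / Sq c) * Sq c) with (Dq c ^ 2 - exp (- c)) by (field; lra).
  replace ((1 - exp (- c)) / Sq c * Sq c) with (1 - exp (- c)) by (field; lra). lra.
Qed.

Lemma Dq_lip_left u v : u <= v -> v < 0 -> Rabs (Dq v - Dq u) <= exp (- u / 2) * (v - u).
Proof.
  intros Huv Hv.
  destruct (MVT_abs Dq (fun t => (exp (- t) - Dq t ^ 2) / Sq t) u v) as [c [E Hc]].
  { rewrite Rmin_left, Rmax_right by lra. intros c Hc. apply is_derive_Reals, is_derive_Dq. lra. }
  rewrite Rmin_left, Rmax_right in Hc by lra.
  rewrite E, (Rabs_pos_eq (v - u)) by lra.
  apply Rmult_le_compat_r; [lra|].
  pose proof (Sq_pos c ltac:(lra)) as Hs. pose proof (Dq_left c ltac:(lra)) as HD.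
  pose proof (exp_half_sq c) as He.
  assert (HD2 : 1 <= Dq c ^ 2 <= exp (- c)) by (rewrite <- He; nra).
  apply Rle_trans with (- Dq c).
  2:{ apply Rle_trans with (exp (- c / 2)); [lra|apply exp_le; lra]. }
  rewrite Rabs_pos_eq.
  2:{ apply Rmult_le_reg_r with (Sq c); [exact Hs|].
      replace ((exp (- c) - Dq c ^ 2) / Sq c * Sq c) with (exp (- c) - Dq c ^ 2) by (field; lra). lra. }
  unfold Dq at 2.
  apply Rmult_le_reg_r with (Sq c); [exact Hs|].
  replace ((exp (- c) - Dq c ^ 2) / Sq c * Sq c) with (exp (- c) - Dq c ^ 2) by (field; lra).
  replace (- ((1 - exp (- c)) / Sq c) * Sq c) with (exp (- c) - 1) by (field; lra). lra.
Qed.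

Lemma Sq_mvt u v : u < v -> 0 < u * v ->
  exists c, u < c < v /\ Sq v - Sq u = Dq c * (v - u).
Proof.
  intros Huv H0.
  destruct (MVT_cor2 Sq Dq u v Huv) as [c [E Hc]].
  { intros c Hc. apply is_derive_Reals, is_derive_Sq. intros ->. nra. }
  exists c. split; assumption.
Qed.

Lemma Sq_le_near t : Rabs t <= / 2 -> Sq t <= 2 * Rabs t.
Proof.
  intros Ht. apply Rsqr_incr_0_var; [|pose proof (Rabs_pos t); lra].
  rewrite !Rsqr_pow2, Sq_sq, Rpow_mult_distr, pow2_abs.
  enough (psi t <= 2 * t ^ 2) by lra.
  apply Rabs_le_between in Ht. unfold psi.
  assert (He : exp (- t) * (1 + t) <= 1).
  { pose proof (exp_ineq1_le t).
    assert (exp (- t) * exp t = 1) by (rewrite <- exp_plus, Rplus_opp_l; apply exp_0). nra. }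
  assert (H1 : 1 <= (1 - t + 2 * t ^ 2) * (1 + t)) by nra.
  enough (exp (- t) <= 1 - t + 2 * t ^ 2) by lra.
  apply Rmult_le_reg_r with (1 + t); lra.
Qed.

Lemma Sq_left_lower t : 0 <= t -> t <= Sq (- t).
Proof.
  intros Ht. apply Rsqr_incr_0_var; [|apply Sq_ge0].
  rewrite !Rsqr_pow2, Sq_sq. unfold psi. rewrite Ropp_involutive.
  destruct (sign_of_derive (fun t => exp t - 1 - t - t ^ 2 / 2) (fun t => exp t - 1 - t))
    with (t := t) as [H _].
  - intros u. auto_derive; [exact I|]. field.
  - intros u. pose proof (exp_ineq1_le u). lra.
  - rewrite exp_0. field.
  - specialize (H Ht). lra.
Qed.

(** * The chirp sum on the circle *)

Definition harm (n : nat) : R := rsum (fun j => / INR (S j)) n.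

Lemma harm_le n : (0 < n)%nat -> harm n <= 1 + ln (INR n).
Proof.
  intros Hn. destruct n as [|n]; [lia|]. clear Hn. unfold harm.
  induction n.
  - simpl. rewrite Rinv_1, ln_1. lra.
  - change (rsum (fun j => / INR (S j)) (S n) + / INR (S (S n)) <= 1 + ln (INR (S (S n)))).
    enough (/ INR (S (S n)) <= ln (INR (S (S n))) - ln (INR (S n))) by lra.
    assert (H1 : 0 < INR (S n)) by (apply lt_0_INR; lia).
    assert (H2 : INR (S (S n)) = INR (S n) + 1) by apply S_INR.
    rewrite H2. set (y := INR (S n)) in *.
    assert (H3 : ln (y / (y + 1)) <= y / (y + 1) - 1).
    { assert (Hy : 0 < y / (y + 1)) by (apply Rdiv_lt_0_compat; lra).
      pose proof (exp_ineq1_le (ln (y / (y + 1)))) as He. rewrite exp_ln in He by exact Hy. lra. }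
    unfold Rdiv in H3 at 1. rewrite ln_mult, ln_Rinv in H3 by (try apply Rinv_0_lt_compat; lra).
    replace (y / (y + 1) - 1) with (- / (y + 1)) in H3 by (field; lra). lra.
Qed.

Lemma harm_mono m n : (m <= n)%nat -> harm m <= harm n.
Proof.
  intros H. unfold harm. replace n with (m + (n - m))%nat by lia. rewrite rsum_add.
  assert (0 <= rsum (fun k => / INR (S (m + k))) (n - m)).
  { apply rsum_ge0. intros k _. left. apply Rinv_0_lt_compat, lt_0_INR. lia. }
  lra.
Qed.

Lemma rsum_rev f n : rsum f n = rsum (fun k => f (n - 1 - k)%nat) n.
Proof.
  induction n; [reflexivity|].
  change (rsum f n + f n = rsum (fun k => f (S n - 1 - k)%nat) (1 + n)).
  rewrite rsum_add. simpl rsum at 2. rewrite IHn.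
  replace (n - 0 - 0)%nat with n by lia.
  rewrite (rsum_ext (fun k => f (S n - 1 - (1 + k))%nat) (fun k => f (n - 1 - k)%nat)); [ring|].
  intros k _. f_equal. lia.
Qed.

(** The sum is that of Ak(k) exp(i phi(k)), phi(k) = (2 PI/l) exp(-l k) + k x, whose
    phase is stationary where exp(-l k) = x/(2 PI), that is l k = t0.  In the coordinate
    [sgm] the phase is sgm^2/2 up to a constant, [th] is its increment, and the spacing
    of the points sgm times [cc] is close to the amplitude [Ak]; [ek] is the mismatch and
    [zk] the weight left over in [cell].  Up to constants, [W] is 1/|1-z|. *)
Section Chirp.
Variables (l x : R).
Hypothesis Hl : 0 < l <= / 4.
Hypothesis Hx : 0 < x < 2 * PI.

Definition t0 := ln (2 * PI / x).
Definition tau (k : nat) := l * INR k - t0.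
Definition Ak (k : nat) := exp (- (l * INR k) / 2).
Definition sgm (k : nat) :=
  sqrt (x / l) * (if Rlt_dec (tau k) 0 then - Sq (tau k) else Sq (tau k)).
Definition th (k : nat) := (sgm (S k) ^ 2 - sgm k ^ 2) / 2.
Definition cc := / sqrt (2 * PI * l).
Definition aa := sqrt (x / (2 * PI)).
Definition ek (k : nat) := Ak k - cc * (sgm (S k) - sgm k).
Definition zk (k : nat) := Ak k * gcot (th k / 2) / 2 + ek k / th k.
Definition W := / x + / (2 * PI - x).

Lemma aa_sq : aa ^ 2 = x / (2 * PI).
Proof. unfold aa. apply pow2_sqrt. left. apply Rdiv_lt_0_compat; lra. Qed.

Lemma aa_range : 0 < aa <= 1.
Proof.
  split; [apply sqrt_lt_R0, Rdiv_lt_0_compat; lra|].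
  unfold aa. rewrite <- sqrt_1. apply sqrt_le_1_alt.
  apply Rle_div_l; lra.
Qed.

Lemma cc_pos : 0 < cc.
Proof. apply Rinv_0_lt_compat, sqrt_lt_R0. nra. Qed.

Lemma cc_sq : cc ^ 2 = / (2 * PI * l).
Proof.
  unfold cc. rewrite pow_inv, pow2_sqrt; [reflexivity|]. nra.
Qed.

(** Thus cc times the spacing of sgm is aa |Dq|, while Ak = aa exp(-tau/2). *)
Lemma cc_lam : cc * sqrt (x / l) = aa / l.
Proof.
  pose proof cc_pos. pose proof aa_range.
  assert (Hq : 0 < x / l) by (apply Rdiv_lt_0_compat; lra).
  apply Rsqr_inj.
  - apply Rmult_le_pos; [lra|apply sqrt_pos].
  - apply Rmult_le_pos; [lra|left; apply Rinv_0_lt_compat; lra].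
  - unfold Rdiv. rewrite !Rsqr_mult. rewrite !Rsqr_pow2, cc_sq, aa_sq, pow2_sqrt by (unfold Rdiv in Hq; lra).
    field. repeat split; lra.
Qed.

Lemma tau_S k : tau (S k) = tau k + l.
Proof. unfold tau. rewrite S_INR. ring. Qed.

Lemma tau_add m j : tau (m + j) = tau m + l * INR j.
Proof. unfold tau. rewrite plus_INR. ring. Qed.

Lemma exp_t0 : exp t0 = 2 * PI / x.
Proof. unfold t0. apply exp_ln. apply Rdiv_lt_0_compat; lra. Qed.

Lemma Ak_tau k : Ak k = aa * exp (- tau k / 2).
Proof.
  assert (H : aa * exp (t0 / 2) = 1).
  { pose proof aa_range. pose proof (exp_pos (t0 / 2)).
    assert (E : (aa * exp (t0 / 2)) ^ 2 = 1).
    { rewrite Rpow_mult_distr, aa_sq.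
      replace (exp (t0 / 2) ^ 2) with (exp t0).
      - rewrite exp_t0. field. lra.
      - simpl. rewrite Rmult_1_r, <- exp_plus. f_equal. field. }
    assert (0 < aa * exp (t0 / 2)) by (apply Rmult_lt_0_compat; lra). nra. }
  unfold Ak, tau. replace (- (l * INR k - t0) / 2) with (t0 / 2 + - (l * INR k) / 2) by field.
  rewrite exp_plus, <- Rmult_assoc, H. ring.
Qed.

Lemma Ak_range k : 0 < Ak k <= 1.
Proof.
  split; [apply exp_pos|]. rewrite <- exp_0. apply exp_le.
  pose proof (pos_INR k). unfold Rdiv. nra.
Qed.

Lemma Ak_step k : 0 <= Ak k - Ak (S k) <= Ak k * l.
Proof.
  assert (E : Ak (S k) = Ak k * exp (- l / 2)).
  { unfold Ak. rewrite <- exp_plus, S_INR. f_equal. field. }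
  pose proof (Ak_range k). pose proof (exp_ineq1_le (- l / 2)).
  assert (exp (- l / 2) <= 1) by (rewrite <- exp_0; apply exp_le; lra).
  rewrite E. split; nra.
Qed.

Lemma Ak_mono k : Ak (S k) <= Ak k.
Proof. pose proof (Ak_step k). lra. Qed.

Lemma sgm_sq k : sgm k ^ 2 = 2 * (x / l) * psi (tau k).
Proof.
  assert (Hxl : 0 < x / l) by (apply Rdiv_lt_0_compat; lra).
  unfold sgm. rewrite Rpow_mult_distr, pow2_sqrt by lra.
  pose proof (Sq_sq (tau k)). destruct (Rlt_dec (tau k) 0); nra.
Qed.

Lemma th_eq k : th k = x / l * (l - exp (- tau k) * (1 - exp (- l))).
Proof.
  unfold th. rewrite !sgm_sq, tau_S. unfold psi.
  rewrite Ropp_plus_distr, exp_plus. field. lra.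
Qed.

Lemma one_minus_q : 0 < 1 - exp (- l) <= l.
Proof.
  pose proof (exp_ineq1_le (- l)).
  assert (exp (- l) < 1) by (rewrite <- exp_0; apply exp_increasing; lra). lra.
Qed.

Lemma th_step k : 0 <= th (S k) - th k <= x * l * exp (- tau k).
Proof.
  rewrite !th_eq, tau_S. rewrite Ropp_plus_distr, exp_plus.
  pose proof one_minus_q as Hq. pose proof (exp_pos (- tau k)) as He.
  replace (_ - _) with (x * exp (- tau k) * ((1 - exp (- l)) ^ 2 / l)) by (field; lra).
  assert (H1 : 0 <= (1 - exp (- l)) ^ 2 / l <= l).
  { split.
    - apply Rmult_le_pos; [apply pow2_ge_0|left; apply Rinv_0_lt_compat; lra].
    - apply Rle_div_l; [lra|]. nra. }
  assert (0 < x * exp (- tau k)) by (apply Rmult_lt_0_compat; lra).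
  split; nra.
Qed.

Lemma W_lower : / 2 <= W /\ / x <= W /\ / (2 * PI - x) <= W.
Proof.
  pose proof PI_4. assert (H1 : 0 < / x) by (apply Rinv_0_lt_compat; lra).
  assert (H2 : 0 < / (2 * PI - x)) by (apply Rinv_0_lt_compat; lra).
  unfold W. split; [|split; lra].
  replace (/ x + / (2 * PI - x)) with (2 * PI / (x * (2 * PI - x))) by (field; lra).
  apply Rle_div_r; [nra|]. pose proof (pow2_ge_0 (x - PI)). nra.
Qed.

Lemma right_th k : 0 < tau k -> x * (1 - exp (- tau k)) <= th k < x.
Proof.
  intros Ht. rewrite th_eq. pose proof one_minus_q. pose proof (exp_pos (- tau k)).
  assert (Hxl : 0 < x / l) by (apply Rdiv_lt_0_compat; lra).
  split.
  - replace (x * (1 - exp (- tau k))) with (x / l * (l - exp (- tau k) * l)) by (field; lra).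
    apply Rmult_le_compat_l; nra.
  - replace x with (x / l * l) at 2 by (field; lra). apply Rmult_lt_compat_l; nra.
Qed.

Lemma right_sgm k : 0 < tau k -> exists xi, tau k < xi < tau (S k) /\
  cc * (sgm (S k) - sgm k) = aa * Dq xi /\ sgm (S k) - sgm k = sqrt (x / l) * l * Dq xi.
Proof.
  intros Ht. rewrite tau_S.
  destruct (Sq_mvt (tau k) (tau k + l)) as [xi [Hxi E]]; [lra|nra|].
  exists xi. split; [exact Hxi|].
  assert (Es : sgm (S k) - sgm k = sqrt (x / l) * l * Dq xi).
  { unfold sgm. rewrite tau_S.
    destruct (Rlt_dec (tau k + l) 0); [lra|]. destruct (Rlt_dec (tau k) 0); [lra|].
    rewrite <- Rmult_minus_distr_l, E. ring. }
  split; [|exact Es]. rewrite Es, <- !Rmult_assoc, cc_lam. field. lra.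
Qed.

Lemma right_ek k : l <= tau k ->
  Rabs (ek k) <= aa * (tau k / 2) /\ Rabs (ek k) <= aa /\ Rabs (ek (S k) - ek k) <= 5 / 2 * l * aa.
Proof.
  intros Ht. pose proof aa_range as Ha.
  destruct (right_sgm k ltac:(lra)) as [xi [Hxi [E _]]].
  destruct (right_sgm (S k)) as [xi' [Hxi' [E' _]]]; [rewrite tau_S; lra|].
  rewrite !tau_S in Hxi'. rewrite tau_S in Hxi.
  assert (Ek : ek k = aa * (exp (- tau k / 2) - Dq xi)) by (unfold ek; rewrite E, Ak_tau; ring).
  pose proof (Dq_right xi ltac:(lra)) as HD.
  assert (H1 : exp (- tau k / 2) <= 1) by (rewrite <- exp_0; apply exp_le; lra).
  pose proof (exp_ineq1_le (- tau k / 2)) as H2. pose proof (exp_pos (- tau k / 2)) as H3.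
  assert (H4 : exp (- tau k / 2) - exp (- xi / 2) <= l / 2).
  { replace (- xi / 2) with (- tau k / 2 + (tau k - xi) / 2) by field. rewrite exp_plus.
    pose proof (exp_ineq1_le ((tau k - xi) / 2)).
    nra. }
  split; [|split].
  - rewrite Ek, Rabs_mult, Rabs_pos_eq by lra. apply Rmult_le_compat_l; [lra|].
    apply Rabs_le. lra.
  - rewrite Ek, Rabs_mult, Rabs_pos_eq by lra. rewrite <- (Rmult_1_r aa) at 2.
    apply Rmult_le_compat_l; [lra|]. apply Rabs_le. lra.
  - replace (ek (S k) - ek k) with (- (Ak k - Ak (S k)) + - aa * (Dq xi' - Dq xi))
      by (unfold ek; rewrite E, E'; ring).
    eapply Rle_trans; [apply Rabs_triang|].
    rewrite Rabs_Ropp, Rabs_mult, Rabs_Ropp, (Rabs_pos_eq aa) by lra.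
    pose proof (Dq_lip_right xi xi' ltac:(lra) ltac:(lra)) as HL.
    assert (HA : Rabs (Ak k - Ak (S k)) <= aa * (l / 2)).
    { pose proof (Ak_step k). rewrite Rabs_pos_eq by lra.
      rewrite !Ak_tau, tau_S, <- Rmult_minus_distr_l. apply Rmult_le_compat_l; [lra|].
      replace (- (tau k + l) / 2) with (- tau k / 2 + - l / 2) by field. rewrite exp_plus.
      pose proof (exp_ineq1_le (- l / 2)). nra. }
    assert (aa * Rabs (Dq xi' - Dq xi) <= aa * (2 * l)) by (apply Rmult_le_compat_l; lra).
    lra.
Qed.

Lemma inv_one_minus_exp t : 0 < t -> / (1 - exp (- t)) <= 1 + / t /\ exp (- t) / (1 - exp (- t)) <= / t.
Proof.
  intros Ht. assert (H1 : exp (- t) < 1) by (rewrite <- exp_0; apply exp_increasing; lra).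
  pose proof (exp_ineq1_le t).
  assert (He : exp (- t) * exp t = 1) by (rewrite <- exp_plus, Rplus_opp_l; apply exp_0).
  split.
  - apply Rmult_le_reg_r with (t * (1 - exp (- t))); [nra|].
    replace (/ (1 - exp (- t)) * (t * (1 - exp (- t)))) with t by (field; lra).
    replace ((1 + / t) * (t * (1 - exp (- t)))) with ((t + 1) * (1 - exp (- t))) by (field; lra). nra.
  - apply Rmult_le_reg_r with (t * (1 - exp (- t))); [nra|].
    replace (exp (- t) / (1 - exp (- t)) * (t * (1 - exp (- t)))) with (t * exp (- t)) by (field; lra).
    replace (/ t * (t * (1 - exp (- t)))) with (1 - exp (- t)) by (field; lra). nra.
Qed.

Lemma quot_diff e e' d d' : d <> 0 -> d' <> 0 ->
  Rabs (e' / d' - e / d) <= Rabs (e' - e) / Rabs d' + Rabs e * Rabs (d' - d) / (Rabs d * Rabs d').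
Proof.
  intros Hd Hd'.
  replace (e' / d' - e / d) with ((e' - e) / d' + - (e * (d' - d) / (d * d'))) by (field; lra).
  eapply Rle_trans; [apply Rabs_triang|]. rewrite Rabs_Ropp. unfold Rdiv.
  rewrite !Rabs_mult, !Rabs_inv, Rabs_mult. lra.
Qed.

(** The mismatch e vanishes to first order at the stationary point, as does th, so the
    quotient is of order 1/x, and its increments are of order (l + l/tau)/x. *)
Lemma right_rk k : l <= tau k ->
  Rabs (ek k / th k) <= 2 / x /\
  Rabs (ek (S k) / th (S k) - ek k / th k) <= 3 / x * (l + l / tau k).
Proof.
  intros Ht. pose proof aa_range as Ha.
  destruct (right_ek k Ht) as [E1 [E2 E3]].
  pose proof (right_th k ltac:(lra)) as T1. pose proof (th_step k) as Tst.
  destruct (inv_one_minus_exp (tau k) ltac:(lra)) as [I1 I2].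
  assert (He : exp (- tau k) < 1) by (rewrite <- exp_0; apply exp_increasing; lra).
  pose proof (exp_pos (- tau k)) as He0.
  set (m := 1 - exp (- tau k)) in *. assert (Hm : 0 < m) by (unfold m; lra).
  assert (Hxm : 0 < x * m) by nra.
  assert (Hit : / th k <= / x * / m).
  { rewrite <- Rinv_mult. apply Rinv_le_contravar; lra. }
  assert (Hit' : / th (S k) <= / x * / m).
  { rewrite <- Rinv_mult. apply Rinv_le_contravar; lra. }
  assert (Hix : 0 < / x) by (apply Rinv_0_lt_compat; lra).
  assert (Him : 0 < / m) by (apply Rinv_0_lt_compat; lra).
  assert (Hith : 0 < / th k) by (apply Rinv_0_lt_compat; lra).
  assert (Hith' : 0 < / th (S k)) by (apply Rinv_0_lt_compat; lra).
  assert (Htt : tau k * / tau k = 1) by (apply Rinv_r; lra).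
  split.
  - unfold Rdiv. rewrite Rabs_mult, (Rabs_pos_eq (/ th k)) by lra.
    apply Rle_trans with (Rabs (ek k) * (/ x * / m)); [apply Rmult_le_compat_l; [apply Rabs_pos|exact Hit]|].
    enough (Rabs (ek k) * / m <= 2) by nra.
    apply Rle_trans with (Rabs (ek k) * (1 + / tau k)); [apply Rmult_le_compat_l; [apply Rabs_pos|exact I1]|].
    nra.
  - eapply Rle_trans; [apply quot_diff; lra|].
    rewrite (Rabs_pos_eq (th k)), (Rabs_pos_eq (th (S k))), (Rabs_pos_eq (th (S k) - th k)) by lra.
    assert (B1 : Rabs (ek (S k) - ek k) / th (S k) <= 5 / 2 * l * (/ x * (1 + / tau k))).
    { unfold Rdiv at 1. apply Rmult_le_compat; [apply Rabs_pos|lra| |].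
      - eapply Rle_trans; [exact E3|]. nra.
      - eapply Rle_trans; [exact Hit'|]. apply Rmult_le_compat_l; lra. }
    assert (B2 : Rabs (ek k) * (th (S k) - th k) / (th k * th (S k)) <= / 2 * l * (/ x * (1 + / tau k))).
    { unfold Rdiv. rewrite Rinv_mult.
      apply Rle_trans with ((tau k / 2) * (x * l * exp (- tau k)) * ((/ x * / m) * (/ x * / m))).
      - apply Rmult_le_compat.
        + apply Rmult_le_pos; [apply Rabs_pos|lra].
        + apply Rmult_le_pos; lra.
        + apply Rmult_le_compat; [apply Rabs_pos|lra|nra|lra].
        + apply Rmult_le_compat; lra.
      - replace ((tau k / 2) * (x * l * exp (- tau k)) * ((/ x * / m) * (/ x * / m)))
          with (/ 2 * l * (/ x * ((tau k * (exp (- tau k) / m)) * / m))) by (field; lra).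
        apply Rmult_le_compat_l; [lra|]. apply Rmult_le_compat_l; [lra|].
        rewrite <- (Rmult_1_l (1 + / tau k)).
        apply Rmult_le_compat; [|lra| |exact I1].
        + apply Rmult_le_pos; [lra|]. apply Rmult_le_pos; lra.
        + rewrite <- Htt. apply Rmult_le_compat_l; lra. }
    unfold Rdiv in *. lra.
Qed.

(** To the left of the stationary point the phase increments grow exponentially.  This
    bound, with its factor exp(u/2), is sharp enough for the growth to cancel in
    [left_rk_step]. *)
Lemma exp_minus_one_lower u : 0 <= u -> u * exp (u / 2) <= exp u - 1.
Proof.
  intros Hu.
  assert (H : u <= exp (u / 2) - exp (- (u / 2))).
  { destruct (sign_of_derive (fun t => exp (t / 2) - exp (- (t / 2)) - t)
      (fun t => exp (t / 2) / 2 + exp (- (t / 2)) / 2 - 1)) with (t := u) as [H _].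
    - intros v. auto_derive; [exact I|]. unfold Rdiv. field.
    - intros v. pose proof (exp_ineq1_le (v / 2)). pose proof (exp_ineq1_le (- (v / 2))). lra.
    - unfold Rdiv. rewrite Rmult_0_l, Ropp_0, exp_0. ring.
    - specialize (H Hu). lra. }
  pose proof (exp_pos (u / 2)).
  assert (E1 : exp (u / 2) * exp (u / 2) = exp u) by (rewrite <- exp_plus; f_equal; field).
  assert (E2 : exp (u / 2) * exp (- (u / 2)) = 1) by (rewrite <- exp_plus, Rplus_opp_r; apply exp_0).
  nra.
Qed.

Lemma left_th k : tau (S k) < 0 ->
  x * (exp (- tau (S k)) - 1) <= - th k <= x * (exp (- tau k) - 1).
Proof.
  intros Ht. rewrite th_eq. rewrite tau_S in *.
  assert (Hxl : 0 < x / l) by (apply Rdiv_lt_0_compat; lra).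
  pose proof one_minus_q as Hq. pose proof (exp_pos (- tau k)) as He.
  assert (Eq : exp (- (tau k + l)) = exp (- tau k) * exp (- l)) by (rewrite <- exp_plus; f_equal; ring).
  assert (Hql : l * exp (- l) <= 1 - exp (- l)).
  { pose proof (exp_ineq1_le l).
    assert (exp (- l) * exp l = 1) by (rewrite <- exp_plus, Rplus_opp_l; apply exp_0). nra. }
  rewrite Eq. split.
  - replace (x * (exp (- tau k) * exp (- l) - 1)) with (x / l * (exp (- tau k) * (l * exp (- l)) - l)) by (field; lra).
    replace (- (x / l * (l - exp (- tau k) * (1 - exp (- l))))) with
      (x / l * (exp (- tau k) * (1 - exp (- l)) - l)) by ring.
    apply Rmult_le_compat_l; nra.
  - replace (x * (exp (- tau k) - 1)) with (x / l * (exp (- tau k) * l - l)) by (field; lra).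
    replace (- (x / l * (l - exp (- tau k) * (1 - exp (- l))))) with
      (x / l * (exp (- tau k) * (1 - exp (- l)) - l)) by ring.
    apply Rmult_le_compat_l; nra.
Qed.

(** At k = 0 the increment is about x - 2 PI; it stays away from the pole -2 PI by x. *)
Lemma left_th_upper k : tau (S k) < 0 -> - th k <= 2 * PI - x.
Proof.
  intros Ht. destruct (left_th k Ht) as [_ H]. eapply Rle_trans; [exact H|].
  assert (exp (- tau k) <= 2 * PI / x).
  { rewrite <- exp_t0. apply exp_le. unfold tau. pose proof (pos_INR k). nra. }
  apply Rle_trans with (x * (2 * PI / x - 1)); [apply Rmult_le_compat_l; lra|].
  right. field. lra.
Qed.

Lemma left_sgm k : tau (S k) < 0 -> exists xi, tau k < xi < tau (S k) /\
  cc * (sgm (S k) - sgm k) = aa * - Dq xi /\ sgm (S k) - sgm k = sqrt (x / l) * l * - Dq xi.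
Proof.
  intros Ht. rewrite tau_S in *.
  destruct (Sq_mvt (tau k) (tau k + l)) as [xi [Hxi E]]; [lra|nra|].
  exists xi. split; [exact Hxi|].
  assert (Es : sgm (S k) - sgm k = sqrt (x / l) * l * - Dq xi).
  { unfold sgm. rewrite tau_S.
    destruct (Rlt_dec (tau k + l) 0); [|lra]. destruct (Rlt_dec (tau k) 0); [|lra].
    rewrite <- Rmult_minus_distr_l.
    replace (- Sq (tau k + l) - - Sq (tau k)) with (- (Sq (tau k + l) - Sq (tau k))) by ring.
    rewrite E. ring. }
  split; [|exact Es]. rewrite Es, <- !Rmult_assoc, cc_lam. field. lra.
Qed.

Lemma left_ek k : tau (S k) < 0 ->
  0 <= ek k <= Ak k * (- tau k / 2).
Proof.
  intros Ht. pose proof aa_range as Ha.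
  destruct (left_sgm k Ht) as [xi [Hxi [E _]]]. rewrite tau_S in *.
  assert (Ek : ek k = aa * (exp (- tau k / 2) - - Dq xi)) by (unfold ek; rewrite E, Ak_tau; ring).
  pose proof (Dq_left xi ltac:(lra)) as HD.
  assert (H1 : exp (- xi / 2) <= exp (- tau k / 2)) by (apply exp_le; lra).
  assert (H2 : exp (- tau k / 2) - 1 <= exp (- tau k / 2) * (- tau k / 2)).
  { pose proof (exp_ineq1_le (tau k / 2)).
    assert (exp (- tau k / 2) * exp (tau k / 2) = 1)
      by (rewrite <- exp_plus; rewrite <- exp_0; f_equal; field). nra. }
  rewrite Ek, Ak_tau. split; nra.
Qed.

Lemma left_ek_step k : tau (S (S k)) < 0 -> Rabs (ek (S k) - ek k) <= 3 * l.
Proof.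
  intros Ht. pose proof aa_range as Ha.
  destruct (left_sgm k) as [xi [Hxi [E _]]]; [rewrite !tau_S in *; lra|].
  destruct (left_sgm (S k) Ht) as [xi' [Hxi' [E' _]]]. rewrite !tau_S in *.
  replace (ek (S k) - ek k) with (- (Ak k - Ak (S k)) + aa * (Dq xi' - Dq xi))
    by (unfold ek; rewrite E, E'; ring).
  eapply Rle_trans; [apply Rabs_triang|].
  rewrite Rabs_Ropp, Rabs_mult, (Rabs_pos_eq aa) by lra.
  pose proof (Ak_step k) as HA. pose proof (Ak_range k) as HA1.
  rewrite (Rabs_pos_eq (Ak k - _)) by lra.
  pose proof (Dq_lip_left xi xi' ltac:(lra) ltac:(lra)) as HL.
  assert (H1 : exp (- xi / 2) <= exp (- tau k / 2)) by (apply exp_le; lra).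
  pose proof (exp_pos (- xi / 2)) as H2.
  assert (H3 : aa * Rabs (Dq xi' - Dq xi) <= aa * (exp (- tau k / 2) * (2 * l))).
  { apply Rmult_le_compat_l; [lra|]. eapply Rle_trans; [exact HL|].
    apply Rmult_le_compat; lra. }
  rewrite <- Rmult_assoc, <- Ak_tau in H3. nra.
Qed.

Lemma left_rk k : tau (S k) <= - l -> Rabs (ek k / th k) <= / x.
Proof.
  intros Ht. destruct (left_ek k ltac:(lra)) as [E1 E2]. destruct (left_th k ltac:(lra)) as [T1 _].
  pose proof (exp_ineq1_le (- tau (S k))) as He. pose proof (Ak_range k) as HA.
  assert (Ht2 : - tau k <= 2 * - tau (S k)) by (rewrite tau_S in *; lra).
  assert (Htk : tau k < 0) by (rewrite tau_S in *; lra).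
  set (d := - th k) in *. set (t := - tau (S k)) in *.
  replace (ek k / th k) with (- (ek k / d)) by (unfold d; field; unfold d in *; nra).
  rewrite Rabs_Ropp, Rabs_pos_eq.
  2:{ apply Rmult_le_pos; [exact E1|left; apply Rinv_0_lt_compat; nra]. }
  apply Rmult_le_reg_r with d; [nra|]. unfold Rdiv. rewrite Rmult_assoc, Rinv_l by nra.
  apply Rmult_le_reg_l with x; [lra|]. replace (x * (/ x * d)) with d by (field; lra).
  assert (Ak k * (- tau k / 2) <= 1 * (- tau k / 2)) by (apply Rmult_le_compat_r; lra).
  nra.
Qed.

(** The increment of th is at most x l exp(t), and the product of two consecutive values
    of th is at least x^2 t1 t2 exp((t1+t2)/2), where t, t1, t2 are consecutive values of
    -tau: the exponentials cancel. *)
Lemma left_rk_step k : tau (S (S k)) <= - l ->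
  Rabs (ek (S k) / th (S k) - ek k / th k) <= 6 / x * (l / - tau (S (S k))).
Proof.
  intros Ht.
  destruct (left_ek k) as [E1 E2]; [rewrite !tau_S in *; lra|].
  pose proof (left_ek_step k ltac:(lra)) as E3.
  destruct (left_th k) as [T1 _]; [rewrite !tau_S in *; lra|].
  destruct (left_th (S k)) as [T2 _]; [lra|].
  pose proof (th_step k) as Tst. pose proof (Ak_range k) as HA.
  set (t2 := - tau (S (S k))) in *. set (t1 := - tau (S k)) in *. set (t := - tau k) in *.
  assert (Et1 : t1 = t2 + l) by (unfold t1, t2; rewrite (tau_S (S k)); ring).
  assert (Et : t = t1 + l) by (unfold t1, t; rewrite (tau_S k); ring).
  assert (Ht2 : l <= t2) by (unfold t2; lra).
  pose proof (exp_minus_one_lower t1 ltac:(lra)) as L1.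
  pose proof (exp_minus_one_lower t2 ltac:(lra)) as L2.
  pose proof (exp_pos (t1 / 2)) as P1. pose proof (exp_pos (t2 / 2)) as P2.
  assert (Hd1 : x * (t1 * exp (t1 / 2)) <= - th k) by nra.
  assert (Hd2 : x * (t2 * exp (t2 / 2)) <= - th (S k)) by nra.
  assert (Hp1 : 0 < x * (t1 * exp (t1 / 2))) by (repeat apply Rmult_lt_0_compat; lra).
  assert (Hp2 : 0 < x * (t2 * exp (t2 / 2))) by (repeat apply Rmult_lt_0_compat; lra).
  eapply Rle_trans; [apply quot_diff; lra|].
  rewrite (Rabs_left1 (th k)), (Rabs_left1 (th (S k))), (Rabs_pos_eq (th (S k) - th k)),
    (Rabs_pos_eq (ek k)) by lra.
  assert (Hix : 0 < / x) by (apply Rinv_0_lt_compat; lra).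
  assert (Hit2 : 0 < / t2) by (apply Rinv_0_lt_compat; lra).
  assert (He2 : 1 <= exp (t2 / 2)) by (rewrite <- exp_0; apply exp_le; lra).
  assert (B1 : Rabs (ek (S k) - ek k) / - th (S k) <= 3 * l * (/ x * / t2)).
  { unfold Rdiv. apply Rmult_le_compat; [apply Rabs_pos|left; apply Rinv_0_lt_compat; lra|exact E3|].
    rewrite <- Rinv_mult. apply Rinv_le_contravar; [nra|].
    eapply Rle_trans; [|exact Hd2]. nra. }
  assert (B2 : ek k * (th (S k) - th k) / (- th k * - th (S k)) <= 3 * l * (/ x * / t2)).
  { assert (Hnum : ek k * (th (S k) - th k) <= (t / 2) * (x * l * exp t)).
    { apply Rmult_le_compat; [exact E1|lra| |exact (proj2 Tst)].
      assert (Ak k * (t / 2) <= 1 * (t / 2)) by (apply Rmult_le_compat_r; lra). lra. }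
    assert (Hden : (x * (t1 * exp (t1 / 2))) * (x * (t2 * exp (t2 / 2))) <= - th k * - th (S k)).
    { apply Rmult_le_compat; lra. }
    apply Rle_trans with ((t / 2) * (x * l * exp t) / ((x * (t1 * exp (t1 / 2))) * (x * (t2 * exp (t2 / 2))))).
    - unfold Rdiv. apply Rmult_le_compat.
      + apply Rmult_le_pos; lra.
      + left. apply Rinv_0_lt_compat. nra.
      + exact Hnum.
      + apply Rinv_le_contravar; [apply Rmult_lt_0_compat; lra|exact Hden].
    - assert (Eexp : exp t = exp (3 / 2 * l) * (exp (t1 / 2) * exp (t2 / 2))).
      { rewrite <- !exp_plus. f_equal. rewrite Et, Et1. field. }
      rewrite Eexp.
      replace ((t / 2) * (x * l * (exp (3 / 2 * l) * (exp (t1 / 2) * exp (t2 / 2))))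
         / ((x * (t1 * exp (t1 / 2))) * (x * (t2 * exp (t2 / 2)))))
        with (l * (/ x * / t2) * (exp (3 / 2 * l) * (t / (2 * t1)))) by (field; repeat split; lra).
      assert (H3 : exp (3 / 2 * l) <= 3).
      { eapply Rle_trans; [|apply exp_le_3]. apply exp_le. lra. }
      assert (H4 : 0 < t / (2 * t1) <= 1).
      { split; [apply Rdiv_lt_0_compat; lra|]. apply Rle_div_l; [lra|]. lra. }
      assert (exp (3 / 2 * l) * (t / (2 * t1)) <= 3) by nra.
      assert (0 < l * (/ x * / t2)) by (repeat apply Rmult_lt_0_compat; lra). nra. }
  unfold Rdiv in *. lra.
Qed.

Lemma right_gcot k : 0 < tau k -> Rabs (gcot (th k / 2)) <= 4 * W.
Proof.
  intros Ht. destruct (right_th k Ht) as [H1 H2].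
  assert (He : exp (- tau k) < 1) by (rewrite <- exp_0; apply exp_increasing; lra).
  assert (H3 : 0 < th k) by nra.
  destruct W_lower as [W1 [W2 W3]].
  eapply Rle_trans; [apply gcot_bound; lra|].
  assert (/ (PI - th k / 2) <= / ((2 * PI - x) / 2)) by (apply Rinv_le_contravar; lra).
  assert (E : / ((2 * PI - x) / 2) = 2 * / (2 * PI - x)) by (field; lra). lra.
Qed.

Lemma left_th_neg k : tau (S k) < 0 -> th k < 0.
Proof.
  intros Ht. destruct (left_th k Ht) as [H1 _]. pose proof (exp_ineq1 (- tau (S k)) ltac:(lra)). nra.
Qed.

Lemma left_gcot k : tau (S k) < 0 -> Rabs (gcot (th k / 2)) <= 4 * W.
Proof.
  intros Ht. pose proof (left_th_neg k Ht). pose proof (left_th_upper k Ht).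
  destruct W_lower as [W1 [W2 W3]].
  eapply Rle_trans; [apply gcot_bound_neg; lra|].
  assert (/ (PI + th k / 2) <= / (x / 2)) by (apply Rinv_le_contravar; lra).
  assert (E : / (x / 2) = 2 * / x) by (field; lra). lra.
Qed.

Lemma W_pos : 0 < W.
Proof. destruct W_lower. lra. Qed.

(** Summation by parts over the steps to the right of the stationary point.  There tau is
    at least a multiple j l, so the increments l/tau add up to a harmonic sum. *)
Lemma right_block (h : nat -> C) m n : (forall k, Cmod (h k) <= 1) -> l <= tau m ->
  Cmod (csum (fun j => (h (S (m + j)) - h (m + j)%nat) * RtoC (zk (m + j)%nat))%C n)
   <= 3 * (6 * W + 3 * W * (l * INR n + harm n)).
Proof.
  intros Hh Hm. destruct W_lower as [W1 [W2 W3]].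
  assert (Htau : forall j, l * INR (S j) <= tau (m + j)).
  { intros j. rewrite tau_add, S_INR. lra. }
  assert (Hl0 : forall j, l <= tau (m + j)).
  { intros j. specialize (Htau j). rewrite S_INR in Htau. pose proof (pos_INR j). nra. }
  assert (Hix : 0 < / x) by (apply Rinv_0_lt_compat; lra).
  assert (HT : 0 <= 3 * W * (l * INR n + harm n)).
  { apply Rmult_le_pos; [lra|]. pose proof (pos_INR n). pose proof (harm_mono 0 n ltac:(lia)) as Hh0.
    unfold harm at 1 in Hh0. simpl in Hh0. nra. }
  rewrite (csum_ext _ (fun j => (h (m + S j)%nat - h (m + j)%nat) * RtoC (zk (m + j)%nat))%C)
    by (intros; do 3 f_equal; lia).
  replace (6 * W + 3 * W * (l * INR n + harm n))
    with (3 / 2 * (4 * W) + 3 * W * (l * INR n + harm n)) by field.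
  apply (weight_block (fun j => h (m + j)%nat) (fun j => Ak (m + j)) (fun j => gcot (th (m + j) / 2))
      (fun j => ek (m + j) / th (m + j))).
    + intros; apply Hh.
    + lra.
    + intros j. pose proof (Ak_range (m + j)). lra.
    + intros j. rewrite Nat.add_succ_r. apply Ak_mono.
    + intros j _. apply right_gcot. specialize (Hl0 j). lra.
    + intros j _. pose proof (Hl0 j). pose proof (Hl0 (S j)).
      destruct (right_th (m + j) ltac:(lra)) as [A1 A2].
      destruct (right_th (m + S j) ltac:(lra)) as [B1 B2].
      assert (exp (- tau (m + j)) < 1) by (rewrite <- exp_0; apply exp_increasing; lra).
      pose proof (th_step (m + j)) as S1. rewrite Nat.add_succ_r in *.
      apply gcot_decr; nra.
    + intros j _. destruct (right_rk (m + j) (Hl0 j)) as [R1 _]. unfold Rdiv in R1 at 2. lra.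
    + apply Rle_trans with (rsum (fun j => 3 * W * (l + / INR (S j))) n).
      * destruct n as [|n]; [simpl; lra|]. simpl pred.
        apply Rle_trans with (rsum (fun j => 3 * W * (l + / INR (S j))) n).
        -- apply rsum_le. intros j _. rewrite Nat.add_succ_r.
           destruct (right_rk (m + j) (Hl0 j)) as [_ R2].
           eapply Rle_trans; [exact R2|].
           assert (Hp : 0 < INR (S j)) by (apply lt_0_INR; lia).
           assert (Hq : l / tau (m + j) <= / INR (S j)).
           { pose proof (Hl0 j). apply Rle_div_l; [lra|].
             apply Rmult_le_reg_l with (INR (S j)); [lra|].
             replace (INR (S j) * (/ INR (S j) * tau (m + j))) with (tau (m + j)) by (field; lra).
             rewrite Rmult_comm. apply Htau. }
           assert (0 <= l / tau (m + j)).
           { pose proof (Hl0 j). apply Rmult_le_pos; [lra|left; apply Rinv_0_lt_compat; lra]. }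
           apply Rmult_le_compat; [unfold Rdiv; lra|lra|unfold Rdiv; lra|lra].
        -- simpl. assert (0 < / INR (S n)) by (apply Rinv_0_lt_compat, lt_0_INR; lia).
           simpl in H. nra.
      * rewrite rsum_scal, rsum_plus, rsum_const. unfold harm. right. ring.
Qed.

Lemma left_block (h : nat -> C) n : (forall k, Cmod (h k) <= 1) -> (n = O \/ tau n <= - l) ->
  Cmod (csum (fun k => (h (S k) - h k) * RtoC (zk k))%C n) <= 3 * (6 * W + 6 * W * harm n).
Proof.
  intros Hh Hn0. destruct (Nat.eq_dec n 0) as [-> | Hne].
  { pose proof W_pos. unfold harm. simpl. rewrite Cmod_0. nra. }
  destruct Hn0 as [H0 | Hn]; [contradiction|].
  destruct W_lower as [W1 [W2 W3]].
  assert (Htau : forall j, (j <= n)%nat -> tau j <= - l * INR (S (n - j))).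
  { intros j Hj. rewrite S_INR, minus_INR by exact Hj. unfold tau in *. lra. }
  assert (Hl0 : forall j, (j < n)%nat -> tau (S j) <= - l).
  { intros j Hj. pose proof (Htau (S j) Hj). rewrite S_INR in H. pose proof (pos_INR (n - S j)). nra. }
  assert (Hix : 0 < / x) by (apply Rinv_0_lt_compat; lra).
  assert (Hh0 : 0 <= harm n).
  { pose proof (harm_mono 0 n ltac:(lia)) as H0. unfold harm at 1 in H0. simpl in H0. exact H0. }
  replace (6 * W + 6 * W * harm n) with (3 / 2 * (4 * W) + 6 * W * harm n) by field.
  apply (weight_block h Ak (fun j => gcot (th j / 2)) (fun j => ek j / th j)).
    + exact Hh.
    + lra.
    + intros j. pose proof (Ak_range j). lra.
    + apply Ak_mono.
    + intros j Hj. apply left_gcot. specialize (Hl0 j ltac:(lia)). lra.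
    + intros j Hj. pose proof (Hl0 j ltac:(lia)). pose proof (Hl0 (S j) ltac:(lia)).
      pose proof (left_th_neg (S j) ltac:(lra)).
      pose proof (left_th_upper j ltac:(lra)). pose proof (th_step j).
      apply gcot_decr_neg; lra.
    + intros j Hj. pose proof (left_rk j (Hl0 j Hj)). lra.
    + apply Rle_trans with (rsum (fun j => 6 * W * / INR (S (pred n - 1 - j))) (pred n)).
      * apply rsum_le. intros j Hj.
        eapply Rle_trans; [apply left_rk_step, Hl0; lia|].
        pose proof (Htau (S (S j)) ltac:(lia)) as Ht.
        assert (Hp : 0 < INR (S (pred n - 1 - j))) by (apply lt_0_INR; lia).
        replace (n - S (S j))%nat with (pred n - 1 - j)%nat in Ht by lia.
        set (t := - tau (S (S j))) in *. assert (Ht2 : l * INR (S (pred n - 1 - j)) <= t) by (unfold t; lra).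
        assert (Ht0 : 0 < t) by nra.
        assert (Hq : l / t <= / INR (S (pred n - 1 - j))).
        { apply Rle_div_l; [lra|].
          apply Rmult_le_reg_l with (INR (S (pred n - 1 - j))); [lra|].
          replace (INR (S (pred n - 1 - j)) * (/ INR (S (pred n - 1 - j)) * t)) with t by (field; lra).
          lra. }
        assert (0 <= l / t) by (apply Rmult_le_pos; [lra|left; apply Rinv_0_lt_compat; lra]).
        apply Rmult_le_compat; [unfold Rdiv; lra|lra|unfold Rdiv; lra|lra].
      * rewrite rsum_scal. apply Rmult_le_compat_l; [lra|].
        rewrite <- (rsum_rev (fun j => / INR (S j))). apply harm_mono. lia.
Qed.

Definition hh (k : nat) : C := cis (sgm k ^ 2 / 2).
Definition Xk (k : nat) : C :=
  (RtoC (Ak k / 2) * (hh k + hh (S k)) - RtoC cc * (Fr (sgm (S k)) - Fr (sgm k)))%C.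
Definition Yk (k : nat) : C := (- Ci * ((hh (S k) - hh k) * RtoC (zk k)))%C.

Lemma Cmod_hh k : Cmod (hh k) <= 1.
Proof. unfold hh. rewrite Cmod_cis. lra. Qed.

(** The cubic error of [Fr_chord], for a spacing of order at most sqrt l. *)
Lemma cell_error k : sgm k < sgm (S k) -> sgm k + sgm (S k) <> 0 -> sin (th k / 2) <> 0 ->
  cc * (sgm (S k) - sgm k) <= 1 -> Cmod (Xk k - Yk k) <= l.
Proof.
  intros H1 H2 H3 H4. pose proof cc_pos as Hc. pose proof PI_4 as HPI4.
  eapply Rle_trans; [apply (cell (sgm k) (sgm (S k)) (Ak k) cc H1 H2 ltac:(lra) H3)|].
  set (d := sgm (S k) - sgm k) in *. assert (Hd : 0 < d) by (unfold d; lra).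
  assert (Hd2 : d ^ 2 <= 2 * PI * l).
  { assert ((cc * d) ^ 2 <= 1) by (apply pow_le_one; nra).
    rewrite Rpow_mult_distr, cc_sq in H.
    apply Rmult_le_reg_l with (/ (2 * PI * l)); [apply Rinv_0_lt_compat; nra|].
    rewrite Rinv_l by nra. exact H. }
  replace (cc * (d ^ 3 / 8)) with (cc * d * (d ^ 2 / 8)) by field.
  apply Rle_trans with (1 * (2 * PI * l / 8)).
  - apply Rmult_le_compat; [nra|nra|exact H4|lra].
  - nra.
Qed.

Lemma right_cell k : 0 < tau k -> Cmod (Xk k - Yk k) <= l.
Proof.
  intros Ht. destruct (right_sgm k Ht) as [xi [Hxi [E1 E2]]].
  pose proof (Dq_right xi ltac:(lra)) as HD. pose proof (exp_pos (- xi / 2)).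
  assert (Hsx : 0 < sqrt (x / l)) by (apply sqrt_lt_R0, Rdiv_lt_0_compat; lra).
  pose proof aa_range as Ha.
  assert (Hpos : 0 < sgm k).
  { unfold sgm. destruct (Rlt_dec (tau k) 0); [lra|]. apply Rmult_lt_0_compat; [exact Hsx|].
    apply Sq_pos. lra. }
  assert (Hd : 0 < sgm (S k) - sgm k) by (rewrite E2; apply Rmult_lt_0_compat; [apply Rmult_lt_0_compat|]; lra).
  destruct (right_th k Ht) as [T1 T2].
  assert (He : exp (- tau k) < 1) by (rewrite <- exp_0; apply exp_increasing; lra).
  apply cell_error; [lra|lra| |rewrite E1; nra].
  apply Rgt_not_eq, sin_gt_0; nra.
Qed.

Lemma left_cell k : tau (S k) < 0 -> Cmod (Xk k - Yk k) <= l.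
Proof.
  intros Ht. destruct (left_sgm k Ht) as [xi [Hxi [E1 E2]]].
  pose proof (Dq_left xi ltac:(lra)) as HD.
  assert (Hsx : 0 < sqrt (x / l)) by (apply sqrt_lt_R0, Rdiv_lt_0_compat; lra).
  pose proof aa_range as Ha.
  assert (Hneg : sgm (S k) < 0).
  { unfold sgm. destruct (Rlt_dec (tau (S k)) 0); [|lra].
    pose proof (Sq_pos (tau (S k)) ltac:(lra)). nra. }
  assert (Hd : 0 < sgm (S k) - sgm k) by (rewrite E2; apply Rmult_lt_0_compat; [apply Rmult_lt_0_compat|]; lra).
  pose proof (left_th_upper k Ht) as T1. pose proof (left_th_neg k Ht) as T2.
  apply cell_error; [lra|lra| |].
  - assert (0 < sin (- (th k / 2))) by (apply sin_gt_0; lra). rewrite sin_neg in H. lra.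
  - rewrite E1. pose proof (Ak_range k) as HA. rewrite Ak_tau in HA.
    assert (exp (- xi / 2) <= exp (- tau k / 2)) by (apply exp_le; lra).
    apply Rle_trans with (aa * exp (- tau k / 2)); [|lra].
    apply Rmult_le_compat_l; lra.
Qed.

Lemma Fr_lip a b : Cmod (Fr b - Fr a) <= Rabs (b - a).
Proof.
  assert (H : forall a b, a <= b -> Cmod (Fr b - Fr a) <= b - a).
  { clear a b. intros a b Hab.
    apply (curve_mvt Fc Fs (fun y => y) (fun y => cos (y ^ 2 / 2)) (fun y => sin (y ^ 2 / 2)) (fun _ => 1));
      [exact Hab|intros; apply is_derive_Fc|intros; apply is_derive_Fs| |].
    - intros y _. apply (is_derive_id (K := R_AbsRing)).
    - intros y _. change (Cmod (cis (y ^ 2 / 2)) <= 1). rewrite Cmod_cis. lra. }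
  destruct (Rle_lt_dec a b) as [Hab|Hab].
  - rewrite Rabs_pos_eq by lra. now apply H.
  - rewrite Rabs_left by lra. replace (Fr b - Fr a)%C with (- (Fr a - Fr b))%C by ring.
    rewrite Cmod_opp. specialize (H b a ltac:(lra)). lra.
Qed.

Lemma sgm_near k : Rabs (tau k) <= 2 * l -> cc * Rabs (sgm k) <= 4.
Proof.
  intros Ht. pose proof aa_range as Ha.
  assert (HS : Sq (tau k) <= 2 * (2 * l)).
  { eapply Rle_trans; [apply Sq_le_near; lra|lra]. }
  assert (E : Rabs (sgm k) = sqrt (x / l) * Sq (tau k)).
  { unfold sgm. rewrite Rabs_mult, (Rabs_pos_eq (sqrt _)) by apply sqrt_pos. f_equal.
    pose proof (Sq_ge0 (tau k)).
    destruct (Rlt_dec (tau k) 0); [rewrite Rabs_Ropp|]; apply Rabs_pos_eq; lra. }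
  rewrite E, <- Rmult_assoc, cc_lam.
  apply Rle_trans with (aa / l * (2 * (2 * l))).
  - apply Rmult_le_compat_l; [|exact HS].
    apply Rmult_le_pos; [lra|left; apply Rinv_0_lt_compat; lra].
  - replace (aa / l * (2 * (2 * l))) with (4 * aa) by (field; lra). lra.
Qed.

(** The steps at the stationary point, at most three, are estimated trivially: there cc
    times sgm is bounded. *)
Lemma center_cell k : Rabs (tau k) <= 2 * l -> Rabs (tau (S k)) <= 2 * l -> Cmod (Xk k) <= 9.
Proof.
  intros H1 H2. pose proof (sgm_near k H1) as N1. pose proof (sgm_near (S k) H2) as N2.
  pose proof cc_pos as Hc. pose proof (Ak_range k) as HA.
  unfold Xk, Cminus at 1. eapply Rle_trans; [apply Cmod_triangle|].
  rewrite Cmod_opp, !Cmod_mult, !Cmod_R, (Rabs_pos_eq cc), (Rabs_pos_eq (Ak k / 2)) by lra.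
  pose proof (Cmod_triangle (hh k) (hh (S k))) as T. pose proof (Cmod_hh k). pose proof (Cmod_hh (S k)).
  pose proof (Fr_lip (sgm k) (sgm (S k))) as L.
  assert (cc * Cmod (Fr (sgm (S k)) - Fr (sgm k)) <= 8).
  { apply Rle_trans with (cc * (Rabs (sgm (S k)) + Rabs (sgm k))); [|lra].
    apply Rmult_le_compat_l; [lra|]. eapply Rle_trans; [exact L|].
    unfold Rminus. eapply Rle_trans; [apply Rabs_triang|]. rewrite Rabs_Ropp. lra. }
  assert (Ak k / 2 * Cmod (hh k + hh (S k)) <= / 2 * 2).
  { apply Rmult_le_compat; [lra|apply Cmod_ge_0|lra|lra]. }
  lra.
Qed.

Lemma block_error m n : (forall j, (j < n)%nat -> Cmod (Xk (m + j) - Yk (m + j)) <= l) ->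
  Cmod (csum (fun j => Xk (m + j)%nat) n) <= l * INR n +
    Cmod (csum (fun j => (hh (S (m + j)) - hh (m + j)%nat) * RtoC (zk (m + j)%nat))%C n).
Proof.
  intros H.
  replace (csum (fun j => Xk (m + j)%nat) n) with
    (csum (fun j => Xk (m + j)%nat - Yk (m + j)%nat)%C n + csum (fun j => Yk (m + j)%nat) n)%C.
  2:{ rewrite csum_minus. ring. }
  eapply Rle_trans; [apply Cmod_triangle|]. apply Rplus_le_compat.
  - eapply Rle_trans; [apply Cmod_csum|]. rewrite Rmult_comm. now apply rsum_le_bound.
  - unfold Yk. rewrite csum_scal, Cmod_mult, Cmod_opp, Cmod_Ci. lra.
Qed.

Lemma t0_lower : (2 * PI - x) / (2 * PI) <= t0.
Proof.
  unfold t0.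
  assert (Hy : 0 < x / (2 * PI)) by (apply Rdiv_lt_0_compat; lra).
  replace (2 * PI / x) with (/ (x / (2 * PI))) by (field; lra). rewrite ln_Rinv by exact Hy.
  pose proof (exp_ineq1_le (ln (x / (2 * PI)))) as He. rewrite exp_ln in He by exact Hy.
  replace ((2 * PI - x) / (2 * PI)) with (1 - x / (2 * PI)) by (field; lra). lra.
Qed.

Lemma t0_pos : 0 < t0.
Proof.
  pose proof t0_lower.
  assert (0 < (2 * PI - x) / (2 * PI)) by (apply Rdiv_lt_0_compat; lra). lra.
Qed.

Lemma cc_over_lam : cc / sqrt (x / l) = / sqrt (2 * PI * x).
Proof.
  unfold cc.
  assert (Hxl : 0 < x / l) by (apply Rdiv_lt_0_compat; lra).
  unfold Rdiv at 1. rewrite <- Rinv_mult, <- sqrt_mult by nra.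
  f_equal. f_equal. field. lra.
Qed.

Lemma sqrt_2PIx_inv : / sqrt (2 * PI * x) <= / x /\
  2 * PI / (2 * PI - x) * / sqrt (2 * PI * x) <= W.
Proof.
  assert (Hs : 0 < sqrt (2 * PI * x)) by (apply sqrt_lt_R0; nra).
  assert (Hsq : sqrt (2 * PI * x) ^ 2 = 2 * PI * x) by (apply pow2_sqrt; nra).
  assert (Hxs : x <= sqrt (2 * PI * x)) by nra.
  split; [apply Rinv_le_contravar; lra|].
  unfold W. replace (/ x + / (2 * PI - x)) with (2 * PI / (2 * PI - x) * / x) by (field; lra).
  apply Rmult_le_compat_l; [|apply Rinv_le_contravar; lra].
  left. apply Rdiv_lt_0_compat; lra.
Qed.

(** Passing to the trapezoidal sum: the amplitude is monotone. *)
Lemma sum_compare K : Cmod (csum (fun k => RtoC (Ak k) * hh k)%C K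
   - csum (fun k => RtoC (Ak k / 2) * (hh k + hh (S k)))%C K) <= 3 / 2.
Proof.
  rewrite <- csum_minus.
  rewrite (csum_ext _ (fun k => RtoC (- / 2) * ((hh (S k) - hh k) * RtoC (Ak k)))%C).
  2:{ intros k _. unfold Rdiv. rewrite RtoC_opp, RtoC_mult.
      replace (RtoC (Ak k)) with (RtoC 2 * RtoC (/ 2) * RtoC (Ak k))%C at 1; [ring|].
      rewrite <- RtoC_mult, Rinv_r by lra. ring. }
  rewrite csum_scal, Cmod_mult, Cmod_R, Rabs_Ropp, (Rabs_pos_eq (/ 2)) by lra.
  enough (Cmod (csum (fun k => (hh (S k) - hh k) * RtoC (Ak k))%C K) <= 3 * 1) by lra.
  apply block_sum; [apply Cmod_hh| | |lra].
  - intros k _. pose proof (Ak_range k). rewrite Rabs_pos_eq; lra.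
  - apply Rle_trans with (rsum (fun k => -1 * (Ak (S k) - Ak k)) (pred K)).
    + apply rsum_le. intros k _. pose proof (Ak_step k). rewrite Rabs_left1; lra.
    + rewrite rsum_scal, rsum_telescope. pose proof (Ak_range O). pose proof (Ak_range (pred K)). lra.
Qed.

(** Stationary phase with an explicit error: the sum is cc times a Fresnel integral over
    [sgm 0, sgm K], up to W times logarithms, and the complete Fresnel integral has
    modulus sqrt(2 PI).  Both ends of the interval are at a distance at least cc/W from
    the stationary point 0. *)
Lemma chirp_sum K : 2 + t0 <= l * INR K ->
  Rabs (Cmod (csum (fun k => RtoC (Ak k) * hh k)%C K) - / sqrt l)
   <= 70 * W * (l * INR K + 3 + ln (INR K)).
Proof.
  intros HK. pose proof t0_pos as Ht0. pose proof W_pos as HW. destruct W_lower as [W1 [W2 W3]].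
  pose proof PI_RGT_0 as HPI.
  destruct (nfloor_ex (t0 / l)) as [n0 [F1 F2]].
  { apply Rmult_le_pos; [lra|left; apply Rinv_0_lt_compat; lra]. }
  assert (G1 : l * INR n0 <= t0).
  { apply Rmult_le_compat_l with (r := l) in F1; [|lra].
    replace (l * (t0 / l)) with t0 in F1 by (field; lra). exact F1. }
  assert (G2 : t0 < l * INR n0 + l).
  { apply Rmult_lt_compat_l with (r := l) in F2; [|lra].
    replace (l * (t0 / l)) with t0 in F2 by (field; lra). lra. }
  assert (HnK : (n0 + 2 <= K)%nat).
  { apply INR_le. rewrite plus_INR. simpl. apply Rmult_le_reg_l with l; lra. }
  assert (HK1 : (0 < K)%nat) by lia.
  set (k1 := pred n0). set (m := (n0 + 2 - k1)%nat). set (Rn := (K - (n0 + 2))%nat).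
  assert (EK : K = (k1 + (m + Rn))%nat) by (unfold k1, m, Rn; lia).
  assert (Hm3 : (m <= 3)%nat) by (unfold m, k1; lia).
  set (LK := l * INR K + 3 + ln (INR K)).
  assert (HlnK : 0 <= ln (INR K)).
  { rewrite <- ln_1. apply le_INR in HK1. simpl in HK1.
    destruct HK1 as [HK1|HK1]; [left; apply ln_increasing; lra|rewrite <- HK1; lra]. }
  assert (HLK : 3 <= LK) by (unfold LK; pose proof (pos_INR K); nra).
  pose proof (harm_le K HK1) as HhK.
  assert (Hharm : forall n, (n <= K)%nat -> harm n <= 1 + ln (INR K)).
  { intros n Hn. eapply Rle_trans; [apply harm_mono, Hn|exact HhK]. }
  assert (HlR : forall n, (n <= K)%nat -> l * INR n <= l * INR K).
  { intros n Hn. apply Rmult_le_compat_l; [lra|]. now apply le_INR. }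
  (* The steps left of the stationary point, those around it, and those on its right. *)
  assert (BL : Cmod (csum Xk k1) <= l * INR k1 + 18 * W * LK).
  { rewrite (csum_ext Xk (fun j => Xk (0 + j)%nat)) by reflexivity.
    assert (Hk1 : k1 = O \/ tau k1 <= - l).
    { unfold k1. destruct n0 as [|n']; [now left|right]. simpl pred. unfold tau.
      rewrite S_INR in G1. lra. }
    eapply Rle_trans; [apply (block_error 0)|].
    - intros j Hj. apply left_cell. simpl.
      destruct Hk1 as [-> | Hk1]; [lia|].
      assert (tau (S j) <= tau k1).
      { unfold tau. apply Rplus_le_compat_r, Rmult_le_compat_l; [lra|]. apply le_INR. lia. }
      lra.
    - apply Rplus_le_compat_l. eapply Rle_trans; [apply (left_block hh k1 Cmod_hh Hk1)|].
      pose proof (Hharm k1 ltac:(lia)). unfold LK.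
      nra. }
  assert (BC : Cmod (csum (fun j => Xk (k1 + j)%nat) m) <= 27).
  { eapply Rle_trans; [apply Cmod_csum|].
    eapply Rle_trans; [apply rsum_le_bound with (c := 9)|].
    - intros j Hj.
      assert (Htau : forall i, (k1 <= i <= n0 + 2)%nat -> Rabs (tau i) <= 2 * l).
      { intros i [Hi1 Hi2]. apply Rabs_le. unfold tau.
        apply le_INR in Hi2. rewrite plus_INR in Hi2. simpl in Hi2.
        assert (Hi3 : INR n0 <= INR i + 1) by (rewrite <- S_INR; apply le_INR; unfold k1 in Hi1; lia).
        split; nra. }
      apply center_cell; apply Htau; unfold m in Hj; lia.
    - apply le_INR in Hm3. simpl in Hm3. lra. }
  assert (BR : Cmod (csum (fun j => Xk (k1 + (m + j))%nat) Rn) <= l * INR Rn + 18 * W * LK).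
  { rewrite (csum_ext _ (fun j => Xk (n0 + 2 + j)%nat)) by (intros; f_equal; lia).
    assert (Htn : l <= tau (n0 + 2)).
    { unfold tau. rewrite plus_INR. simpl. lra. }
    eapply Rle_trans; [apply (block_error (n0 + 2))|].
    - intros j _. apply right_cell. rewrite tau_add. pose proof (pos_INR j). nra.
    - apply Rplus_le_compat_l. eapply Rle_trans; [apply (right_block hh (n0 + 2) Rn Cmod_hh Htn)|].
      pose proof (Hharm Rn ltac:(lia)). pose proof (HlR Rn ltac:(lia)). unfold LK.
      nra. }
  assert (BX : Cmod (csum Xk K) <= l * INR K + 27 + 36 * W * LK).
  { rewrite EK at 1. rewrite csum_add, (csum_add (fun k => Xk (k1 + k)%nat)).
    eapply Rle_trans; [apply Cmod_triangle|].
    eapply Rle_trans; [apply Rplus_le_compat_l, Cmod_triangle|].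
    assert (l * INR k1 + l * INR Rn <= l * INR K).
    { rewrite <- Rmult_plus_distr_l, <- plus_INR. apply HlR. lia. }
    lra. }
  (* The part of the Fresnel integral missing beyond the two end points. *)
  assert (Hsx : 0 < sqrt (x / l)) by (apply sqrt_lt_R0, Rdiv_lt_0_compat; lra).
  pose proof cc_pos as Hc. pose proof cc_over_lam as Hcl. destruct sqrt_2PIx_inv as [Q1 Q2].
  assert (Es0 : sgm O = - (sqrt (x / l) * Sq (- t0))).
  { unfold sgm. assert (Et : tau 0 = - t0) by (unfold tau; simpl; ring). rewrite Et.
    destruct (Rlt_dec (- t0) 0); [ring|lra]. }
  assert (HtK : 2 <= tau K) by (unfold tau; lra).
  assert (EsK : sgm K = sqrt (x / l) * Sq (tau K)).
  { unfold sgm. destruct (Rlt_dec (tau K) 0); [lra|reflexivity]. }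
  assert (HSK : 1 <= Sq (tau K)).
  { apply Rsqr_incr_0_var; [|apply Sq_ge0]. rewrite !Rsqr_pow2, Sq_sq.
    unfold psi. pose proof (exp_pos (- tau K)). lra. }
  pose proof (Sq_left_lower t0 ltac:(lra)) as HS0. pose proof t0_lower as Htl.
  set (a := sqrt (x / l) * Sq (- t0)) in *. set (b := sqrt (x / l) * Sq (tau K)) in *.
  assert (Ha : 0 < a) by (apply Rmult_lt_0_compat; lra).
  assert (Hb : 0 < b) by (apply Rmult_lt_0_compat; lra).
  pose proof (fresnel_const a b Ha Hb) as HF.
  assert (Hca : cc * (2 / a) <= 2 * W).
  { replace (cc * (2 / a)) with (2 * (/ Sq (- t0) * (cc / sqrt (x / l))))
      by (unfold a; field; split; lra).
    rewrite Hcl. apply Rmult_le_compat_l; [lra|]. eapply Rle_trans; [|exact Q2].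
    assert (Hp : 0 < / sqrt (2 * PI * x)) by (apply Rinv_0_lt_compat, sqrt_lt_R0; nra).
    apply Rmult_le_compat_r; [lra|].
    assert (Hq : 0 < (2 * PI - x) / (2 * PI)) by (apply Rdiv_lt_0_compat; lra).
    replace (2 * PI / (2 * PI - x)) with (/ ((2 * PI - x) / (2 * PI))) by (field; lra).
    apply Rinv_le_contravar; lra. }
  assert (Hcb : cc * (2 / b) <= 2 * W).
  { replace (cc * (2 / b)) with (2 * (/ Sq (tau K) * (cc / sqrt (x / l))))
      by (unfold b; field; split; lra).
    rewrite Hcl. apply Rmult_le_compat_l; [lra|].
    assert (Hp : 0 < / sqrt (2 * PI * x)) by (apply Rinv_0_lt_compat, sqrt_lt_R0; nra).
    assert (/ Sq (tau K) <= 1) by (rewrite <- Rinv_1; apply Rinv_le_contravar; lra). nra. }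
  set (S1 := csum (fun k => RtoC (Ak k) * hh k)%C K).
  set (S2 := csum (fun k => RtoC (Ak k / 2) * (hh k + hh (S k)))%C K).
  set (S3 := (RtoC cc * (Fr (sgm K) - Fr (sgm 0%nat)))%C).
  assert (EX : csum Xk K = (S2 - S3)%C).
  { unfold Xk, S2, S3. rewrite csum_minus, csum_scal, (csum_telescope (fun k => Fr (sgm k))).
    reflexivity. }
  pose proof (sum_compare K) as HC. fold S1 S2 in HC.
  rewrite EX in BX.
  assert (H13 : Rabs (Cmod S1 - Cmod S3) <= 3 / 2 + (l * INR K + 27 + 36 * W * LK)).
  { eapply Rle_trans; [apply Cmod_diff_le|].
    replace (S1 - S3)%C with ((S1 - S2) + (S2 - S3))%C by ring.
    eapply Rle_trans; [apply Cmod_triangle|]. lra. }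
  assert (H3 : Rabs (Cmod S3 - / sqrt l) <= 4 * W).
  { assert (Ec : / sqrt l = cc * sqrt (2 * PI)).
    { unfold cc. rewrite sqrt_mult by lra.
      assert (0 < sqrt (2 * PI)) by (apply sqrt_lt_R0; lra).
      assert (0 < sqrt l) by (apply sqrt_lt_R0; lra). field. lra. }
    unfold S3. rewrite Ec, Cmod_mult, Cmod_R, (Rabs_pos_eq cc) by lra.
    rewrite <- Rmult_minus_distr_l, Rabs_mult, (Rabs_pos_eq cc) by lra.
    rewrite Es0, EsK.
    apply Rle_trans with (cc * (2 / a + 2 / b)); [apply Rmult_le_compat_l; lra|lra]. }
  replace (Cmod S1 - / sqrt l) with ((Cmod S1 - Cmod S3) + (Cmod S3 - / sqrt l)) by ring.
  eapply Rle_trans; [apply Rabs_triang|].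
  assert (HWL : 3 / 2 <= W * LK) by nra.
  assert (HlL : l * INR K <= 2 * (W * LK)).
  { apply Rle_trans with LK; [unfold LK; lra|nra]. }
  assert (H4W : 3 * W <= W * LK) by nra.
  replace (70 * W * LK) with (70 * (W * LK)) by ring.
  replace (36 * W * LK) with (36 * (W * LK)) in H13 by ring.
  lra.
Qed.

End Chirp.

(** * The chirp polynomial *)

(** b_k = sqrt(w_k) exp(i (2 PI/l) q^k).  The derivative of the phase of b_k e^(ikx) in k
    is x - 2 PI q^k: as k grows it vanishes at one point only, reached at the rate
    2 PI w_k, to leading order, which balances |b_k|^2 = w_k: the modulus of the sum is
    close to 1 for all x away from 0. *)
Definition bco (l : R) (K k : nat) : C :=
  if (k <? K)%nat
  then (RtoC (sqrt (1 - exp (- l)) * Ak l k) * cis (2 * PI / l * exp (- (l * INR k))))%C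
  else RtoC 0.

Lemma bco_sq l K k : 0 < l -> (k < K)%nat -> Cmod (bco l K k) ^ 2 = wt l k.
Proof.
  intros Hl Hk. unfold bco. destruct (Nat.ltb_spec k K); [|lia].
  assert (Hq : 0 < 1 - exp (- l)).
  { assert (exp (- l) < 1) by (rewrite <- exp_0; apply exp_increasing; lra). lra. }
  rewrite Cmod_mult, Cmod_cis, Cmod_R, Rmult_1_r, pow2_abs, Rpow_mult_distr, pow2_sqrt by lra.
  rewrite wt_exp by exact Hl. unfold Rminus at 2. rewrite exp_plus, exp_ln by exact Hq.
  f_equal. unfold Ak. simpl. rewrite Rmult_1_r, <- exp_plus. f_equal. field.
Qed.

Lemma peval_bco l K n z : (K <= n)%nat -> peval (bco l K) n z = peval (bco l K) K z.
Proof.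
  intros H. unfold peval. apply csum_zero_tail; [exact H|].
  intros k Hk. unfold bco. destruct (Nat.ltb_spec k K); [lia|ring].
Qed.

(** A rotation turns the phase into sgm^2/2. *)
Lemma f0_modulus l x K : 0 < l <= / 4 -> 0 < x < 2 * PI ->
  Cmod (peval (bco l K) K (cis x)) =
  sqrt (1 - exp (- l)) * Cmod (csum (fun k => RtoC (Ak l k) * hh l x k)%C K).
Proof.
  intros Hl Hx. pose proof (sqrt_pos (1 - exp (- l))) as Hs.
  set (om := x / l * (t0 x + 1)).
  assert (E : peval (bco l K) K (cis x) =
    (RtoC (sqrt (1 - exp (- l))) * cis om * csum (fun k => RtoC (Ak l k) * hh l x k) K)%C).
  { unfold peval. rewrite <- csum_scal. apply csum_ext. intros k Hk.
    unfold bco. destruct (Nat.ltb_spec k K); [|lia].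
    rewrite cis_pow, RtoC_mult. unfold hh.
    assert (Eph : 2 * PI / l * exp (- (l * INR k)) + INR k * x = om + sgm l x k ^ 2 / 2).
    { rewrite sgm_sq by assumption. unfold psi, tau, om.
      replace (- (l * INR k - t0 x)) with (- (l * INR k) + t0 x) by ring.
      rewrite exp_plus, exp_t0 by assumption. field. lra. }
    replace (RtoC (sqrt (1 - exp (- l))) * cis om * (RtoC (Ak l k) * cis (sgm l x k ^ 2 / 2)))%C
      with (RtoC (sqrt (1 - exp (- l))) * RtoC (Ak l k) * (cis om * cis (sgm l x k ^ 2 / 2)))%C by ring.
    rewrite <- cis_plus, <- Eph, cis_plus. ring. }
  rewrite E, !Cmod_mult, Cmod_cis, Cmod_R, Rabs_pos_eq by exact Hs. ring.
Qed.

(** Here sqrt(1-q) differs from sqrt l by a relative error l, and |1-z| W <= 2. *)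
Lemma f0_interval l x K : 0 < l <= / 4 -> 0 < x < 2 * PI ->
  2 + ln (2 * PI / x) <= l * INR K ->
  Rabs (Cmod (peval (bco l K) K (cis x)) - 1) * Cmod (1 - cis x)
   <= 142 * sqrt l * (l * INR K + 3 + ln (INR K)).
Proof.
  intros Hl Hx HK.
  pose proof (chirp_sum l x Hl Hx K HK) as HC.
  rewrite f0_modulus by assumption.
  set (S := Cmod (csum (fun k => RtoC (Ak l k) * hh l x k)%C K)) in *.
  set (LK := l * INR K + 3 + ln (INR K)) in *.
  pose proof (one_minus_q l Hl) as Hq.
  assert (Hql : l * (1 - l) <= 1 - exp (- l)).
  { pose proof (exp_ineq1_le l).
    assert (exp (- l) * exp l = 1) by (rewrite <- exp_plus, Rplus_opp_l; apply exp_0). nra. }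
  set (u := sqrt (1 - exp (- l))). set (v := sqrt l).
  assert (Hu0 : 0 <= u) by apply sqrt_pos.
  assert (Hv0 : 0 < v) by (apply sqrt_lt_R0; lra).
  assert (Hu2 : u ^ 2 = 1 - exp (- l)) by (apply pow2_sqrt; lra).
  assert (Hv2 : v ^ 2 = l) by (apply pow2_sqrt; lra).
  assert (Huv : u <= v) by (unfold u, v; apply sqrt_le_1_alt; lra).
  assert (Huv2 : 1 - l <= u * / v <= 1).
  { split.
    - apply Rmult_le_reg_r with v; [exact Hv0|]. rewrite Rmult_assoc, Rinv_l, Rmult_1_r by lra.
      apply Rmult_le_reg_r with v; [exact Hv0|]. nra.
    - apply Rmult_le_reg_r with v; [exact Hv0|]. rewrite Rmult_assoc, Rinv_l by lra. lra. }
  destruct (W_lower x Hx) as [W1 [W2 W3]].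
  set (w := W x) in *.
  assert (HK8 : 2 <= l * INR K).
  { pose proof (t0_pos x Hx) as Ht. unfold t0 in Ht. lra. }
  assert (HLK3 : 3 <= LK).
  { unfold LK. enough (0 <= ln (INR K)) by lra. rewrite <- ln_1.
    assert (1 < INR K) by nra. left. apply ln_increasing; lra. }
  assert (Hmain : Rabs (u * S - 1) <= 71 * v * w * LK).
  { replace (u * S - 1) with (u * (S - / v) + (u * / v - 1)) by ring.
    eapply Rle_trans; [apply Rabs_triang|].
    rewrite Rabs_mult, (Rabs_pos_eq u), (Rabs_left1 (u * / v - 1)) by lra.
    assert (u * Rabs (S - / v) <= v * (70 * w * LK)).
    { apply Rmult_le_compat; [lra|apply Rabs_pos|exact Huv|exact HC]. }
    assert (Hlv : l <= v * / 2) by (rewrite <- Hv2; nra).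
    assert (v * / 2 <= v * (w * LK)) by (apply Rmult_le_compat_l; nra). lra. }
  assert (Hs1 : Cmod (1 - cis x) * w <= 2).
  { unfold w, W. rewrite Rmult_plus_distr_l.
    assert (H1 : Cmod (1 - cis x) <= x).
    { rewrite <- (Rabs_pos_eq x) at 2 by lra. apply Cmod_1_minus_cis_le. }
    assert (H2 : Cmod (1 - cis x) <= 2 * PI - x).
    { replace (cis x) with (cis (x - 2 * PI)).
      - eapply Rle_trans; [apply Cmod_1_minus_cis_le|]. rewrite Rabs_left; lra.
      - replace (x - 2 * PI) with (x - 2 * PI * INR 1) by (simpl; ring).
        rewrite cis_minus, cis_2PI_INR. unfold Cconj; simpl. rewrite Ropp_0. apply Cmult_1_r. }
    assert (Cmod (1 - cis x) * / x <= x * / x).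
    { apply Rmult_le_compat_r; [left; apply Rinv_0_lt_compat; lra|exact H1]. }
    assert (Cmod (1 - cis x) * / (2 * PI - x) <= (2 * PI - x) * / (2 * PI - x)).
    { apply Rmult_le_compat_r; [left; apply Rinv_0_lt_compat; lra|exact H2]. }
    rewrite !Rinv_r in * by lra. lra. }
  pose proof (Cmod_ge_0 (1 - cis x)) as Hs0.
  apply Rle_trans with (71 * v * w * LK * Cmod (1 - cis x)); [now apply Rmult_le_compat_r|].
  replace (71 * v * w * LK * Cmod (1 - cis x)) with (71 * v * LK * (Cmod (1 - cis x) * w)) by ring.
  replace (142 * v * LK) with (71 * v * LK * 2) by ring.
  apply Rmult_le_compat_l; [|exact Hs1].
  apply Rmult_le_pos; [|lra]. lra.
Qed.

(** At distance at least sqrt l from z = 1 the stationary point occurs for l k at most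
    3 + ln(1/l), and K terms go beyond it. *)
Lemma f0_circle l x K : 0 < l <= / 4 -> 5 + ln (/ l) <= l * INR K ->
  sqrt l <= Cmod (1 - cis x) ->
  Rabs (Cmod (peval (bco l K) K (cis x)) - 1) * Cmod (1 - cis x)
   <= 142 * sqrt l * (l * INR K + 3 + ln (INR K)).
Proof.
  intros Hl HK Hs. pose proof PI_4 as HPI4.
  assert (Hv0 : 0 < sqrt l) by (apply sqrt_lt_R0; lra).
  assert (Hex : exists y, 0 < y < 2 * PI /\ cis y = cis x).
  { destruct (cis_reduce x) as [y [Hy Ey]].
    destruct (Rtotal_order y 0) as [H|[H|H]].
    - exists (y + 2 * PI * INR 1). simpl INR. split; [lra|].
      rewrite <- Ey, cis_plus. replace (2 * PI * 1) with (2 * PI * INR 1) by (simpl; ring).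
      rewrite cis_2PI_INR. apply Cmult_1_r.
    - exfalso. subst y. rewrite <- Ey, cis_0 in Hs.
      replace (1 - 1)%C with (RtoC 0) in Hs by ring. rewrite Cmod_0 in Hs. lra.
    - exists y. split; [lra|exact Ey]. }
  destruct Hex as [y [Hy Ey]]. rewrite <- Ey in *.
  apply f0_interval; [exact Hl|exact Hy|].
  assert (Hys : sqrt l <= y).
  { eapply Rle_trans; [exact Hs|]. eapply Rle_trans; [apply Cmod_1_minus_cis_le|].
    rewrite Rabs_pos_eq; lra. }
  assert (Hln : ln (2 * PI / y) <= 3 + ln (/ l)).
  { assert (Hly : l <= y).
    { pose proof (pow2_sqrt l ltac:(lra)) as H2.
      nra. }
    assert (H8 : 2 * PI <= exp 3).
    { pose proof (exp_ineq1_le 1). replace 3 with (1 + 1 + 1) by ring. rewrite !exp_plus. nra. }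
    rewrite <- (ln_exp 3), <- ln_mult; [|apply exp_pos|apply Rinv_0_lt_compat; lra].
    assert (H : 2 * PI / y <= exp 3 * / l).
    { apply Rmult_le_compat; [lra|left; apply Rinv_0_lt_compat; lra|exact H8|].
      apply Rinv_le_contravar; lra. }
    destruct H as [H|H]; [left; apply ln_increasing; [apply Rdiv_lt_0_compat; lra|exact H]|].
    rewrite H. lra. }
  lra.
Qed.

Lemma f0_trivial l x K : 0 < l -> Cmod (peval (bco l K) K (cis x)) <= INR K.
Proof.
  intros Hl. unfold peval. eapply Rle_trans; [apply Cmod_csum|].
  rewrite <- (Rmult_1_r (INR K)). apply rsum_le_bound. intros k Hk.
  rewrite Cmod_mult, Cmod_pow, Cmod_cis, pow1, Rmult_1_r.
  pose proof (bco_sq l K k Hl Hk) as H. pose proof (q_range l Hl) as Hq.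
  assert (Hw : wt l k <= 1).
  { unfold wt. assert (exp (- l) ^ k <= 1) by (apply pow_le_one; lra).
    nra. }
  apply Cmod_sq_le; lra.
Qed.

Lemma chord_lower y : Rabs y <= PI -> 2 / PI * Rabs y <= Cmod (1 - cis y).
Proof.
  intros Hy. pose proof (Rabs_pos y).
  rewrite Cmod_1_minus_cis.
  assert (E : Rabs (sin (y / 2)) = sin (Rabs y / 2)).
  { unfold Rabs at 2. destruct (Rcase_abs y) as [Hy0|Hy0].
    - replace (- y / 2) with (- (y / 2)) by field. rewrite sin_neg. apply Rabs_left1.
      assert (0 <= sin (- (y / 2))).
      { apply sin_ge_0; rewrite Rabs_left in Hy by exact Hy0; lra. }
      rewrite sin_neg in *. lra.
    - apply Rabs_pos_eq. rewrite Rabs_right in Hy by exact Hy0. apply sin_ge_0; lra. }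
  rewrite E. pose proof (sin_lower (Rabs y / 2) ltac:(lra)). lra.
Qed.

(** * Loss of the inner product *)

Lemma sin_parabola t : 0 <= t <= PI -> 2 * (t * (PI - t)) / PI ^ 2 <= sin t.
Proof.
  pose proof PI_RGT_0 as HPI.
  assert (H : forall t, 0 <= t <= PI / 2 -> 2 * (t * (PI - t)) / PI ^ 2 <= sin t).
  { clear t. intros t Ht. eapply Rle_trans; [|apply (sin_lower t Ht)].
    replace (2 * (t * (PI - t)) / PI ^ 2) with (2 / PI * (t * ((PI - t) / PI))) by (field; lra).
    apply Rmult_le_compat_l; [left; apply Rdiv_lt_0_compat; lra|].
    assert ((PI - t) / PI <= 1) by (apply Rle_div_l; lra). nra. }
  intros Ht. destruct (Rle_lt_dec t (PI / 2)) as [H1|H1]; [apply H; lra|].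
  rewrite <- sin_PI_x. replace (t * (PI - t)) with ((PI - t) * (PI - (PI - t))) by ring.
  apply H. lra.
Qed.

(** The parabola below the sine gives 1/|1 - root| <= (L/4)(1/j + 1/(L-j)), a pair of
    harmonic sums. *)
Lemma root_chord_sum L : (1 <= L)%nat ->
  rsum (fun j => / Cmod (1 - root L (S j))) (pred L) <= INR L / 2 * (1 + ln (INR L)).
Proof.
  intros HL. pose proof PI_RGT_0 as HPI.
  assert (HL0 : 0 < INR L) by (apply lt_0_INR; lia).
  apply Rle_trans with (rsum (fun j => INR L / 4 * (/ INR (S j) + / INR (S (pred L - 1 - j)))) (pred L)).
  - apply rsum_le. intros j Hj.
    assert (H1 : 0 < INR (S j)) by (apply lt_0_INR; lia).
    assert (H2 : 0 < INR (S (pred L - 1 - j))) by (apply lt_0_INR; lia).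
    assert (E2 : INR (S (pred L - 1 - j)) = INR L - INR (S j)).
    { rewrite <- minus_INR by lia. f_equal. lia. }
    set (a := INR (S j)) in *. set (b := INR (S (pred L - 1 - j))) in *.
    assert (Hlow : 4 * (a * b / (a + b)) / INR L <= Cmod (1 - root L (S j))).
    { unfold root. fold a. rewrite Cmod_1_minus_cis.
      replace (2 * PI * a / INR L / 2) with (PI * a / INR L) by (field; lra).
      assert (Ht : 0 < PI * a / INR L < PI).
      { split; [apply Rdiv_lt_0_compat; nra|]. apply Rlt_div_l; nra. }
      pose proof (sin_parabola (PI * a / INR L) ltac:(lra)) as H.
      rewrite Rabs_pos_eq by (apply sin_ge_0; lra).
      eapply Rle_trans; [|apply Rmult_le_compat_l; [lra|exact H]].
      right. rewrite E2. field. lra. }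
    replace (INR L / 4 * (/ a + / b)) with (/ (4 * (a * b / (a + b)) / INR L)) by (field; lra).
    apply Rinv_le_contravar; [|exact Hlow].
    apply Rdiv_lt_0_compat; [|lra]. apply Rmult_lt_0_compat; [lra|]. apply Rdiv_lt_0_compat; nra.
  - rewrite rsum_scal, rsum_plus.
    rewrite <- (rsum_rev (fun j => / INR (S j))).
    change (rsum (fun k => / INR (S k)) (pred L)) with (harm (pred L)).
    pose proof (harm_mono (pred L) L ltac:(lia)). pose proof (harm_le L ltac:(lia)).
    replace (INR L / 2 * (1 + ln (INR L))) with (INR L / 4 * (2 * (1 + ln (INR L)))) by field.
    apply Rmult_le_compat_l; lra.
Qed.

(** By Parseval the inner product of f0 h and f0 is the mean of |f0|^2 h over the roots of
    unity.  The loss |f0|^2 |1-h| is bounded pointwise by 2 (|f0|^2 - 1) + Q/|1-z|: away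
    from z = 1 because |f0| is close to 1 and h is close to 1, near z = 1 because
    |1-h| <= 2.  The mean of |f0|^2 - 1 is not positive, so that large values of f0 near
    z = 1 are harmless. *)
Lemma damped_inner l K (h : C -> C) eta H1 L (a : nat -> C) :
  0 < l <= / 4 -> 0 <= eta -> 0 <= H1 -> (1 <= L)%nat -> (K <= L)%nat ->
  (forall z, peval a L z = (peval (bco l K) K z * h z)%C) ->
  (forall x, sqrt l <= Cmod (1 - cis x) ->
     Rabs (Cmod (peval (bco l K) K (cis x)) - 1) * Cmod (1 - cis x) <= eta) ->
  (forall x, Cmod (h (cis x)) <= 1) ->
  (forall x, Cmod (1 - h (cis x)) * Cmod (1 - cis x) <= H1) ->
  rsum (wt l) K - (2 / INR L
      + (2 * sqrt l + (1 + eta / sqrt l) ^ 2 * H1 + 4 * eta) * ((1 + ln (INR L)) / 2))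
   <= Re (csum (fun k => a k * Cconj (bco l K k))%C K).
Proof.
  intros Hl Heta HH1 HL HKL Ha Hf Hh1 Hh2.
  assert (HL0 : 0 < INR L) by (apply lt_0_INR; lia).
  assert (Hv0 : 0 < sqrt l) by (apply sqrt_lt_R0; lra).
  set (f0 := peval (bco l K) K) in *.
  set (Q := 2 * sqrt l + (1 + eta / sqrt l) ^ 2 * H1 + 4 * eta).
  assert (HQ : 0 <= Q).
  { unfold Q. assert (0 <= (1 + eta / sqrt l) ^ 2 * H1) by (apply Rmult_le_pos; [apply pow2_ge_0|lra]). lra. }
  assert (P1 : INR L * Re (csum (fun k => a k * Cconj (bco l K k))%C K) =
     rsum (fun j => Cmod (f0 (root L j)) ^ 2 * Re (h (root L j))) L).
  { pose proof (parseval_inner a (bco l K) L L (le_n L)) as P.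
    assert (Ecs : csum (fun k => a k * Cconj (bco l K k))%C L = csum (fun k => a k * Cconj (bco l K k))%C K).
    { apply csum_zero_tail; [exact HKL|]. intros k Hk. unfold bco.
      destruct (Nat.ltb_spec k K); [lia|].
      replace (Cconj 0) with (RtoC 0) by (unfold Cconj; simpl; now rewrite Ropp_0). ring. }
    rewrite Ecs in P. apply (f_equal Re) in P.
    rewrite re_scal_l in P. rewrite <- P, Re_csum. apply rsum_ext. intros j _.
    rewrite Ha, peval_bco by exact HKL. fold f0.
    replace (f0 (root L j) * h (root L j) * Cconj (f0 (root L j)))%C
      with ((f0 (root L j) * Cconj (f0 (root L j))) * h (root L j))%C by ring.
    rewrite <- Cmod2_conj, re_scal_l. reflexivity. }
  assert (P2 : INR L * rsum (wt l) K = rsum (fun j => Cmod (f0 (root L j)) ^ 2) L).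
  { pose proof (parseval (bco l K) K L HKL) as P. fold f0 in P. rewrite P. f_equal.
    apply rsum_ext. intros k Hk. symmetry. apply bco_sq; [lra|exact Hk]. }
  assert (Hw1 : rsum (wt l) K <= 1).
  { rewrite wt_sum. pose proof (q_range l ltac:(lra)). assert (0 < exp (- l) ^ K) by (apply pow_lt; lra). lra. }
  (* The value at the root 1 is treated apart, since Q/|1-z| has a pole there. *)
  set (g := fun j => 2 * (Cmod (f0 (root L j)) ^ 2 - 1)
     + (if Nat.eq_dec j 0 then 2 else Q * / Cmod (1 - root L j))).
  assert (Hpt : forall j, (j < L)%nat ->
    Cmod (f0 (root L j)) ^ 2 - Cmod (f0 (root L j)) ^ 2 * Re (h (root L j)) <= g j).
  { intros j Hj. unfold root. set (x := 2 * PI * INR j / INR L).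
    assert (Eg : g j = 2 * (Cmod (f0 (cis x)) ^ 2 - 1)
       + (if Nat.eq_dec j 0 then 2 else Q * / Cmod (1 - cis x))) by reflexivity.
    rewrite Eg. set (F := Cmod (f0 (cis x))). set (s := Cmod (1 - cis x)).
    assert (HF0 : 0 <= F) by apply Cmod_ge_0.
    set (R1 := Cmod (1 - h (cis x))).
    assert (HR : 1 - Re (h (cis x)) <= R1).
    { unfold R1. eapply Rle_trans; [|apply re_le_Cmod]. eapply Rle_trans; [|apply Rle_abs].
      right. destruct (h (cis x)). simpl. ring. }
    assert (HR2 : R1 <= 2).
    { unfold R1, Cminus. eapply Rle_trans; [apply Cmod_triangle|].
      rewrite Cmod_opp, Cmod_1. specialize (Hh1 x). lra. }
    assert (HR0 : 0 <= R1) by apply Cmod_ge_0.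
    assert (Hloss : F ^ 2 - F ^ 2 * Re (h (cis x)) <= F ^ 2 * R1).
    { nra. }
    eapply Rle_trans; [exact Hloss|].
    destruct (Nat.eq_dec j 0) as [Hj0|Hj0].
    { nra. }
    assert (Hspos : 0 < s).
    { unfold s. destruct (Req_dec (Cmod (1 - cis x)) 0) as [H0|H0]; [|pose proof (Cmod_ge_0 (1 - cis x)); lra].
      exfalso. rewrite Cmod_1_minus_cis in H0.
      assert (Hx : 0 < x / 2 < PI).
      { pose proof PI_RGT_0. assert (0 < INR j) by (apply lt_0_INR; lia).
        assert (INR j < INR L) by (apply lt_INR; lia).
        replace (x / 2) with (PI * (INR j / INR L)) by (unfold x; field; lra).
        assert (0 < INR j / INR L) by (apply Rdiv_lt_0_compat; lra).
        assert (INR j / INR L < 1).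
        { apply Rlt_div_l; lra. }
        nra. }
      pose proof (sin_gt_0 (x / 2) ltac:(lra) ltac:(lra)).
      rewrite Rabs_pos_eq in H0; lra. }
    assert (Hsi : s * / s = 1) by (apply Rinv_r; lra).
    assert (Hsi0 : 0 < / s) by (apply Rinv_0_lt_compat; lra).
    destruct (Rle_lt_dec (sqrt l) s) as [Hfar|Hnear].
    - specialize (Hf x Hfar). fold F s in Hf. specialize (Hh2 x). fold R1 s in Hh2.
      assert (Hf2 : Rabs (F - 1) <= eta * / s).
      { apply Rmult_le_reg_r with s; [lra|]. rewrite Rmult_assoc, Rinv_l by lra. lra. }
      assert (HR3 : R1 <= H1 * / s).
      { apply Rmult_le_reg_r with s; [lra|]. rewrite Rmult_assoc, Rinv_l by lra. lra. }
      apply Rabs_le_between in Hf2.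
      assert (Hes : eta * / s <= eta / sqrt l).
      { apply Rmult_le_compat_l; [lra|]. apply Rinv_le_contravar; lra. }
      assert (B1 : F ^ 2 * R1 <= (1 + eta / sqrt l) ^ 2 * (H1 * / s)).
      { apply Rmult_le_compat; [apply pow2_ge_0|lra| |exact HR3]. apply pow_incr. lra. }
      assert (B2 : 1 - 2 * (eta * / s) <= F ^ 2).
      { assert (2 * F - 1 <= F ^ 2) by (pose proof (pow2_ge_0 (F - 1)); nra). lra. }
      unfold Q. assert (0 <= 2 * sqrt l * / s) by (apply Rmult_le_pos; lra).
      replace ((2 * sqrt l + (1 + eta / sqrt l) ^ 2 * H1 + 4 * eta) * / s) with
        (2 * sqrt l * / s + (1 + eta / sqrt l) ^ 2 * (H1 * / s) + 4 * (eta * / s)) by ring.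
      lra.
    - assert (H2 : 2 <= Q * / s).
      { apply Rle_trans with (2 * s * / s); [rewrite Rmult_assoc, Hsi; lra|].
        apply Rmult_le_compat_r; [lra|]. unfold Q.
        assert (0 <= (1 + eta / sqrt l) ^ 2 * H1) by (apply Rmult_le_pos; [apply pow2_ge_0|lra]). lra. }
      assert (F ^ 2 * R1 <= F ^ 2 * 2) by (apply Rmult_le_compat_l; [apply pow2_ge_0|exact HR2]). lra. }
  assert (Hsum : INR L * rsum (wt l) K - INR L * Re (csum (fun k => a k * Cconj (bco l K k))%C K)
    <= 2 + Q * (INR L / 2 * (1 + ln (INR L)))).
  { rewrite P1, P2.
    apply Rle_trans with (rsum g L).
    - replace (rsum (fun j => Cmod (f0 (root L j)) ^ 2) L
        - rsum (fun j => Cmod (f0 (root L j)) ^ 2 * Re (h (root L j))) L)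
        with (rsum (fun j => Cmod (f0 (root L j)) ^ 2
            + -1 * (Cmod (f0 (root L j)) ^ 2 * Re (h (root L j)))) L)
        by (rewrite rsum_plus, rsum_scal; ring).
      apply rsum_le. intros j Hj. specialize (Hpt j Hj). lra.
    - unfold g. rewrite rsum_plus, rsum_scal.
      assert (E1 : rsum (fun j => Cmod (f0 (root L j)) ^ 2 - 1) L <= 0).
      { rewrite (rsum_ext _ (fun j => Cmod (f0 (root L j)) ^ 2 + -1)) by (intros; ring).
        rewrite rsum_plus, rsum_const, <- P2. nra. }
      assert (E2 : rsum (fun j => if Nat.eq_dec j 0 then 2 else Q * / Cmod (1 - root L j)) L
        <= 2 + Q * (INR L / 2 * (1 + ln (INR L)))).
      { set (phi := fun j => if Nat.eq_dec j 0 then 2 else Q * / Cmod (1 - root L j)).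
        replace (rsum phi L) with (rsum phi (1 + pred L)) by (f_equal; lia).
        rewrite rsum_add.
        assert (E0 : rsum phi 1 = 2) by (unfold phi; simpl; ring). rewrite E0.
        rewrite (rsum_ext _ (fun j => Q * / Cmod (1 - root L (S j)))) by reflexivity.
        rewrite rsum_scal. pose proof (root_chord_sum L HL).
        assert (Q * rsum (fun j => / Cmod (1 - root L (S j))) (pred L) <= Q * (INR L / 2 * (1 + ln (INR L))))
          by (apply Rmult_le_compat_l; assumption). lra. }
      lra. }
  apply Rmult_le_reg_l with (INR L); [exact HL0|].
  replace (INR L * (rsum (wt l) K - (2 / INR L + Q * ((1 + ln (INR L)) / 2)))) with
    (INR L * rsum (wt l) K - (2 + Q * (INR L / 2 * (1 + ln (INR L))))) by (field; lra).
  lra.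
Qed.

(** * Choice of parameters and the limit *)

Lemma ln_le_minus_one z : 0 < z -> ln z <= z - 1.
Proof. intros H. pose proof (exp_ineq1_le (ln z)) as He. rewrite exp_ln in He by exact H. lra. Qed.

Lemma ln_mono a b : 0 < a -> a <= b -> ln a <= ln b.
Proof. intros Ha [H|H]; [left; now apply ln_increasing|rewrite H; lra]. Qed.

Lemma dyadic_approx z : 1 <= z -> exists n, z <= INR (2 ^ n) <= 2 * z /\ INR n <= 1 + 2 * ln z.
Proof.
  intros Hz.
  assert (H : forall N, z <= 2 ^ N -> exists n, z <= 2 ^ n <= 2 * z).
  { induction N; intros HN.
    - exists O. simpl in *. lra.
    - destruct (Rle_lt_dec z (2 ^ N)) as [H|H]; [now apply IHN|].
      exists (S N). simpl in *. lra. }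
  destruct (INR_unbounded z) as [N HN].
  destruct (H N) as [n Hn].
  { pose proof (bernoulli 1 N ltac:(lra)) as Hb. replace (1 + 1) with 2 in Hb by ring. lra. }
  exists n. rewrite pow_INR. change (INR 2) with 2. split; [exact Hn|].
  assert (E : ln (2 ^ n) = INR n * ln 2).
  { clear. induction n; [simpl; rewrite ln_1; ring|].
    rewrite S_INR. simpl. rewrite ln_mult, IHn by (try apply pow_lt; lra). ring. }
  assert (Hl : ln (2 ^ n) <= ln (2 * z)) by (apply ln_mono; [apply pow_lt; lra|lra]).
  rewrite E, ln_mult in Hl by lra.
  pose proof ln_lt_2 as H2. assert (0 <= ln z) by (rewrite <- ln_1; apply ln_mono; lra).
  apply Rmult_le_reg_r with (ln 2); [lra|]. nra.
Qed.

Lemma PI_sq_le : PI ^ 2 <= 16.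
Proof. pose proof PI_4. pose proof PI_RGT_0. nra. Qed.

(** Far from z = 1 the excess eta/|1-z| of |f0| over 1 is beaten by the damping
    exp(-eta/|1-z|).  At distance less than sqrt l the damping has reached the size
    1/(1+K) because of the logarithm in kap, and the trivial bound |f0| <= K suffices.
    The factor PI^2 comes from comparing |x| with |1-z|. *)
Lemma damped_bound l K n eta (h : C -> C) kap :
  0 < l <= / 4 -> 0 <= eta -> 5 + ln (/ l) <= l * INR K -> (0 < K)%nat ->
  142 * sqrt l * (l * INR K + 3 + ln (INR K)) <= eta ->
  / sqrt l <= INR (2 ^ n) ->
  kap = PI ^ 2 * (eta + sqrt l * ln (1 + INR K)) ->
  (forall x, Cmod (h (cis x)) <= 1) ->
  (forall x B, Rabs x <= PI -> B * PI ^ 2 <= 2 * INR (2 ^ n) -> B * (PI * Rabs x) <= 1 ->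
     Cmod (h (cis x)) <= exp (- (kap / 2 * B))) ->
  forall x, Cmod (peval (bco l K) K (cis x) * h (cis x)) <= 1.
Proof.
  intros Hl Heta HK HK0 HLK HD Ekap Hh1 Hh x0.
  destruct (cis_reduce x0) as [x [Hx <-]]. clear x0.
  pose proof PI_RGT_0 as HPI.
  assert (Hxa : Rabs x <= PI) by (apply Rabs_le; lra).
  assert (Hv0 : 0 < sqrt l) by (apply sqrt_lt_R0; lra).
  assert (HKr : 1 <= INR K) by (apply (le_INR 1); lia).
  assert (Hln : 0 <= ln (1 + INR K)) by (rewrite <- ln_1; apply ln_mono; lra).
  rewrite Cmod_mult. set (F := Cmod (peval (bco l K) K (cis x))). set (s := Cmod (1 - cis x)).
  assert (HF0 : 0 <= F) by apply Cmod_ge_0. assert (Hh0 : 0 <= Cmod (h (cis x))) by apply Cmod_ge_0.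
  pose proof (chord_lower x Hxa) as Hch. fold s in Hch.
  assert (Hch2 : PI * Rabs x <= PI ^ 2 / 2 * s).
  { replace (PI * Rabs x) with (PI ^ 2 / 2 * (2 / PI * Rabs x)) by (field; lra).
    apply Rmult_le_compat_l; [nra|exact Hch]. }
  assert (HP2 : 0 < PI ^ 2) by nra.
  set (s' := Rmax (sqrt l) s).
  assert (Hs1 : sqrt l <= s') by apply Rmax_l. assert (Hs2 : s <= s') by apply Rmax_r.
  assert (Hmain : F <= exp ((eta + sqrt l * ln (1 + INR K)) / s')).
  { assert (Hvl : 0 <= sqrt l * ln (1 + INR K)) by (apply Rmult_le_pos; lra).
    destruct (Rle_lt_dec (sqrt l) s) as [Hfar|Hnear].
    - assert (Es : s' = s) by (apply Rmax_right; exact Hfar).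
      pose proof (f0_circle l x K Hl HK Hfar) as H. fold F s in H.
      assert (Hb : F - 1 <= eta / s).
      { apply Rle_div_r; [lra|]. eapply Rle_trans; [|apply (Rle_trans _ _ _ H HLK)].
        apply Rmult_le_compat_r; [lra|apply Rle_abs]. }
      eapply Rle_trans; [|apply exp_ineq1_le]. rewrite Es.
      assert (eta / s <= (eta + sqrt l * ln (1 + INR K)) / s)
        by (apply Rmult_le_compat_r; [left; apply Rinv_0_lt_compat|]; lra). lra.
    - assert (Es : s' = sqrt l) by (apply Rmax_left; lra). rewrite Es.
      pose proof (f0_trivial l x K ltac:(lra)) as HFb. fold F in HFb.
      apply Rle_trans with (exp (ln (1 + INR K))); [rewrite exp_ln; lra|].
      apply exp_le, Rle_div_r; lra. }
  apply Rle_trans with (exp (kap / 2 * (2 / (PI ^ 2 * s'))) * exp (- (kap / 2 * (2 / (PI ^ 2 * s'))))).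
  - apply Rmult_le_compat; [exact HF0|exact Hh0| |].
    + eapply Rle_trans; [exact Hmain|]. apply exp_le. right. rewrite Ekap. field. lra.
    + apply Hh; [exact Hxa| |].
      * replace (2 / (PI ^ 2 * s') * PI ^ 2) with (2 * / s') by (field; lra).
        assert (/ s' <= / sqrt l) by (apply Rinv_le_contravar; lra). lra.
      * apply Rle_trans with (2 / (PI ^ 2 * s') * (PI ^ 2 / 2 * s')); [|right; field; lra].
        apply Rmult_le_compat_l; [left; apply Rdiv_lt_0_compat; [lra|apply Rmult_lt_0_compat; lra]|].
        eapply Rle_trans; [exact Hch2|]. apply Rmult_le_compat_l; lra.
  - rewrite <- exp_plus, Rplus_opp_r, exp_0. lra.
Qed.

(** All ingredients combined: [Mf_lower] for the polynomial f0 h divided by 1 + l, which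
    is of degree less than L. *)
Lemma lower_parametric p l K n eta kap :
  1 < p < 2 -> 0 < l <= / 4 -> 0 <= eta -> 5 + ln (/ l) <= l * INR K -> (0 < K)%nat ->
  142 * sqrt l * (l * INR K + 3 + ln (INR K)) <= eta ->
  / sqrt l <= INR (2 ^ n) ->
  kap = PI ^ 2 * (eta + sqrt l * ln (1 + INR K)) ->
  exists L : nat, (K <= L)%nat /\
    INR L <= INR K + 1 + (8 * kap * INR (2 ^ n) ^ 2 + 1) * (INR (2 ^ n) + 1) /\
    Rpower (1 / (1 - exp (- l))) (1 - p / 2) * (1 - exp (- l) ^ K - 2 * l
      - 2 * (2 / INR L + (2 * sqrt l + (1 + eta / sqrt l) ^ 2 * (kap * (3 * INR (S n))) + 4 * eta)
         * ((1 + ln (INR L)) / 2)))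
    <= M p (exp (- l * (1 - p / 2))).
Proof.
  intros Hp Hl Heta HK HK0 HLK HD Ekap.
  assert (Hv0 : 0 < sqrt l) by (apply sqrt_lt_R0; lra).
  assert (HKr : 1 <= INR K) by (apply (le_INR 1); lia).
  assert (Hln : 0 <= ln (1 + INR K)) by (rewrite <- ln_1; apply ln_mono; lra).
  assert (Hkap : 0 <= kap).
  { rewrite Ekap. apply Rmult_le_pos; [apply pow2_ge_0|].
    assert (0 <= sqrt l * ln (1 + INR K)) by (apply Rmult_le_pos; lra). lra. }
  destruct (damping n kap Hkap) as [m [h [Hm [Hpoly [Hh1 [Hh2 Hh3]]]]]].
  set (d := S (m * S (2 ^ n))). set (L := (K + d)%nat).
  assert (HKL : (K <= L)%nat) by (unfold L; lia).
  assert (HL1 : 1 <= INR L) by (apply (le_INR 1); lia).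
  exists L. split; [exact HKL|]. split.
  { unfold L, d. rewrite plus_INR, S_INR, mult_INR, S_INR.
    assert (INR m * (INR (2 ^ n) + 1) <= (8 * kap * INR (2 ^ n) ^ 2 + 1) * (INR (2 ^ n) + 1)).
    { apply Rmult_le_compat_r; [pose proof (pos_INR (2 ^ n)); lra|exact Hm]. }
    lra. }
  assert (Hfp : ispoly L (fun z => peval (bco l K) K z * h z)%C).
  { apply ispoly_mult; [exists (bco l K); reflexivity|exact Hpoly]. }
  destruct Hfp as [a Ha].
  assert (Hball : forall x, Cmod (peval a L (cis x)) <= 1).
  { intros x. rewrite <- Ha. now apply (damped_bound l K n eta h kap). }
  destruct (poly_classB L a l ltac:(lra) Hball) as [g Hg].
  pose proof (damped_inner l K h eta (kap * (3 * INR (S n))) L a Hl Heta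
    ltac:(apply Rmult_le_pos; [exact Hkap|pose proof (pos_INR (S n)); lra])
    ltac:(lia) HKL ltac:(intros; symmetry; apply Ha)) as HI.
  specialize (HI ltac:(intros x Hx; eapply Rle_trans; [apply f0_circle; assumption|exact HLK]) Hh1 Hh3).
  set (loss := 2 / INR L + (2 * sqrt l + (1 + eta / sqrt l) ^ 2 * (kap * (3 * INR (S n))) + 4 * eta)
         * ((1 + ln (INR L)) / 2)) in *.
  assert (Hloss : 0 <= loss).
  { unfold loss. assert (0 <= ln (INR L)) by (rewrite <- ln_1; apply ln_mono; lra).
    assert (0 <= (1 + eta / sqrt l) ^ 2 * (kap * (3 * INR (S n)))).
    { apply Rmult_le_pos; [apply pow2_ge_0|]. apply Rmult_le_pos; [exact Hkap|].
      pose proof (pos_INR (S n)). lra. }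
    assert (0 < 2 / INR L) by (apply Rdiv_lt_0_compat; lra).
    apply Rplus_le_le_0_compat; [lra|]. apply Rmult_le_pos; lra. }
  apply Rle_trans with (Mf p g (exp (- l * (1 - p / 2)))); [|apply M_bounds; lra].
  eapply Rle_trans; [|apply (Mf_lower p l Hp ltac:(lra) g (bco l K) K)].
  2:{ intros k Hk. apply bco_sq; [lra|exact Hk]. }
  apply Rmult_le_compat_l; [left; apply T_pos|].
  rewrite (csum_ext _ (fun k => RtoC (/ (1 + l)) * (a k * Cconj (bco l K k)))%C).
  2:{ intros k Hk. rewrite Hg by lia. ring. }
  rewrite csum_scal, re_scal_l.
  set (w := rsum (wt l) K) in *. set (I := Re (csum (fun k => a k * Cconj (bco l K k))%C K)) in *.
  assert (Ew : w = 1 - exp (- l) ^ K) by apply wt_sum.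
  assert (Hw : 0 <= w <= 1).
  { pose proof (q_range l ltac:(lra)). rewrite Ew.
    assert (0 < exp (- l) ^ K) by (apply pow_lt; lra).
    assert (exp (- l) ^ K <= 1) by (apply pow_le_one; lra). lra. }
  set (i := / (1 + l)).
  assert (Hi : 1 - l <= i <= 1).
  { unfold i. split.
    - apply Rmult_le_reg_r with (1 + l); [lra|]. rewrite Rinv_l by lra. nra.
    - rewrite <- Rinv_1. apply Rinv_le_contravar; lra. }
  assert (H1 : i * (w - loss) <= i * I) by (apply Rmult_le_compat_l; lra).
  assert (H2 : (1 - l) * w <= i * w) by (apply Rmult_le_compat_r; lra).
  assert (H3 : i * loss <= 1 * loss) by (apply Rmult_le_compat_r; lra).
  assert (H4 : l * w <= l * 1) by (apply Rmult_le_compat_l; lra).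
  assert (H6 : p * (w - l - loss) <= p * (i * I)) by (apply Rmult_le_compat_l; lra).
  assert (H7 : p * (l + loss) <= 2 * (l + loss)) by (apply Rmult_le_compat_r; lra).
  lra.
Qed.

(** K and 2^n are taken of order ln(1/l)/l and l^(-1/2).  The constants are crude; what
    matters is the power l^(1/2), up to a power of the logarithm y. *)
Lemma lower_bound p l : 1 < p < 2 -> 0 < l <= / 4 ->
  Rpower (1 / (1 - exp (- l))) (1 - p / 2)
    * (1 - 30000000000000 * sqrt l * (1 + ln (/ l)) ^ 5) <= M p (exp (- l * (1 - p / 2))).
Proof.
  intros Hp Hl.
  set (v := sqrt l). set (La := ln (/ l)). set (y := 1 + La). set (z := / l).
  assert (Hv0 : 0 < v) by (apply sqrt_lt_R0; lra).
  assert (Hv2 : v ^ 2 = l) by (apply pow2_sqrt; lra).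
  assert (Hv1 : v <= / 2) by nra.
  assert (Hlv : l <= v) by nra.
  assert (Hz : 4 <= z) by (unfold z; rewrite <- (Rinv_inv 4); apply Rinv_le_contravar; lra).
  assert (Hlz : l * z = 1) by (unfold z; apply Rinv_r; lra).
  assert (HLa : 1 <= La).
  { unfold La. fold z. apply Rle_trans with (ln (2 * 2)).
    - rewrite ln_mult by lra. pose proof ln_lt_2. lra.
    - apply ln_mono; lra. }
  assert (Hyz : y <= z) by (unfold y, La; fold z; pose proof (ln_le_minus_one z ltac:(lra)); lra).
  assert (Hy : 2 <= y) by (unfold y; lra).
  destruct (nfloor_ex ((5 + La) / l)) as [k0 [F1 F2]].
  { apply Rmult_le_pos; [lra|left; apply Rinv_0_lt_compat; lra]. }
  set (K := S k0).
  assert (EK : INR K = INR k0 + 1) by apply S_INR.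
  assert (G1 : 5 + La <= l * INR K).
  { rewrite EK. apply Rmult_lt_compat_l with (r := l) in F2; [|lra].
    replace (l * ((5 + La) / l)) with (5 + La) in F2 by (field; lra). lra. }
  assert (G2 : l * INR K <= 6 + La).
  { rewrite EK. apply Rmult_le_compat_l with (r := l) in F1; [|lra].
    replace (l * ((5 + La) / l)) with (5 + La) in F1 by (field; lra). lra. }
  assert (HK6 : INR K <= 6 * y * z).
  { apply Rmult_le_reg_l with l; [lra|]. replace (l * (6 * y * z)) with (6 * y * (l * z)) by ring.
    rewrite Hlz. unfold y. lra. }
  assert (HK5 : 5 * z <= INR K).
  { apply Rmult_le_reg_l with l; [lra|]. replace (l * (5 * z)) with (5 * (l * z)) by ring.
    rewrite Hlz. lra. }
  assert (HlnK : ln (INR K) <= 5 * y).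
  { apply Rle_trans with (ln (6 * y * z)); [apply ln_mono; lra|].
    rewrite (ln_mult (6 * y)), (ln_mult 6) by lra. pose proof (ln_le_minus_one 6 ltac:(lra)).
    pose proof (ln_le_minus_one y ltac:(lra)).
    assert (ln z = La) by reflexivity. unfold y in *. lra. }
  assert (HlnK1 : ln (1 + INR K) <= 6 * y).
  { apply Rle_trans with (ln (2 * INR K)); [apply ln_mono; lra|].
    rewrite ln_mult by lra. pose proof (ln_le_minus_one 2 ltac:(lra)). lra. }
  assert (HlnK1p : 0 <= ln (1 + INR K)) by (rewrite <- ln_1; apply ln_mono; lra).
  assert (HlnKp : 0 <= ln (INR K)) by (rewrite <- ln_1; apply ln_mono; lra).
  set (LK := l * INR K + 3 + ln (INR K)).
  assert (HLK : 0 <= LK <= 14 * y) by (unfold LK, y in *; lra).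
  set (eta := 142 * v * LK).
  assert (Heta : 0 <= eta <= 2000 * (v * y)).
  { unfold eta. split; [apply Rmult_le_pos; lra|].
    assert (v * LK <= v * (14 * y)) by (apply Rmult_le_compat_l; lra).
    assert (0 <= v * y) by (apply Rmult_le_pos; lra). lra. }
  set (kap := PI ^ 2 * (eta + v * ln (1 + INR K))).
  assert (Hvln : 0 <= v * ln (1 + INR K) <= 6 * (v * y)).
  { split; [apply Rmult_le_pos; lra|].
    replace (6 * (v * y)) with (v * (6 * y)) by ring. apply Rmult_le_compat_l; lra. }
  assert (Hkap : 0 <= kap <= 32100 * (v * y)).
  { unfold kap. pose proof PI_sq_le. pose proof (pow2_ge_0 PI).
    split; [apply Rmult_le_pos; lra|].
    apply Rle_trans with (16 * (2006 * (v * y))); [apply Rmult_le_compat; lra|].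
    lra. }
  destruct (dyadic_approx (/ v)) as [n [[D1 D2] Dn]].
  { rewrite <- Rinv_1. apply Rinv_le_contravar; lra. }
  assert (HlnV : 2 * ln (/ v) = La).
  { unfold La. rewrite !ln_Rinv by lra. rewrite <- Hv2.
    replace (v ^ 2) with (v * v) by ring. rewrite ln_mult by lra. ring. }
  rewrite HlnV in Dn.
  assert (HSn : INR (S n) <= 2 * y) by (rewrite S_INR; unfold y in *; lra).
  destruct (lower_parametric p l K n eta kap Hp Hl ltac:(lra) G1 ltac:(unfold K; lia)
    ltac:(unfold eta, v, LK; lra) D1 eq_refl) as [L [HKL [HL HM]]].
  eapply Rle_trans; [|exact HM].
  apply Rmult_le_compat_l; [left; apply T_pos|]. fold v.
  (* L is at most polynomial in 1/l, so its logarithm is of order y. *)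
  assert (HKLr : INR K <= INR L) by (apply le_INR; exact HKL).
  assert (HLb : INR L <= 8000000 * z ^ 3).
  { eapply Rle_trans; [exact HL|].
    assert (Hvz : / v <= z) by (apply Rinv_le_contravar; lra).
    assert (Hiv2 : (/ v) ^ 2 = z) by (unfold z; rewrite <- Hv2; field; lra).
    set (D := INR (2 ^ n)) in *.
    assert (HDsq : D ^ 2 <= 4 * z).
    { replace (4 * z) with ((2 * / v) ^ 2) by (rewrite Rpow_mult_distr, Hiv2; ring).
      apply pow_incr. split; [apply pos_INR|exact D2]. }
    assert (Hz2 : 16 <= z ^ 2) by (replace 16 with (4 ^ 2) by ring; apply pow_incr; lra).
    assert (HD1 : D + 1 <= 3 * z) by lra.
    assert (Hvy : v * y <= 1 * z) by (apply Rmult_le_compat; lra).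
    assert (HkD : 8 * kap * D ^ 2 + 1 <= 1030000 * z ^ 2).
    { assert (kap * D ^ 2 <= (32100 * z) * (4 * z)).
      { apply Rmult_le_compat; [lra|apply pow2_ge_0|lra|exact HDsq]. }
      replace (32100 * z * (4 * z)) with (128400 * z ^ 2) in H by ring. lra. }
    assert (HKz : INR K + 1 <= 7 * z ^ 2).
    { assert (6 * y * z <= 6 * z * z) by (apply Rmult_le_compat_r; lra).
      replace (6 * z * z) with (6 * z ^ 2) in H by ring. lra. }
    assert ((8 * kap * D ^ 2 + 1) * (D + 1) <= 1030000 * z ^ 2 * (3 * z)).
    { apply Rmult_le_compat; [|lra|exact HkD|exact HD1].
      assert (0 <= kap * D ^ 2) by (apply Rmult_le_pos; [lra|apply pow2_ge_0]). lra. }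
    assert (1 * z ^ 2 <= z * z ^ 2) by (apply Rmult_le_compat_r; lra).
    replace (z * z ^ 2) with (z ^ 3) in H0 by ring.
    replace (1030000 * z ^ 2 * (3 * z)) with (3090000 * z ^ 3) in H by ring. lra. }
  assert (HlnL : 0 <= ln (INR L) <= 26 * y).
  { split; [rewrite <- ln_1; apply ln_mono; lra|].
    apply Rle_trans with (ln (8000000 * z ^ 3)); [apply ln_mono; lra|].
    assert (H8 : ln 8000000 <= 23).
    { rewrite <- (ln_exp 23). apply ln_mono; [lra|].
      assert (E : exp 23 = exp 1 ^ 23).
      { replace 23 with (INR 23 * 1) by (simpl; ring).
        generalize 23%nat. intros j. induction j; [simpl; rewrite Rmult_0_l; apply exp_0|].
        rewrite S_INR, Rmult_plus_distr_r, exp_plus, IHj. simpl. rewrite Rmult_1_l. ring. }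
      rewrite E. apply Rle_trans with (2 ^ 23); [lra|]. apply pow_incr.
      pose proof (exp_ineq1_le 1). lra. }
    replace (z ^ 3) with (z * z * z) by ring.
    assert (Hzz : 0 < z * z) by (apply Rmult_lt_0_compat; lra).
    rewrite (ln_mult 8000000), (ln_mult (z * z)), (ln_mult z) by lra.
    assert (ln z = La) by reflexivity. unfold y in *. lra. }
  assert (Hyp : forall j, y ^ j <= y ^ S j).
  { intros j. simpl. rewrite <- (Rmult_1_l (y ^ j)) at 1.
    apply Rmult_le_compat_r; [apply pow_le|]; lra. }
  assert (Hy2 : y <= y ^ 2) by (pose proof (Hyp 1%nat) as H1; rewrite pow_1 in H1; exact H1).
  pose proof (Hyp 2%nat) as Hy3.
  pose proof (Hyp 3%nat) as Hy4.
  pose proof (Hyp 4%nat) as Hy5.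
  assert (HH1 : 0 <= kap * (3 * INR (S n)) <= 192600 * (v * y ^ 2)).
  { pose proof (pos_INR (S n)). split; [apply Rmult_le_pos; lra|].
    replace (192600 * (v * y ^ 2)) with (32100 * (v * y) * (3 * (2 * y))) by ring.
    apply Rmult_le_compat; lra. }
  assert (Hev : 0 <= 1 + eta / v <= 2001 * y).
  { assert (0 <= eta / v <= 2000 * y).
    { split; [apply Rmult_le_pos; [lra|left; apply Rinv_0_lt_compat; lra]|].
      apply Rmult_le_reg_r with v; [lra|]. unfold Rdiv. rewrite Rmult_assoc, Rinv_l by lra. lra. }
    lra. }
  assert (HQ : 2 * v + (1 + eta / v) ^ 2 * (kap * (3 * INR (S n))) + 4 * eta <= 800000000000 * (v * y ^ 4)).
  { assert (H1 : (1 + eta / v) ^ 2 * (kap * (3 * INR (S n))) <= (2001 * y) ^ 2 * (192600 * (v * y ^ 2))).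
    { apply Rmult_le_compat; [apply pow2_ge_0|lra|apply pow_incr; lra|lra]. }
    replace ((2001 * y) ^ 2 * (192600 * (v * y ^ 2))) with (771170592600 * (v * y ^ 4)) in H1 by ring.
    assert (v * y <= v * y ^ 4) by (apply Rmult_le_compat_l; lra).
    assert (v * 1 <= v * y ^ 4) by (apply Rmult_le_compat_l; lra). lra. }
  assert (HQL : (2 * v + (1 + eta / v) ^ 2 * (kap * (3 * INR (S n))) + 4 * eta) * ((1 + ln (INR L)) / 2)
     <= 11000000000000 * (v * y ^ 5)).
  { apply Rle_trans with (800000000000 * (v * y ^ 4) * (27 / 2 * y)).
    - apply Rmult_le_compat; [|lra|exact HQ|lra].
      assert (0 <= (1 + eta / v) ^ 2 * (kap * (3 * INR (S n)))) by (apply Rmult_le_pos; [apply pow2_ge_0|lra]).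
      lra.
    - replace (800000000000 * (v * y ^ 4) * (27 / 2 * y)) with (10800000000000 * (v * y ^ 5)) by field.
      assert (0 <= v * y ^ 5) by (apply Rmult_le_pos; lra). lra. }
  assert (H2L : 2 / INR L <= l).
  { apply Rmult_le_reg_r with (INR L); [lra|]. unfold Rdiv. rewrite Rmult_assoc, Rinv_l by lra. nra. }
  assert (HqK : exp (- l) ^ K <= l).
  { assert (E : forall j, exp (- l) ^ j = exp (- (l * INR j))).
    { intros j. induction j; [simpl; rewrite Rmult_0_r, Ropp_0, exp_0; reflexivity|].
      rewrite S_INR. simpl. rewrite IHj, <- exp_plus. f_equal. ring. }
    rewrite E. apply Rle_trans with (exp (- La)); [apply exp_le; lra|].
    unfold La. rewrite exp_Ropp, exp_ln by (apply Rinv_0_lt_compat; lra). rewrite Rinv_inv. lra. }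
  assert (Hvy5 : v * 1 <= v * y ^ 5) by (apply Rmult_le_compat_l; lra).
  replace (30000000000000 * v * y ^ 5) with (30000000000000 * (v * y ^ 5)) by ring.
  lra.
Qed.

Lemma T_upper p l : 1 < p < 2 -> 0 < l <= / 4 ->
  Rpower (1 / (1 - exp (- l))) (1 - p / 2) <= 2 * exp ((1 - p / 2) * ln (/ l)).
Proof.
  intros Hp Hl.
  assert (Hq : l / 2 <= 1 - exp (- l)).
  { pose proof (exp_ineq1_le l).
    assert (exp (- l) * exp l = 1) by (rewrite <- exp_plus, Rplus_opp_l; apply exp_0). nra. }
  assert (H1 : 1 / (1 - exp (- l)) <= 2 * / l).
  { unfold Rdiv. rewrite Rmult_1_l. replace (2 * / l) with (/ (l / 2)) by (field; lra).
    apply Rinv_le_contravar; lra. }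
  assert (H0 : 0 < 1 / (1 - exp (- l))) by (apply Rdiv_lt_0_compat; lra).
  unfold Rpower.
  assert (H2 : ln (1 / (1 - exp (- l))) <= ln 2 + ln (/ l)).
  { rewrite <- ln_mult by (try apply Rinv_0_lt_compat; lra). now apply ln_mono. }
  pose proof ln_lt_2 as Hl2.
  apply Rle_trans with (exp (ln 2 + (1 - p / 2) * ln (/ l))).
  - apply exp_le. assert ((1 - p / 2) * ln (1 / (1 - exp (- l))) <= (1 - p / 2) * (ln 2 + ln (/ l)))
      by (apply Rmult_le_compat_l; lra).
    assert ((1 - p / 2) * ln 2 <= 1 * ln 2) by (apply Rmult_le_compat_r; lra). lra.
  - rewrite exp_plus, exp_ln by lra. lra.
Qed.

(** One sixth of the exponential absorbs each of the five factors 1 + t, and one sixth is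
    left over. *)
Lemma decay b t : 0 < b <= 1 -> 0 <= t ->
  exp (- b * t) * (1 + t) ^ 5 <= (6 / b) ^ 5 * / (1 + b * t / 6).
Proof.
  intros Hb Ht. set (u := b * t / 6). assert (Hu : 0 <= u) by (unfold u; nra).
  assert (H6 : 6 <= 6 / b).
  { apply Rmult_le_reg_r with b; [lra|]. unfold Rdiv. rewrite Rmult_assoc, Rinv_l by lra. lra. }
  assert (H1 : 1 + t <= 6 / b * exp u).
  { apply Rle_trans with (6 / b * (1 + u)).
    - replace (6 / b * (1 + u)) with (6 / b + t) by (unfold u; field; lra). lra.
    - apply Rmult_le_compat_l; [lra|apply exp_ineq1_le]. }
  assert (H2 : (1 + t) ^ 5 <= (6 / b * exp u) ^ 5) by (apply pow_incr; lra).
  assert (E : exp (- b * t) * (6 / b * exp u) ^ 5 = (6 / b) ^ 5 * exp (- u)).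
  { rewrite Rpow_mult_distr.
    replace (- b * t) with (- u + - u + - u + - u + - u + - u) by (unfold u; field).
    rewrite !exp_plus. assert (He : exp (- u) * exp u = 1) by (rewrite <- exp_plus, Rplus_opp_l; apply exp_0).
    replace (exp (- u) * exp (- u) * exp (- u) * exp (- u) * exp (- u) * exp (- u) * ((6 / b) ^ 5 * exp u ^ 5))
      with ((6 / b) ^ 5 * exp (- u) * (exp (- u) * exp u) ^ 5) by ring.
    rewrite He, pow1. ring. }
  apply Rle_trans with (exp (- b * t) * (6 / b * exp u) ^ 5).
  - apply Rmult_le_compat_l; [left; apply exp_pos|exact H2].
  - rewrite E. apply Rmult_le_compat_l; [apply pow_le; lra|].
    rewrite exp_Ropp. apply Rinv_le_contravar; [lra|apply exp_ineq1_le].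
Qed.

(** The gap is at most of order l^(-(1-p/2)) l^(1/2) = l^((p-1)/2), up to logarithms.
    With t = ln(1/l) this is the decay of exp(-b t) for b = (p-1)/2. *)
Lemma gap_small p eps : 1 < p < 2 -> 0 < eps -> exists l0, 0 < l0 <= / 4 /\
  forall l, 0 < l <= l0 ->
    Rabs (M p (exp (- l * (1 - p / 2))) - Rpower (1 / (1 - exp (- l))) (1 - p / 2)) < eps.
Proof.
  intros Hp Heps. set (b := (p - 1) / 2). assert (Hb : 0 < b <= 1) by (unfold b; lra).
  set (C0 := 60000000000000 * (6 / b) ^ 5).
  assert (HC0 : 0 < C0).
  { unfold C0. apply Rmult_lt_0_compat; [lra|]. apply pow_lt, Rdiv_lt_0_compat; lra. }
  set (t1 := 6 * C0 / (b * eps)).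
  assert (Ht1 : 0 < t1) by (apply Rdiv_lt_0_compat; nra).
  exists (Rmin (/ 4) (exp (- t1))). split; [split; [apply Rmin_glb_lt; [lra|apply exp_pos]|apply Rmin_l]|].
  intros l [Hl0 Hl1].
  assert (Hl4 : l <= / 4) by (eapply Rle_trans; [exact Hl1|apply Rmin_l]).
  assert (Hle : l <= exp (- t1)) by (eapply Rle_trans; [exact Hl1|apply Rmin_r]).
  set (t := ln (/ l)).
  assert (Ht : t1 <= t).
  { unfold t. rewrite ln_Rinv by lra. apply ln_mono in Hle; [|lra]. rewrite ln_exp in Hle. lra. }
  pose proof (lower_bound p l Hp ltac:(lra)) as HL. fold t in HL.
  pose proof (T_upper p l Hp ltac:(lra)) as HT. fold t in HT.
  assert (HU : M p (exp (- l * (1 - p / 2))) <= Rpower (1 / (1 - exp (- l))) (1 - p / 2)).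
  { (* Any member of the class gives access to the upper bound, for instance 0. *)
    destruct (poly_classB 0 (fun _ => RtoC 0) 1 ltac:(lra)) as [g _].
    - intros x. unfold peval. simpl. rewrite Cmod_0. lra.
    - apply (M_bounds p l Hp Hl0 g). }
  set (T := Rpower (1 / (1 - exp (- l))) (1 - p / 2)) in *.
  assert (Hsl : sqrt l = exp (- (t / 2))).
  { unfold t. rewrite ln_Rinv by lra.
    replace (- (- ln l / 2)) with (/ 2 * ln l) by field.
    change (exp (/ 2 * ln l)) with (Rpower l (/ 2)). symmetry. apply Rpower_sqrt. exact Hl0. }
  assert (Hgap : T * (30000000000000 * sqrt l * (1 + t) ^ 5) < eps).
  { assert (Hpos : 0 <= sqrt l * (1 + t) ^ 5).
    { apply Rmult_le_pos; [apply sqrt_pos|apply pow_le; lra]. }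
    apply Rle_lt_trans with (2 * exp ((1 - p / 2) * t) * (30000000000000 * (sqrt l * (1 + t) ^ 5))).
    - rewrite (Rmult_assoc _ (sqrt l)). apply Rmult_le_compat_r; [lra|exact HT].
    - rewrite Hsl.
      replace (2 * exp ((1 - p / 2) * t) * (30000000000000 * (exp (- (t / 2)) * (1 + t) ^ 5)))
        with (60000000000000 * (exp ((1 - p / 2) * t) * exp (- (t / 2)) * (1 + t) ^ 5)) by ring.
      rewrite <- exp_plus.
      replace ((1 - p / 2) * t + - (t / 2)) with (- b * t) by (unfold b; field).
      pose proof (decay b t Hb ltac:(lra)) as HD.
      apply Rle_lt_trans with (C0 * / (1 + b * t / 6)).
      + unfold C0. rewrite Rmult_assoc. apply Rmult_le_compat_l; [lra|exact HD].
      + apply Rmult_lt_reg_r with (1 + b * t / 6); [nra|].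
        rewrite Rmult_assoc, Rinv_l by nra.
        assert (Hbt : C0 / eps <= b * t / 6).
        { replace (C0 / eps) with (b * t1 / 6) by (unfold t1; field; lra). nra. }
        assert (C0 = eps * (C0 / eps)) by (field; lra). nra. }
  rewrite Rabs_left1 by lra. lra.
Qed.

Theorem mainTheorem3 (p : R) (hp : 1 < p < 2) :
  filterlim
    (fun r : R =>
       M p r - Rpower (1 / (1 - Rpower r (2 / (2 - p)))) (1 - p / 2))
    (at_left 1) (locally 0).
Proof.
  apply filterlim_locally. intros eps.
  destruct (gap_small p eps hp (cond_pos eps)) as [l0 [Hl0 H]].
  assert (Hd : 0 < Rmin (/ 2) (l0 * (2 - p) / 4)).
  { apply Rmin_glb_lt; [lra|]. assert (0 < l0 * (2 - p)) by (apply Rmult_lt_0_compat; lra). lra. }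
  exists (mkposreal _ Hd). intros r Hr Hr1.
  change (Rabs (r - 1) < Rmin (/ 2) (l0 * (2 - p) / 4)) in Hr.
  rewrite Rabs_left in Hr by lra.
  assert (Hr2 : - (r - 1) < / 2) by (eapply Rlt_le_trans; [exact Hr|apply Rmin_l]).
  assert (Hr3 : - (r - 1) < l0 * (2 - p) / 4) by (eapply Rlt_le_trans; [exact Hr|apply Rmin_r]).
  set (c := 2 / (2 - p)). assert (Hc : 0 < c) by (apply Rdiv_lt_0_compat; lra).
  set (l := - (c * ln r)).
  assert (Hln : ln r < 0) by (rewrite <- ln_1; apply ln_increasing; lra).
  assert (Hln2 : - ln r <= 2 * - (r - 1)).
  { rewrite <- ln_Rinv by lra. eapply Rle_trans; [apply ln_le_minus_one, Rinv_0_lt_compat; lra|].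
    apply Rmult_le_reg_r with r; [lra|]. rewrite Rmult_minus_distr_r, Rinv_l by lra. nra. }
  assert (Hl : 0 < l <= l0).
  { unfold l. split; [nra|].
    apply Rle_trans with (c * (2 * - (r - 1))); [nra|].
    apply Rle_trans with (c * (2 * (l0 * (2 - p) / 4))); [apply Rmult_le_compat_l; lra|].
    right. unfold c. field. lra. }
  specialize (H l Hl).
  replace (exp (- l * (1 - p / 2))) with r in H.
  2:{ replace (- l * (1 - p / 2)) with (ln r) by (unfold l, c; field; lra). symmetry. apply exp_ln. lra. }
  replace (exp (- l)) with (Rpower r c) in H by (unfold Rpower, l; f_equal; ring).
  unfold ball; simpl; unfold AbsRing_ball, abs, minus, plus, opp; simpl.
  fold c. rewrite Ropp_0, Rplus_0_r. exact H.
Qed.
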